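(* Let $\mathfrak{g}$ be a simple finite-dimensional complex Lie algebra of rank $N$ with root system $\Phi$, $\bar\rho:\mathrm{SL}(2,\mathbb{C})\to\mathrm{Aut}(\mathfrak{g})$ a homomorphism, $\Gamma$ a polyhedral group and $P$ a relative invariant form of degree $|\Gamma|$ vanishing on a $\Gamma$-orbit. The automorphic Lie algebra $\mathfrak{g}[X,Y,P^{-1}]^{B\Gamma}_0$ is generated as a free $\mathbb{C}[\mathbb{I}]$-module by elements $h_i(X,Y)$ and $\bar a_\alpha(X,Y)$ where $i=1,\ldots,N$ and $\alpha\in\Phi$. The $\mathbb{C}[\mathbb{I}]$-linear Lie structure is given by the brackets $$\begin{array}{rll} [h_i,h_j]&=0,\\ {[}h_i,\bar a_\alpha]&=\alpha(H_i)\,\bar a_\alpha,\\ {[}\bar a_\alpha,\bar a_{-\alpha}]&=\mathbb{I}^{\omega^2(\alpha,-\alpha)}h_\alpha,\\ {[}\bar a_\alpha,\bar a_\beta]&=\epsilon(\alpha,\beta)\,\mathbb{I}^{\omega^2(\alpha,\beta)}\,\bar a_{\alpha+\beta},&\alpha+\beta\in\Phi,\\ {[}\bar a_\alpha,\bar a_\beta]&=0,&\alpha+\beta\notin\Phi\cup\{0\}, \end{array}$$ where $\omega^2=\mathsf{d}\big(\frac1\nu\circ\mathsf{n}\circ k\big)$ is the symmetric $2$-cocycle on the root system $\Phi$ with components $\omega^2(\alpha,\beta)_i=\frac{1}{\nu_i}\big(\mathsf{n}(k(\beta))_i-\mathsf{n}(k(\alpha+\beta))_i+\mathsf{n}(k(\alpha))_i\big)$,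 $i\in\Omega$, and $\mathbb{I}^{\omega^2(\alpha,\beta)}$ denotes the product $\prod_{i\in\Omega}\mathbb{I}_i^{\omega^2(\alpha,\beta)_i}$ with $\mathbb{I}_i=P_i^{\nu_i}P^{-1}$.
   Context: $\Gamma\subset \mathrm{SO}(3)$ is a polyhedral group, i.e. a finite subgroup, and $B\Gamma\subset\mathrm{SU}(2)$ is its full preimage under the double cover $\mathrm{SU}(2)\to\mathrm{SO}(3)$, so $\Gamma\cong B\Gamma/\{\pm\mathrm{Id}\}$ acts on the Riemann sphere (the complex projective line of lines in $\mathbb{C}^2$). $\Omega$ indexes the $\Gamma$-orbits $S_i$ whose elements have nontrivial stabiliser; $d_i=|S_i|$, $\nu_i$ is the stabiliser order, $d_i\nu_i=|\Gamma|$; $P_i\in\mathbb{C}[X,Y]$ is a homogeneous polynomial of degree $d_i$ vanishing on $S_i$ (a ground form). $B\Gamma$ acts on $\mathbb{C}[X,Y]$ by $(\gamma f)(v)=f(\gamma^{-1}v)$, $v=(X,Y)^T$. $S$ is any $\Gamma$-orbit on the sphere and $P$ is a homogeneous polynomial of degree $|\Gamma|$ vanishing on $S$ which each $\gamma\in B\Gamma$ multiplies by a scalar (unique up to a nonzero scalar). The ring $\mathbb{C}[X,Y,P^{-1}]^{B\Gamma}_0$ of invariants of homogeneous degree $0$ is a polynomial ring $\mathbb{C}[\mathbb{I}]$ in one variable; $\mathbb{I}$ can be chosen to be any nonconstant quotient $P_i^{\nu_i}P^{-1}$. $\mathfrak{g}[X,Y,P^{-1}]=\mathfrak{g}\otimes_{\mathbb{C}}\mathbb{C}[X,Y,P^{-1}]$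 carries the $\mathbb{C}[X,Y,P^{-1}]$-bilinear bracket and the action $(\gamma\cdot f)(v)=\bar\rho(\gamma)f(\gamma^{-1}v)$ of $B\Gamma$; subscript $0$ denotes homogeneous degree $0$ in $X,Y$ and superscript $B\Gamma$ invariants. $H,E,F$ are the images under the derivative $\mathrm{d}\bar\rho$ of $\begin{pmatrix}1&0\\0&-1\end{pmatrix},\begin{pmatrix}0&1\\0&0\end{pmatrix},\begin{pmatrix}0&0\\1&0\end{pmatrix}$. Choose a Cartan subalgebra $\mathfrak{h}$ of $\mathfrak{g}$ with $H\in\mathrm{ad}(\mathfrak{h})$, with root system $\Phi$, and a Chevalley basis $\{H_i,A_\alpha : i=1,\ldots,N,\ \alpha\in\Phi\}$ with brackets $[H_i,H_j]=0$, $[H_i,A_\alpha]=\alpha(H_i)A_\alpha$, $[A_\alpha,A_{-\alpha}]=H_\alpha$ (the coroot of $\alpha$), $[A_\alpha,A_\beta]=\epsilon(\alpha,\beta)A_{\alpha+\beta}$ if $\alpha+\beta\in\Phi$, and $[A_\alpha,A_\beta]=0$ if $\alpha+\beta\notin\Phi\cup\{0\}$. $k(\alpha)$ is the $H$-eigenvalue of $A_\alpha$, and $k(0)=0$. $\Phi_{P,\bar\rho}=\bar\rho(\Phi_{P,1})$ with $\Phi_{P,1}=\begin{pmatrix}\frac{\partial_YP}{\deg(P)P}&X\\-\frac{\partial_XP}{\deg(P)P}&Y\end{pmatrix}$ (determinant $1$), i.e. $\Phi_{P,\bar\rho}=\exp[\frac{X}{Y}E]\exp[-\frac{Y\partial_XP}{\deg(P)P}F]\exp[-\ln(Y)H]$,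 where $\exp[-\ln(Y)H]$ multiplies the $k$-eigenspace of $H$ by $Y^{-k}$. $\mathsf{n}:2\mathbb{Z}\to\prod_{i\in\Omega}\{0,\ldots,\nu_i-1\}$ is the periodic map extending $2\mapsto(1,\ldots,1)$, given explicitly as follows: $\mathsf{n}(k)_i$ is the residue of $k/2$ modulo $\nu_i$ for every $\Gamma$ other than a cyclic group of even order; for $\Gamma$ cyclic of order $2m$ (where $\nu_1=\nu_2=2m$), $\mathsf{n}(k)_i\in\{0,\ldots,m-1\}$ is the residue of $k/2$ modulo $m$. The map $\frac1\nu$ divides component $i$ by $\nu_i$, and $(\mathsf{d}f)(\alpha,\beta)=f(\beta)-f(\alpha+\beta)+f(\alpha)$. The cocycle $\omega^2$ takes values in $\{0,1\}^{|\Omega|}$, except when $\Gamma$ is cyclic of even order, in which case each value is $(0,0)$ or $(1/2,1/2)$. For even $k$, $P_k=P^{\ell}\prod_{i\in\Omega}P_i^{\mathsf{n}(k)_i}$ with $\ell=(k-\sum_i\mathsf{n}(k)_id_i)/|\Gamma|$; for odd $k$, $P_k=0$. Put $h_i=\Phi_{P,\bar\rho}(H_i)$, $h_\alpha=\Phi_{P,\bar\rho}(H_\alpha)$ and $\bar a_\alpha=P_{k(\alpha)}\Phi_{P,\bar\rho}(A_\alpha)$. Thus $\bar a_\alpha=0$ when $k(\alpha)$ is odd, and it is the nonzero elements among the $h_i$ and $\bar a_\alpha$ that form the module basis; $\mathsf{n}$, and hence $\omega^2$, refers to even eigenvalues (the main case of interest being that $k(\alpha)$ is even for all roots $\alpha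$).
   Formalization: For Γ cyclic of even order 2m, n(k)_i is the residue of k/2 modulo ν_i = 2m, not modulo m (with m, P_{-2} or P_2 is not invariant and the claim fails for every nontrivial ρ̄), so ω² is integral there too; the zero set of P is exactly the orbit. *)

(* Defs.v *)
From HB Require Import structures.
From mathcomp Require Import all_boot all_order all_algebra.
From mathcomp Require Import boolp reals complex mpoly.
Set Implicit Arguments.
Unset Strict Implicit.
Unset Printing Implicit Defensive.
Import Order.TTheory GRing.Theory Num.Theory.
Local Open Scope ring_scope.

Section LieAlgebra.
Variables (F : fieldType) (L : vectType F) (br : L -> L -> L).

Record is_lie_bracket : Prop := {
  lie_linl : forall y, linear (br^~ y);
  lie_linr : forall x, linear (br x);
  lie_alt : forall x, br x x = 0;
  lie_jacobi : forall x y z,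
    br x (br y z) + br y (br z x) + br z (br x y) = 0 }.

Record is_simple_lie : Prop := {
  simple_lie : is_lie_bracket;
  simple_nonabelian : exists x y, br x y != 0;
  simple_ideals : forall I : {vspace L},
    (forall x y, y \in I -> br x y \in I) -> I = 0%VS \/ I = fullv }.

Definition brv (U V : {vspace L}) : {vspace L} :=
  <<[seq br u v | u <- vbasis U, v <- vbasis V]>>%VS.

(* Nilpotent subalgebra equal to its own normaliser. *)
Definition is_cartan (h : {vspace L}) : Prop :=
  [/\ (brv h h <= h)%VS,
      exists m, iter m (brv h) h = 0%VS
    & forall x, (forall y, y \in h -> br x y \in h) -> x \in h].

Variable h : {vspace L}.

Local Notation dual := ('Hom(subvs_of h, F^o)).

Definition in_root_space (a : dual) (x : L) : Prop :=
  forall y : subvs_of h, br (vsval y) x = (a y : F) *: x.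

Definition is_root (a : dual) : Prop :=
  a != 0 /\ exists2 x, x != 0 & in_root_space a x.

Definition is_root_system (Phi : seq dual) : Prop :=
  uniq Phi /\ forall a, a \in Phi <-> is_root a.

(* The coroot of a is the element of [g_a, g_(-a)] on which a takes value 2. *)
Definition is_coroot (a : dual) (y : subvs_of h) : Prop :=
  (a y : F) = 2 /\
  exists x z, [/\ in_root_space a x, in_root_space (- a) z & vsval y = br x z].

Variable N : nat.

Definition is_base (Phi : seq dual) (Delta : 'I_N -> dual) : Prop :=
  [/\ forall i, Delta i \in Phi,
      basis_of fullv [seq Delta i | i : 'I_N]
    & forall a, a \in Phi -> exists c : 'I_N -> nat,
        a = \sum_i Delta i *+ c i \/ a = - \sum_i Delta i *+ c i].

Record is_chevalley_basis (Phi : seq dual) (Delta : 'I_N -> dual)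
    (Hs : 'I_N -> subvs_of h) (Hc : dual -> subvs_of h) (A : dual -> L)
    (eps : dual -> dual -> F) : Prop := {
  chev_base : is_base Phi Delta;
  chev_coroot : forall a, a \in Phi -> is_coroot a (Hc a);
  chev_simple_coroot : forall i, Hs i = Hc (Delta i);
  chev_basis :
    basis_of fullv ([seq vsval (Hs i) | i : 'I_N] ++ [seq A a | a <- Phi]);
  chev_HH : forall i j, br (vsval (Hs i)) (vsval (Hs j)) = 0;
  chev_HA : forall i a, a \in Phi ->
    br (vsval (Hs i)) (A a) = (a (Hs i) : F) *: A a;
  chev_AAN : forall a, a \in Phi -> br (A a) (A (- a)) = vsval (Hc a);
  chev_AA : forall a b, a \in Phi -> b \in Phi -> a + b \in Phi ->
    br (A a) (A b) = eps a b *: A (a + b);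
  chev_AA0 : forall a b, a \in Phi -> b \in Phi -> a + b \notin 0 :: Phi ->
    br (A a) (A b) = 0;
  chev_eps : forall a b, a \in Phi -> b \in Phi -> a + b \in Phi ->
    eps a b = - eps (- a) (- b) }.

End LieAlgebra.

Section Representation.
Variables (F : fieldType) (L : vectType F) (br : L -> L -> L).

Local Notation n := (\dim {:L}).
Local Notation e := (vbasis {:L}).

(* A morphism of algebraic groups from SL_2 to Aut(L) is given by a matrix rhoP
   of polynomials in the 2 * 2 matrix entries (variables numbered as in mxvec),
   acting on coordinate columns in the basis e. The values of rhoP outside
   determinant 1 are irrelevant. *)
Variable rhoP : 'M[{mpoly F[(2 * 2)]}]_n.

Definition rho_eval (S : comNzRingType) (f : F -> S) (M : 'M[S]_2) : 'M[S]_n :=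
  map_mx (mmap f (fun v => mxvec M 0 v)) rhoP.

Record is_sl2_action (rho : 'M[F]_2 -> 'End(L)) : Prop := {
  sl2_one : rho 1%:M = \1%VF;
  sl2_mul : forall M M', \det M = 1 -> \det M' = 1 ->
    rho (M *m M') = (rho M \o rho M')%VF;
  sl2_bracket : forall M x y, \det M = 1 -> rho M (br x y) = br (rho M x) (rho M y);
  sl2_regular : forall M x i, \det M = 1 ->
    coord e i (rho M x) = \sum_j rho_eval idfun M i j * coord e j x }.

(* The derivative at the identity of M |-> rho M, in direction M. *)
Definition drho (M : 'M[F]_2) (x : L) : L :=
  \sum_i \sum_j
    ((\sum_v (rhoP i j)^`M(v).@[fun w => mxvec 1%:M 0 w] * mxvec M 0 v)
       * coord e j x) *: e`_i.

Definition sl2H : 'M[F]_2 := \matrix_(i, j) (if i == j then (-1) ^+ i else 0).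

End Representation.

Section Polyhedral.
Variable R : realType.
Local Notation C := (R[i]).

Definition in_SU2 (U : 'M[C]_2) : Prop := U \is unitarymx /\ \det U = 1.

Definition in_SO3 (A : 'M[R]_3) : Prop := A *m A^T = 1%:M /\ \det A = 1.

Definition mx2 (T : Type) (a b c d : T) : 'M[T]_2 :=
  \matrix_(i, j) (if i == 0 then if j == 0 then a else b
                  else if j == 0 then c else d).

Definition pauli (j : 'I_3) : 'M[C]_2 :=
  if j == 0 then mx2 0 1 1 0
  else if j == 1 then mx2 0 (Complex 0 (-1)) (Complex 0 1) 0
  else mx2 1 0 0 (-1).

(* The double cover SU(2) -> SO(3): conjugation on traceless Hermitian
   matrices, in the orthogonal basis of Pauli matrices. *)
Definition double_cover (U : 'M[C]_2) : 'M[R]_3 :=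
  \matrix_(j, k) complex.Re
    (\tr (pauli j *m U *m pauli k *m map_mx Num.conj U^T) / 2).

Record is_polyhedral (G : seq 'M[R]_3) : Prop := {
  poly_uniq : uniq G;
  poly_SO3 : forall A, A \in G -> in_SO3 A;
  poly_one : 1%:M \in G;
  poly_mul : forall A B, A \in G -> B \in G -> A *m B \in G;
  poly_inv : forall A, A \in G -> invmx A \in G }.

Variable G : seq 'M[R]_3.

Definition in_BG (U : 'M[C]_2) : Prop := in_SU2 U /\ double_cover U \in G.

(* Points of the Riemann sphere are the subspaces of dimension 1. *)
Local Notation line := {vspace 'cV[C]_2}.

Definition act_line (U : 'M[C]_2) (l : line) : line :=
  (linfun (mulmx U : 'cV_2 -> 'cV_2) @: l)%VS.

Definition is_orbit (S : seq line) : Prop :=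
  uniq S /\ exists2 l : line, \dim l = 1%N &
    forall l', l' \in S <-> exists2 U, in_BG U & l' = act_line U l.

(* Order of the stabiliser in G; a rotation acts through any of its lifts. *)
Definition stab_order (l : line) : nat :=
  count (fun g => `[< exists U,
    [/\ in_SU2 U, double_cover U = g & act_line U l = l] >]) G.

Record is_exceptional_orbits (Omega : finType) (S : Omega -> seq line)
    (nu : Omega -> nat) : Prop := {
  exc_orbit : forall i, is_orbit (S i);
  exc_stab : forall i l, l \in S i -> stab_order l = nu i;
  exc_nontrivial : forall i, (1 < nu i)%N;
  exc_all : forall l : line, \dim l = 1%N -> (1 < stab_order l)%N ->
    exists i, l \in S i;
  exc_distinct : forall i j l, l \in S i -> l \in S j -> i = j }.

Definition vanishes (p : {mpoly C[2]}) (l : line) : Prop :=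
  forall v, v \in l -> p.@[fun i => v i 0] = 0.

Definition is_ground_form (S : seq line) (p : {mpoly C[2]}) : Prop :=
  [/\ p != 0, p \is (size S).-homog & forall l, l \in S -> vanishes p l].

(* f(v) |-> f(U v). *)
Definition subst_poly (U : 'M[C]_2) (p : {mpoly C[2]}) : {mpoly C[2]} :=
  p \mPo [tuple \sum_j U i j *: 'X_j | i < 2].

(* The zero set has to be exactly T: for T an orbit with nontrivial stabiliser,
   mere vanishing on T does not determine the form up to a scalar (for G cyclic
   of order n, X Y^(n-1) vanishes on the orbit of the line X = 0). *)
Definition is_orbit_form (T : seq line) (P : {mpoly C[2]}) : Prop :=
  [/\ P \is (size G).-homog,
      forall l : line, \dim l = 1%N -> vanishes P l <-> l \in T
    & forall U, in_BG U -> exists c : C, subst_poly (invmx U) P = c *: P].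

End Polyhedral.

Section Automorphic.
Variable R : realType.
Local Notation C := (R[i]).
Local Notation K := {fraction {mpoly C[2]}}.

Definition constK (c : C) : K := tofrac c%:MP.

(* f(v) |-> f(U v) on rational functions; independent of the representative
   since substitution is injective for invertible U. *)
Definition subst_frac (U : 'M[C]_2) (f : K) : K :=
  tofrac (subst_poly U \n_(repr f)) / tofrac (subst_poly U \d_(repr f)).

(* The elements of C[X, Y, 1/P]. *)
Definition in_loc (P : {mpoly C[2]}) (f : K) : Prop :=
  exists p m, f = tofrac p / tofrac P ^+ m.

Definition homog0 (f : K) : Prop :=
  exists d (p q : {mpoly C[2]}),
    [/\ p \is d.-homog, q \is d.-homog, q != 0 & f = tofrac p / tofrac q].

Variables (G : seq 'M[R]_3) (P : {mpoly C[2]}).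

Definition in_inv_ring (f : K) : Prop :=
  [/\ in_loc P f, homog0 f & forall U, in_BG G U -> subst_frac (invmx U) f = f].

Definition evalC (I : K) (q : {poly C}) : K := (map_poly constK q).[I].

Definition is_inv_generator (I : K) : Prop :=
  (forall f, in_inv_ring f <-> exists q, f = evalC I q)
  /\ (forall q, evalC I q = 0 -> q = 0).

Variables (L : vectType C) (br : L -> L -> L).
Variable rhoP : 'M[{mpoly C[(2 * 2)]}]_(\dim {:L}).

(* L (x) K is 'cV[K]_(\dim {:L}), by coordinates in vbasis {:L}. *)
Local Notation LK := 'cV[K]_(\dim {:L}).
Local Notation e := (vbasis {:L}).

Definition extend (x : L) : LK := \col_i constK (coord e i x).

Definition brK (f g : LK) : LK :=
  \sum_i \sum_j (f i 0 * g j 0) *: extend (br e`_i e`_j).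

Definition in_aLie (f : LK) : Prop :=
  [/\ forall i, in_loc P (f i 0),
      forall i, homog0 (f i 0)
    & forall U, in_BG G U ->
        rho_eval rhoP constK (map_mx constK U)
          *m map_mx (subst_frac (invmx U)) f = f].

Definition is_free_basis (I : K) (b : seq LK) (M : LK -> Prop) : Prop :=
  (forall f, M f <-> exists c : 'I_(size b) -> {poly C},
     f = \sum_j evalC I (c j) *: b`_j)
  /\ (forall c : 'I_(size b) -> {poly C},
     \sum_j evalC I (c j) *: b`_j = 0 -> forall j, c j = 0).

Definition Phi1 : 'M[K]_2 :=
  let dP := ((msize P).-1%:R : K) * tofrac P in
  mx2 (tofrac P^`M(1) / dP) (tofrac 'X_0)
      (- (tofrac P^`M(0) / dP)) (tofrac 'X_1).

Definition Phi_rho (x : L) : LK := rho_eval rhoP constK Phi1 *m extend x.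

Variables (Omega : finType) (S : Omega -> seq {vspace 'cV[C]_2}).
Variables (nu : Omega -> nat) (Pi : Omega -> {mpoly C[2]}).

(* Meaningful for even k only. The residue is modulo nu i also for G cyclic of
   even order 2m: there gamma P = - P for generators gamma of the lift of G, so
   that odd powers of P, which residues modulo m would give as ell, do not
   produce invariant forms. *)
Definition nres (k : int) (i : Omega) : int := ((k %/ 2)%Z %% (nu i)%:Z)%Z.

(* The division is exact for even k. *)
Definition ell (k : int) : int :=
  ((k - \sum_i nres k i * (size (S i))%:Z) %/ (size G)%:Z)%Z.

Definition Pk (k : int) : K :=
  if (2 %| k)%Z then tofrac P ^ ell k * \prod_i tofrac (Pi i) ^ nres k i else 0.

Definition coboundary (V : zmodType) (f : V -> rat) (a b : V) : rat :=
  f b - f (a + b) + f a.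

Definition omega2 (V : zmodType) (k : V -> int) (a b : V) (i : Omega) : rat :=
  coboundary (fun c => (nres (k c) i)%:~R / (nu i)%:R) a b.

(* omega2 is integer-valued where it is used, so numq is the integer itself. *)
Definition I_omega (V : zmodType) (k : V -> int) (a b : V) : K :=
  \prod_i (tofrac (Pi i) ^+ nu i / tofrac P) ^ numq (omega2 k a b i).

Definition is_symmetric_2cocycle (V : zmodType) (w : V -> V -> rat) : Prop :=
  (forall a b, w a b = w b a)
  /\ (forall a b c, w b c - w (a + b) c + w a (b + c) - w a b = 0).

End Automorphic.

(* Main.v *)
Require Import Defs.
From HB Require Import structures.
From mathcomp Require Import all_boot all_order all_algebra.
From mathcomp Require Import boolp reals complex mpoly.
From mathcomp Require Import ring lra zify.
Set Implicit Arguments.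
Unset Strict Implicit.
Unset Printing Implicit Defensive.
Import Order.TTheory GRing.Theory Num.Theory.
Local Open Scope ring_scope.

(** Write K for the field of rational functions in X and Y. The frame Phi1 has
determinant 1 and entries in C[X, Y, 1/P] (Euler's identity, det_Phi1), and for
U in the binary group it satisfies Phi1(U v) = U Phi1(v): its columns are the
identity map and the gradient of log P turned by a right angle
(Phi1_equivariant). Hence rho(Phi1)^-1 turns vectors that are equivariant through
rho into vectors with invariant coordinates. Under scalars the frame is
multiplied from the right by a torus element (Phi1_scaling), so in a basis of
weight vectors a coordinate at weight k of a vector of degree 0 has degree k. The
automorphic Lie algebra thus becomes the direct sum, over a weight basis, of the
spaces of invariants of degree k in C[X, Y, 1/P], and everything reduces to the
claim that this space is the free module generated by Pk k over the ring of
invariants of degree 0, or zero if k is odd (eigen_coefficient). Root vectors have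
the weights k(alpha), and Cartan elements have weight 0.

For the claim, two things are needed. First, an invariant of degree k must be
divisible by Pk k. This is local: at an exceptional line with stabiliser of order
nu, the stabiliser in the binary group acts by the roots of unity of order 2 nu,
and comparing eigenvalues shows that the order of vanishing is k/2 modulo nu
(local_order), hence at least the exponent in Pk k. If T is itself exceptional,
its ground form is invertible in the localisation. Second, Pk k must be invariant.
The forms P and Pi i ^+ nu i share one character c of the binary group: up to
scalars each of them is a norm form, the product of the rotated copies of one
linear form (orbit_formE, norm_form_orbit, common_char). The characters x i of the
Pi i are nu i-th roots of c, and the relation between them that makes Pk k
invariant comes from a Jacobian. The Jacobian of P and the norm form of a generic
line has character c^2 and degree 2 |G| - 2, and by the local analysis it vanishes
to order nu i - 1 on each exceptional orbit. Counting the fixed lines of all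
rotations (exc_count) shows that these zeros exhaust its degree, so it is a
multiple of the product of the Pi i ^+ (nu i).-1 (jac_Pi), which gives
prod_char. The same count makes the division in the exponent ell exact (ellE).

The ring of invariants of degree 0 is generated by F / P with F the norm form of
a generic line: subtract from an invariant its value at that line, divide by F
and induct on the degree (semi_inv_polynomial).

The brackets follow from rho(Phi1) being an automorphism of the Lie algebra over
K. This is known for complex matrices of determinant 1 and passes to K by
evaluation at generic points (spec_eq, brK_rho). So the brackets of the Chevalley
basis persist, and the structure constants only pick up the quotients
Pk(k a) Pk(k b) / Pk(k(a + b)), which PkM identifies with the powers prescribed
by omega2; k is additive on roots because H is a Cartan element (weightE). *)

(** * Unit quaternions and the double cover *)

Section Rotations.
Variable R : realType.
Local Notation C := (R[i]).
Implicit Types U V : 'M[C]_2.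

Lemma ord2P (P : 'I_2 -> Prop) : P 0 -> P 1 -> forall i, P i.
Proof.
move=> P0 P1 [[|[|i]] hi] //.
- by rewrite (_ : Ordinal hi = 0) //; apply: val_inj.
- by rewrite (_ : Ordinal hi = 1) //; apply: val_inj.
Qed.

Lemma ord3P (P : 'I_3 -> Prop) :
  P 0 -> P 1 -> P 2%:R -> forall i, P i.
Proof.
move=> P0 P1 P2 [[|[|[|i]]] hi] //.
- by rewrite (_ : Ordinal hi = 0) //; apply: val_inj.
- by rewrite (_ : Ordinal hi = 1) //; apply: val_inj.
- by rewrite (_ : Ordinal hi = 2%:R) //; apply: val_inj.
Qed.

Lemma sum2E (S : nmodType) (F : 'I_2 -> S) : \sum_i F i = F 0 + F 1.
Proof.
rewrite !big_ord_recl big_ord0 addr0; congr (_ + F _); exact: val_inj.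
Qed.

Lemma sum3E (S : nmodType) (F : 'I_3 -> S) :
  \sum_i F i = F 0 + F 1 + F 2%:R.
Proof.
by rewrite !big_ord_recl big_ord0 addr0 addrA; congr (_ + F _ + F _);
  exact: val_inj.
Qed.

Lemma mx2_eq (T : Type) (M : 'M[T]_2) : M = mx2 (M 0 0) (M 0 1) (M 1 0) (M 1 1).
Proof. by apply/matrixP; elim/ord2P; elim/ord2P; rewrite mxE. Qed.

Lemma mx2M (S : pzSemiRingType) (a b c d a' b' c' d' : S) :
  mx2 a b c d *m mx2 a' b' c' d' =
  mx2 (a * a' + b * c') (a * b' + b * d') (c * a' + d * c') (c * b' + d * d').
Proof. by apply/matrixP; elim/ord2P; elim/ord2P; rewrite mxE sum2E !mxE. Qed.

Lemma mx2_1 (S : pzSemiRingType) : 1%:M = mx2 1 0 0 1 :> 'M[S]_2.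
Proof. by apply/matrixP; elim/ord2P; elim/ord2P; rewrite !mxE. Qed.

Lemma det_mx2 (S : comNzRingType) (a b c d : S) :
  \det (mx2 a b c d) = a * d - b * c.
Proof.
rewrite (expand_det_row _ 0) sum2E /cofactor !det_mx11 !mxE /=; ring.
Qed.

Lemma mx2_map (S T : Type) (f : S -> T) a b c d :
  map_mx f (mx2 a b c d) = mx2 (f a) (f b) (f c) (f d).
Proof. by apply/matrixP; elim/ord2P; elim/ord2P; rewrite !mxE. Qed.

Lemma mx2_tr (S : Type) (a b c d : S) : (mx2 a b c d)^T = mx2 a c b d.
Proof. by apply/matrixP; elim/ord2P; elim/ord2P; rewrite !mxE. Qed.

Lemma mx2_inj (S : Type) (a b c d a' b' c' d' : S) :
  mx2 a b c d = mx2 a' b' c' d' -> [/\ a = a', b = b', c = c' & d = d'].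
Proof.
move=> /matrixP e; split.
- by have := e 0 0; rewrite !mxE.
- by have := e 0 1; rewrite !mxE.
- by have := e 1 0; rewrite !mxE.
- by have := e 1 1; rewrite !mxE.
Qed.

(** A quaternion as x0 plus the imaginary unit times a combination of Pauli
matrices. As unit quaternions are exactly SU(2), identities in SU(2) and under
the double cover become polynomial identities in four real variables. *)
Definition quat (x0 x1 x2 x3 : R) : 'M[C]_2 :=
  mx2 (Complex x0 x3) (Complex x2 x1) (Complex (- x2) x1) (Complex x0 (- x3)).

Lemma SU2P U : in_SU2 U <->
  exists x0 x1 x2 x3,
    x0 ^+ 2 + x1 ^+ 2 + x2 ^+ 2 + x3 ^+ 2 = 1 /\ U = quat x0 x1 x2 x3.
Proof.
split; last first.
  case=> x0 [x1 [x2 [x3 [e ->]]]]; split.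
    apply/unitarymxP; rewrite mx2_tr mx2_map mx2M mx2_1 /=.
    by congr (mx2 _ _ _ _); apply/eqP; rewrite eq_complex /=;
      apply/andP; split; apply/eqP; rewrite -?e; ring.
  rewrite det_mx2; apply/eqP; rewrite eq_complex /=.
  by apply/andP; split; apply/eqP; rewrite -?e; ring.
rewrite (mx2_eq U); move: (U 0 0) (U 0 1) (U 1 0) (U 1 1) => a b c d.
case=> /unitarymxP; rewrite mx2_tr mx2_map det_mx2 => hU hd.
have hA : mx2 d (- b) (- c) a *m mx2 a b c d = 1%:M.
  by rewrite mx2M mx2_1 -hd; congr (mx2 _ _ _ _); ring.
have := congr1 (mulmx (mx2 d (- b) (- c) a)) hU.
rewrite mulmxA hA mul1mx mulmx1 => e; have [ea ec eb ed] := mx2_inj e.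
have {}ec : b = - c^* by rewrite ec opprK.
have hn : a * a^* + c * c^* = 1 by rewrite ea -hd ec; ring.
move: ea ec hn {hU hd hA e eb ed}; case: a => a0 a1; case: c => c0 c1 /= <- ->.
move=> /eqP; rewrite eq_complex /= => /andP[/eqP hn _].
exists a0, c1, (- c0), a1; split; first by rewrite -hn; ring.
by rewrite /quat opprK; congr (mx2 _ _ _ _); apply/eqP; rewrite eq_complex /= ?opprK !eqxx.
Qed.

Definition mx3 (S : Type) (a b c d e f g h i : S) : 'M[S]_3 :=
  \matrix_(j, k) if j == 0 then (if k == 0 then a else if k == 1 then b else c)
    else if j == 1 then (if k == 0 then d else if k == 1 then e else f)
    else (if k == 0 then g else if k == 1 then h else i).

(** The Euler-Rodrigues matrix: conjugation by the quaternion, written in the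
basis of Pauli matrices. *)
Definition rot (x0 x1 x2 x3 : R) : 'M[R]_3 :=
  mx3 (x0^+2 + x1^+2 - x2^+2 - x3^+2) (2 * (x1 * x2 + x0 * x3)) (2 * (x1 * x3 - x0 * x2))
    (2 * (x1 * x2 - x0 * x3)) (x0^+2 - x1^+2 + x2^+2 - x3^+2)  (2 * (x2 * x3 + x0 * x1))
    (2 * (x1 * x3 + x0 * x2)) (2 * (x2 * x3 - x0 * x1)) (x0^+2 - x1^+2 - x2^+2 + x3^+2).

Lemma mx2_trace (S : pzSemiRingType) (a b c d : S) : \tr (mx2 a b c d) = a + d.
Proof. by rewrite /mxtrace sum2E !mxE. Qed.

Lemma Re_half (z : C) : complex.Re (z / 2) = complex.Re z / 2.
Proof.
case: z => a b; have -> : (2 : C)^-1 = Complex (2^-1 : R) 0.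
  apply: (mulfI (_ : (2 : C) != 0)); first by rewrite pnatr_eq0.
  rewrite divff ?pnatr_eq0 //; apply/eqP; rewrite eq_complex /=.
  by apply/andP; split; apply/eqP; field.
by rewrite /= mulr0 subr0.
Qed.

Lemma double_cover_quat x0 x1 x2 x3 :
  double_cover (quat x0 x1 x2 x3) = rot x0 x1 x2 x3.
Proof.
apply/matrixP; elim/ord3P; elim/ord3P;
by rewrite mxE [RHS]mxE /= Re_half /pauli /= /quat mx2_tr mx2_map !mx2M mx2_trace /=;
field.
Qed.

Lemma quatM x0 x1 x2 x3 y0 y1 y2 y3 :
  quat x0 x1 x2 x3 *m quat y0 y1 y2 y3 =
  quat (x0 * y0 - x1 * y1 - x2 * y2 - x3 * y3)
       (x0 * y1 + x1 * y0 - x2 * y3 + x3 * y2)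
       (x0 * y2 + x2 * y0 - x3 * y1 + x1 * y3)
       (x0 * y3 + x3 * y0 - x1 * y2 + x2 * y1).
Proof.
rewrite mx2M; congr (mx2 _ _ _ _); apply/eqP; rewrite eq_complex /=;
  apply/andP; split; apply/eqP; ring.
Qed.

Lemma SU2_mul U V : in_SU2 U -> in_SU2 V -> in_SU2 (U *m V).
Proof.
case/SU2P=> x0 [x1 [x2 [x3 [e ->]]]]; case/SU2P=> y0 [y1 [y2 [y3 [f ->]]]].
rewrite quatM; apply/SU2P; do 4!eexists; split; last by [].
rewrite -[RHS]mulr1 -{1}e -f; ring.
Qed.

Lemma SU2_1 : in_SU2 (1%:M : 'M[C]_2).
Proof.
apply/SU2P; exists 1, 0, 0, 0; split; first by rewrite !expr0n expr1n !addr0.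
by rewrite mx2_1 /quat oppr0.
Qed.

Lemma SU2_unit U : in_SU2 U -> U \in unitmx.
Proof. by case=> _ dU; rewrite unitmxE dU unitr1. Qed.

Lemma SU2_inv U : in_SU2 U -> in_SU2 (invmx U).
Proof.
move=> h; have u := SU2_unit h; case/SU2P: h u => x0 [x1 [x2 [x3 [e ->]]]] u.
apply/SU2P; exists x0, (- x1), (- x2), (- x3); split; first by rewrite !sqrrN.
rewrite -[RHS](mulKmx u) -[LHS]mulmx1; congr (_ *m _); rewrite quatM.
rewrite mx2_1; congr (mx2 _ _ _ _); apply/eqP; rewrite eq_complex /=;
  apply/andP; split; apply/eqP; rewrite -?e; ring.
Qed.

Lemma SU2_opp U : in_SU2 U -> in_SU2 (- U).
Proof.
case/SU2P=> x0 [x1 [x2 [x3 [e ->]]]]; apply/SU2P.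
exists (- x0), (- x1), (- x2), (- x3); split; first by rewrite !sqrrN.
by apply/matrixP; elim/ord2P; elim/ord2P; rewrite !mxE /=;
  apply/eqP; rewrite eq_complex /= ?opprK !eqxx.
Qed.

Lemma double_coverM U V : in_SU2 U -> in_SU2 V ->
  double_cover (U *m V) = double_cover U *m double_cover V.
Proof.
case/SU2P=> x0 [x1 [x2 [x3 [_ ->]]]]; case/SU2P=> y0 [y1 [y2 [y3 [_ ->]]]].
rewrite quatM !double_cover_quat.
apply/matrixP; elim/ord3P; elim/ord3P; rewrite !mxE sum3E !mxE /=; ring.
Qed.

Lemma double_cover1 : double_cover (1%:M : 'M[C]_2) = 1%:M :> 'M[R]_3.
Proof.
have -> : (1%:M : 'M[C]_2) = quat 1 0 0 0 by rewrite mx2_1 /quat oppr0.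
rewrite double_cover_quat.
apply/matrixP; elim/ord3P; elim/ord3P; rewrite !mxE /=; ring.
Qed.

Lemma double_coverN U : in_SU2 U -> double_cover (- U) = double_cover U.
Proof.
case/SU2P=> x0 [x1 [x2 [x3 [_ ->]]]].
have -> : - quat x0 x1 x2 x3 = quat (- x0) (- x1) (- x2) (- x3).
  by apply/matrixP; elim/ord2P; elim/ord2P; rewrite !mxE /=;
  apply/eqP; rewrite eq_complex /= ?opprK !eqxx.
by rewrite !double_cover_quat /rot !sqrrN !mulrNN.
Qed.

Lemma double_cover_inv U : in_SU2 U -> double_cover (invmx U) = invmx (double_cover U).
Proof.
move=> hU.
have e : double_cover (invmx U) *m double_cover U = 1%:M.
  by rewrite -double_coverM ?mulVmx ?double_cover1 ?SU2_unit //; apply: SU2_inv.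
have /mulmx1_unit [_ u] := e.
by rewrite -[LHS](mulmxK u) e mul1mx.
Qed.

(** The diagonal of the rotation matrix gives the squares of the coordinates;
unit norm does the rest. *)
Lemma double_cover_ker U : in_SU2 U -> double_cover U = 1%:M -> U = 1%:M \/ U = - 1%:M.
Proof.
case/SU2P=> x0 [x1 [x2 [x3 [e ->]]]]; rewrite double_cover_quat => /matrixP h.
have := h 0 0; rewrite !mxE /= => h0.
have := h 1 1; rewrite !mxE /= => h1.
have := (sqr_ge0 x1, (sqr_ge0 x2, sqr_ge0 x3)) => -[q1 [q2 q3]].
have z1 : x1 = 0 by apply/eqP; rewrite -sqrf_eq0; apply/eqP; lra.
have z2 : x2 = 0 by apply/eqP; rewrite -sqrf_eq0; apply/eqP; lra.
have z3 : x3 = 0 by apply/eqP; rewrite -sqrf_eq0; apply/eqP; lra.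
move: e; rewrite z1 z2 z3 !expr0n /= !addr0 => /eqP; rewrite sqrf_eq1.
case/orP=> /eqP ->; [left|right]; rewrite mx2_1 /quat ?oppr0 //.
by apply/matrixP; elim/ord2P; elim/ord2P; rewrite !mxE /=;
  apply/eqP; rewrite eq_complex /= ?opprK ?oppr0 !eqxx.
Qed.

Lemma mx3_eq (T : Type) (M : 'M[T]_3) :
  M = mx3 (M 0 0) (M 0 1) (M 0 2%:R) (M 1 0) (M 1 1) (M 1 2%:R)
    (M 2%:R 0) (M 2%:R 1) (M 2%:R 2%:R).
Proof. by apply/matrixP; elim/ord3P; elim/ord3P; rewrite mxE. Qed.

Lemma rotT x0 x1 x2 x3 : (rot x0 x1 x2 x3)^T = rot x0 (- x1) (- x2) (- x3).
Proof. apply/matrixP; elim/ord3P; elim/ord3P; rewrite !mxE /=; ring. Qed.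

Lemma det_mx3 (S : comNzRingType) (a b c d e f g h i : S) :
  \det (mx3 a b c d e f g h i) =
  a * (e * i - f * h) - b * (d * i - f * g) + c * (d * h - e * g).
Proof.
rewrite (expand_det_row _ 0) sum3E /cofactor !(expand_det_row _ 0) !sum2E.
rewrite /cofactor !det_mx11 !mxE /=; ring.
Qed.

End Rotations.

Section Lift.
Variable R : realType.
Local Notation C := (R[i]).
Implicit Types U V : 'M[C]_2.

Lemma double_cover_SO3 U : in_SU2 U -> in_SO3 (double_cover U).
Proof.
move=> hU; case/SU2P: (hU)=> x0 [x1 [x2 [x3 [e ->]]]].
rewrite double_cover_quat; split; last first.
  rewrite det_mx3; transitivity ((x0 ^+ 2 + x1 ^+ 2 + x2 ^+ 2 + x3 ^+ 2) ^+ 3).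
    by ring.
  by rewrite e expr1n.
rewrite rotT -!double_cover_quat -double_coverM; first last.
- by apply/SU2P; exists x0, (- x1), (- x2), (- x3); rewrite !sqrrN.
- by apply/SU2P; exists x0, x1, x2, x3.
rewrite quatM -[RHS]double_cover1; congr double_cover.
rewrite mx2_1; congr (mx2 _ _ _ _); apply/eqP; rewrite eq_complex /=;
  apply/andP; split; apply/eqP; rewrite -?e; ring.
Qed.

(** A unit quaternion without third component turns the third axis into a given
unit vector; the antipode of that axis needs a half turn about the first
axis. *)
Lemma rot_axis (n0 n1 n2 : R) : n0 ^+ 2 + n1 ^+ 2 + n2 ^+ 2 = 1 ->
  exists U, in_SU2 U /\ forall i,
    double_cover U i 2%:R = if i == 0 then n0 else if i == 1 then n1 else n2.
Proof.
move=> hn; have [e|ne] := eqVneq n2 (- 1).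
  have [z0 z1] : n0 = 0 /\ n1 = 0.
    by split; apply/eqP; rewrite -sqrf_eq0; apply/eqP; nra.
  exists (quat 0 1 0 0); split.
    by apply/SU2P; exists 0, 1, 0, 0; split=> //; ring.
  by elim/ord3P; rewrite double_cover_quat !mxE /= ?z0 ?z1 ?e; ring.
have hp : 0 < (1 + n2) / 2.
  rewrite divr_gt0 // lt_def; apply/andP; split; last by nra.
  by apply: contra ne => /eqP e; apply/eqP; lra.
pose x0 := Num.sqrt ((1 + n2) / 2).
have h0 : x0 != 0 by rewrite sqrtr_eq0 -ltNge.
have hx : x0 ^+ 2 = (1 + n2) / 2 by rewrite sqr_sqrtr // ltW.
pose x1 := n1 / (2 * x0); pose x2 := - n0 / (2 * x0).
have e1 : x0 * x1 = n1 / 2 by rewrite /x1; field.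
have e2 : x0 * x2 = - n0 / 2 by rewrite /x2; field.
have e12 : x1 ^+ 2 + x2 ^+ 2 = (1 - n2) / 2.
  apply: (mulfI (expf_neq0 2 h0)); rewrite mulrDr -!exprMn e1 e2 hx.
  have -> : (n1 / 2) ^+ 2 + (- n0 / 2) ^+ 2 = (n0 ^+ 2 + n1 ^+ 2 + n2 ^+ 2 - n2 ^+ 2) / 4.
    by field.
  by rewrite hn; field.
exists (quat x0 x1 x2 0); split.
  by apply/SU2P; exists x0, x1, x2, 0; split=> //; lra.
by elim/ord3P; rewrite double_cover_quat !mxE /=; lra.
Qed.

(** Once the third axis is turned into place, what remains is a plane rotation,
and its lift has half the angle: a complex square root. *)
Lemma double_cover_surj A : in_SO3 A ->
  exists U, in_SU2 U /\ double_cover U = A.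
Proof.
move=> [hA dA].
have hA' : A^T *m A = 1%:M by apply: mulmx1C.
have : A 0 2%:R ^+ 2 + A 1 2%:R ^+ 2 + A 2%:R 2%:R ^+ 2 = 1.
  by have /matrixP/(_ 2%:R 2%:R) := hA'; rewrite !mxE sum3E !mxE /= -!expr2.
move=> /rot_axis [U [hU UA]].
have [hD dD] := double_cover_SO3 hU.
pose B := (double_cover U)^T *m A.
have hB : B *m B^T = 1%:M.
  rewrite /B trmx_mul trmxK mulmxA -(mulmxA _ A) hA mulmx1; exact: mulmx1C.
have dB : \det B = 1 by rewrite det_mulmx det_tr dD dA mul1r.
have B2 i : B i 2%:R = (i == 2%:R)%:R.
  have -> : B i 2%:R = ((double_cover U)^T *m double_cover U) i 2%:R.
    rewrite !mxE !sum3E !UA !eqxx //.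
  by rewrite (mulmx1C hD) mxE.
have AB : double_cover U *m B = A by rewrite mulmxA hD mul1mx.
clearbody B.
have [b02 b12 b22] : [/\ B 0 2%:R = 0, B 1 2%:R = 0 & B 2%:R 2%:R = 1].
  by rewrite !B2.
have := hB; rewrite [B]mx3_eq b02 b12 b22 in dB *.
move=> /matrixP e.
have := e 2%:R 2%:R; rewrite !mxE sum3E !mxE /= => e22.
have [b20 b21] : B 2%:R 0 = 0 /\ B 2%:R 1 = 0.
  have := (sqr_ge0 (B 2%:R 0), sqr_ge0 (B 2%:R 1)) => -[q1 q2].
  by split; apply/eqP; rewrite -sqrf_eq0; apply/eqP; lra.
have := e 0 0; rewrite !mxE sum3E !mxE /= => e00.
have := e 1 1; rewrite !mxE sum3E !mxE /= => e11.
have := e 0 1; rewrite !mxE sum3E !mxE /= => e01.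
move: dB; rewrite det_mx3 b20 b21 => d.
set c := B 0 0 in e00 e01 e11 d *; set s := B 0 1 in e00 e01 e11 d *.
have cs : c ^+ 2 + s ^+ 2 = 1 by lra.
have b11 : B 1 1 = c.
  rewrite -[LHS]mul1r -cs -[RHS]mulr1 -d.
  have h : c * B 1 0 + s * B 1 1 = 0 by lra.
  transitivity (c * (c * B 1 1 - s * B 1 0) + s * (c * B 1 0 + s * B 1 1)).
    by ring.
  by rewrite h; ring.
have b10 : B 1 0 = - s.
  rewrite -[LHS]mul1r -cs -[RHS]mulr1 -d.
  have h : c * B 1 0 + s * B 1 1 = 0 by lra.
  transitivity (c * (c * B 1 0 + s * B 1 1) - s * (c * B 1 1 - s * B 1 0)).
    by ring.
  by rewrite h; ring.
pose z := sqrtC (Complex c s : C).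
have hz : z ^+ 2 = Complex c s by rewrite sqrtCK.
case: z hz => u v; rewrite expr2 => /eqP; rewrite eq_complex /=.
case/andP=> /eqP hc /eqP hs.
have huv : u ^+ 2 + v ^+ 2 = 1.
  (* the square root of a number of modulus 1 has modulus 1 *)
  have h : (u ^+ 2 + v ^+ 2) ^+ 2 = 1.
    rewrite -cs.
    by rewrite -hc -hs; ring.
  move: h => /eqP; rewrite sqrf_eq1 => /orP[/eqP //|/eqP h].
  by have := addr_ge0 (sqr_ge0 u) (sqr_ge0 v); rewrite h; lra.
have hV : in_SU2 (quat u 0 0 v).
  by apply/SU2P; exists u, 0, 0, v; split=> //; rewrite -huv; ring.
exists (U *m quat u 0 0 v); split; first exact: SU2_mul.
rewrite double_coverM //.
have -> : double_cover (quat u 0 0 v) = B.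
  rewrite double_cover_quat [B]mx3_eq b02 b12 b22 b20 b21 b11 b10 -/c -/s.
  by congr (mx3 _ _ _ _ _ _ _ _ _); rewrite -?hc -?hs;
    first [ring | by rewrite -[RHS]huv; ring].
exact: AB.
Qed.
End Lift.

(** * Lines of the plane fixed by a unitary matrix *)

Section Lines.
Variable R : realType.
Local Notation C := (R[i]).
Local Notation line := {vspace 'cV[C]_2}.
Implicit Types (U V : 'M[C]_2) (v w : 'cV[C]_2) (l : line).

Lemma act_lineE U w : act_line U <[w]> = <[U *m w]>%VS.
Proof. by rewrite /act_line limg_line lfunE. Qed.

Lemma line_vpick l : \dim l = 1%N -> l = <[vpick l]>%VS /\ vpick l != 0.
Proof.
move=> dl; have n0 : vpick l != 0 by rewrite vpick0 -dimv_eq0 dl.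
split=> //; apply/esym/eqP; rewrite eqEdim dl dim_vline n0 andbT.
by rewrite -memvE memv_pick.
Qed.

Lemma line_ind (Q : line -> Prop) :
  (forall w, w != 0 -> Q <[w]>%VS) -> forall l, \dim l = 1%N -> Q l.
Proof. by move=> h l /line_vpick[e n0]; rewrite e; apply: h. Qed.

Lemma eq_lineP w v : w != 0 -> v != 0 ->
  reflect (exists2 c, c != 0 & v = c *: w) (<[w]>%VS == <[v]>%VS :> line).
Proof.
move=> w0 v0; apply: (iffP eqP) => [e|[c c0 ->]].
  have : v \in <[w]>%VS by rewrite e memv_line.
  case/vlineP=> c vE; exists c => //.
  by apply: contra v0 => /eqP c0; rewrite vE c0 scale0r.
apply/eqP; rewrite eqEdim !dim_vline w0 scaler_eq0 negb_or c0 w0 /= andbT.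
rewrite -memvE; apply/vlineP; exists c^-1.
by rewrite scalerA mulVf ?scale1r.
Qed.

Lemma mulmx_neq0 U w : U \in unitmx -> w != 0 -> U *m w != 0.
Proof.
by move=> u; apply: contra => /eqP e; rewrite -(mulKmx u w) e mulmx0.
Qed.

Lemma dim_act_line U l : U \in unitmx -> \dim l = 1%N -> \dim (act_line U l) = 1%N.
Proof.
move=> u /line_vpick[e n0]; rewrite e.
by rewrite act_lineE dim_vline mulmx_neq0.
Qed.

Lemma act_lineM U V l : act_line (U *m V) l = act_line U (act_line V l).
Proof.
rewrite /act_line -limg_comp; congr (_ @: _)%VS.
by apply/lfunP => x; rewrite comp_lfunE !lfunE /= mulmxA.
Qed.

Lemma act_line1 l : act_line 1%:M l = l.
Proof.
rewrite /act_line -[RHS]lim1g; congr (_ @: _)%VS.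
by apply/lfunP => x; rewrite id_lfunE lfunE /= mul1mx.
Qed.

Lemma act_lineZ (c : C) U l : c != 0 -> act_line (c *: U) l = act_line U l.
Proof.
move=> c0; have -> : c *: U = U *m c%:M by rewrite mul_mx_scalar.
rewrite act_lineM; congr (act_line _ _); apply/eqP.
rewrite eqEsubv; apply/andP; split; apply/subvP=> x.
  by case/memv_imgP=> y yl ->; rewrite lfunE /= mul_scalar_mx memvZ.
move=> xl; have -> : x = linfun (mulmx (c%:M : 'M_2)) (c^-1 *: x).
  by rewrite lfunE /= mul_scalar_mx scalerA divff // scale1r.
by apply: memv_img; rewrite memvZ.
Qed.

(** The area form of the plane. It vanishes exactly on proportional vectors, so
it tests equality of lines, and matrices of determinant 1 preserve it. *)
Definition dt w v : C := w 0 0 * v 1 0 - w 1 0 * v 0 0.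

Lemma vec2P v w : v 0 0 = w 0 0 -> v 1 0 = w 1 0 -> v = w.
Proof. by move=> e0 e1; apply/matrixP => i j; rewrite (ord1 j); elim/ord2P: i. Qed.

Lemma mulmx2E U v :
  ((U *m v) 0 0 = U 0 0 * v 0 0 + U 0 1 * v 1 0) *
  ((U *m v) 1 0 = U 1 0 * v 0 0 + U 1 1 * v 1 0).
Proof. by rewrite !mxE !sum2E. Qed.

Lemma det2E (S : comNzRingType) (M : 'M[S]_2) :
  \det M = M 0 0 * M 1 1 - M 0 1 * M 1 0.
Proof. by rewrite [in LHS](mx2_eq M) det_mx2. Qed.

Lemma dt_mul U w v : dt (U *m w) (U *m v) = \det U * dt w v.
Proof. rewrite det2E /dt !mulmx2E; ring. Qed.

Lemma dtxx w : dt w w = 0. Proof. rewrite /dt; ring. Qed.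

Lemma vec2_neq0 w : w != 0 -> (w 0 0 != 0) || (w 1 0 != 0).
Proof.
apply: contraR; rewrite negb_or !negbK => /andP[/eqP h0 /eqP h1].
by apply/eqP/vec2P; rewrite mxE.
Qed.

Lemma dt_eq0 w v : w != 0 -> dt w v = 0 -> exists c, v = c *: w.
Proof.
move=> /vec2_neq0 /orP[] n0 /eqP; rewrite /dt subr_eq0 => /eqP e.
  exists (v 0 0 / w 0 0); apply: vec2P; rewrite mxE ?divfK //.
  by apply: (mulfI n0); rewrite e; field.
exists (v 1 0 / w 1 0); apply: vec2P; rewrite mxE ?divfK //.
by apply: (mulfI n0); rewrite -e; field.
Qed.

Lemma dtZr c w v : dt w (c *: v) = c * dt w v.
Proof. rewrite /dt !mxE; ring. Qed.

Lemma dtZl c w v : dt (c *: w) v = c * dt w v.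
Proof. rewrite /dt !mxE; ring. Qed.

Lemma eq_line_dt w v : w != 0 -> v != 0 ->
  (<[w]>%VS == <[v]>%VS :> line) = (dt w v == 0).
Proof.
move=> w0 v0; apply/eq_lineP/eqP => // [[c c0 ->]|].
  by rewrite dtZr dtxx mulr0.
case/(dt_eq0 w0) => c e; exists c => //.
by apply: contra v0 => /eqP c0; rewrite e c0 scale0r.
Qed.

Lemma fixed_lineP U w : U \in unitmx -> w != 0 ->
  act_line U <[w]> = <[w]>%VS <-> exists2 c, c != 0 & U *m w = c *: w.
Proof.
move=> u w0; rewrite act_lineE; split.
  by move/eqP; rewrite eq_sym => /(eq_lineP w0 (mulmx_neq0 u w0)).
case=> c c0 e; apply/eqP; rewrite eq_sym; apply/eq_lineP => //.
  exact: mulmx_neq0.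
by exists c.
Qed.

(** Cayley-Hamilton, applied to an eigenvector. *)
Lemma eigen_char U w c : \det U = 1 -> w != 0 -> U *m w = c *: w ->
  c ^+ 2 - \tr U * c + 1 = 0.
Proof.
move=> dU w0 e.
have := congr1 (fun M : 'cV[C]_2 => M 0 0) e; rewrite mulmx2E mxE => e0.
have := congr1 (fun M : 'cV[C]_2 => M 1 0) e; rewrite mulmx2E mxE => e1.
rewrite /mxtrace sum2E -dU det2E.
case/orP: (vec2_neq0 w0) => n; apply: (mulfI n); rewrite mulr0.
  transitivity ((c - U 1 1) * (c * w 0 0 - U 0 0 * w 0 0) - U 0 1 * U 1 0 * w 0 0).
    by ring.
  rewrite -e0; transitivity (U 0 1 * (c * w 1 0 - (U 1 0 * w 0 0 + U 1 1 * w 1 0))).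
    by ring.
  by rewrite e1; ring.
transitivity ((c - U 0 0) * (c * w 1 0 - U 1 1 * w 1 0) - U 0 1 * U 1 0 * w 1 0).
  by ring.
rewrite -e1; transitivity (U 1 0 * (c * w 0 0 - (U 0 0 * w 0 0 + U 0 1 * w 1 0))).
  by ring.
by rewrite e0; ring.
Qed.

(** Trace 2 means real part 1, and unit length leaves no room for an imaginary
part. *)
Lemma SU2_tr2 U : in_SU2 U -> \tr U = 2 -> U = 1%:M.
Proof.
case/SU2P=> x0 [x1 [x2 [x3 [e ->]]]]; rewrite mx2_trace => /eqP.
rewrite eq_complex /= => /andP[/eqP h _].
have z0 : x0 = 1 by lra.
move: e; rewrite z0 => e.
have := (sqr_ge0 x1, (sqr_ge0 x2, sqr_ge0 x3)) => -[q1 [q2 q3]].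
have z1 : x1 = 0 by apply/eqP; rewrite -sqrf_eq0; apply/eqP; lra.
have z2 : x2 = 0 by apply/eqP; rewrite -sqrf_eq0; apply/eqP; lra.
have z3 : x3 = 0 by apply/eqP; rewrite -sqrf_eq0; apply/eqP; lra.
by rewrite z1 z2 z3 mx2_1 /quat oppr0.
Qed.

Lemma SU2_eigen1 U w : in_SU2 U -> w != 0 -> U *m w = w -> U = 1%:M.
Proof.
move=> hU w0 e; apply: SU2_tr2 => //.
have : U *m w = 1 *: w by rewrite scale1r.
case: (hU) => _ dU /(eigen_char dU w0).
rewrite expr1n mulr1 => h; apply/esym/eqP; rewrite -subr_eq0; apply/eqP.
by rewrite -h; ring.
Qed.

Lemma SU2_eigenN1 U w : in_SU2 U -> w != 0 -> U *m w = - w -> U = - 1%:M.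
Proof.
move=> hU w0 e; apply: oppr_inj; rewrite opprK.
by apply: (SU2_eigen1 (SU2_opp hU) w0); rewrite mulNmx e opprK.
Qed.

Lemma SU2_eigen_sq1 U w c : in_SU2 U -> w != 0 -> U *m w = c *: w ->
  c ^+ 2 = 1 -> U = 1%:M \/ U = - 1%:M.
Proof.
move=> hU w0 e /eqP; rewrite sqrf_eq1 => /orP[]/eqP ce; move: e; rewrite ce.
  by rewrite scale1r => /(SU2_eigen1 hU w0); left.
by rewrite scaleN1r => /(SU2_eigenN1 hU w0); right.
Qed.

Lemma eigen_exists U c : in_SU2 U -> U <> 1%:M -> U <> - 1%:M ->
  c ^+ 2 - \tr U * c + 1 = 0 -> exists2 w : 'cV[C]_2, w != 0 & U *m w = c *: w.
Proof.
move=> hU n1 nN1; rewrite /mxtrace sum2E; case: (hU) => _ dU.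
have dU' := dU; rewrite det2E in dU'; rewrite -{1}dU' => hc.
have [vec vE] : exists vec : C -> C -> 'cV[C]_2,
    forall x y, (vec x y 0 0 = x) * (vec x y 1 0 = y).
  exists (fun x y => \col_(i < 2) if i == 0 then x else y).
  by split; rewrite mxE.
have [b0|b0] := eqVneq (U 0 1) 0; last first.
  exists (vec (U 0 1) (c - U 0 0)).
    by apply: contra b0 => /eqP/matrixP/(_ 0 0); rewrite vE mxE => ->.
  apply: vec2P; rewrite mulmx2E [RHS]mxE !vE; first by ring.
  by apply/eqP; rewrite -subr_eq0; apply/eqP; rewrite -[RHS]oppr0 -hc; ring.
have [c0|c0] := eqVneq (U 1 0) 0; last first.
  exists (vec (c - U 1 1) (U 1 0)).
    by apply: contra c0 => /eqP/matrixP/(_ 1 0); rewrite vE mxE => ->.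
  apply: vec2P; rewrite mulmx2E [RHS]mxE !vE; last by ring.
  by apply/eqP; rewrite -subr_eq0; apply/eqP; rewrite -[RHS]oppr0 -hc; ring.
have : (c - U 0 0) * (c - U 1 1) = 0 by rewrite -[RHS]hc b0 c0; ring.
move/eqP; rewrite mulf_eq0 => /orP[]; rewrite subr_eq0 => /eqP ce.
  exists (vec 1 0).
    by apply/negP => /eqP/matrixP/(_ 0 0); rewrite vE mxE => /eqP; rewrite oner_eq0.
  by apply: vec2P; rewrite mulmx2E [RHS]mxE !vE ?c0 ce; ring.
exists (vec 0 1).
  by apply/negP => /eqP/matrixP/(_ 1 0); rewrite vE mxE => /eqP; rewrite oner_eq0.
by apply: vec2P; rewrite mulmx2E [RHS]mxE !vE ?b0 ce; ring.
Qed.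

Lemma eigen_same U w v c : in_SU2 U -> U <> 1%:M -> U <> - 1%:M ->
  w != 0 -> v != 0 -> U *m w = c *: w -> U *m v = c *: v -> dt w v = 0.
Proof.
move=> hU n1 nN1 w0 v0 e1 e2; apply/eqP; apply: contra_notT nN1 => nz.
case: (hU) => _ dU.
have := dt_mul U w v; rewrite e1 e2 dtZl dtZr dU mul1r mulrA -expr2.
rewrite -[RHS]mul1r => /(mulIf nz) /(SU2_eigen_sq1 hU w0 e1) [] //.
Qed.

(** The two eigenvalues are inverse to each other, so they coincide only when
they are 1 or -1, and then the matrix is a sign. Otherwise each has a single
eigenline. *)
Lemma SU2_two_lines U : in_SU2 U -> U <> 1%:M -> U <> - 1%:M ->
  exists l1 l2 : line, [/\ l1 != l2, \dim l1 = 1%N, \dim l2 = 1%N &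
    forall l, \dim l = 1%N -> (act_line U l == l) = (l == l1) || (l == l2)].
Proof.
move=> hU n1 nN1; case: (hU) => _ dU; have u := SU2_unit hU.
pose t := \tr U; pose s := sqrtC (t ^+ 2 - 4).
have hs : s ^+ 2 = t ^+ 2 - 4 by rewrite sqrtCK.
pose c1 := (t + s) / 2; pose c2 := (t - s) / 2.
have hc (x : C) : x ^+ 2 - t * x + 1 = (x - c1) * (x - c2).
  transitivity (x ^+ 2 - t * x + (t ^+ 2 - s ^+ 2) / 4).
    by rewrite hs; field.
  by rewrite /c1 /c2; field.
have hc1 : c1 ^+ 2 - t * c1 + 1 = 0 by rewrite hc subrr mul0r.
have hc2 : c2 ^+ 2 - t * c2 + 1 = 0 by rewrite hc subrr mulr0.
have [w1 w10 e1] := eigen_exists hU n1 nN1 hc1.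
have [w2 w20 e2] := eigen_exists hU n1 nN1 hc2.
have c12 : c1 * c2 = 1.
  by have := hc 0; rewrite expr0n mulr0 subr0 !add0r mulrNN => <-.
have nc : c1 != c2.
  apply/negP => /eqP e; move: c12; rewrite -e -expr2.
  by case/(SU2_eigen_sq1 hU w10 e1).
have ne : <[w1]>%VS != <[w2]>%VS :> line.
  apply/negP => /(eq_lineP w10 w20) [c c0 w2E].
  move: e2; rewrite w2E -scalemxAr e1 !scalerA => /eqP.
  rewrite -subr_eq0 -scalerBl scaler_eq0 (negbTE w10) orbF.
  rewrite [c2 * _]mulrC -mulrBr mulf_eq0 (negbTE c0) /= subr_eq0.
  by rewrite (negbTE nc).
exists <[w1]>%VS, <[w2]>%VS; split; rewrite ?dim_vline ?w10 ?w20 //.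
have nz c w : w != 0 -> U *m w = c *: w -> c != 0.
  move=> w0 e; have := mulmx_neq0 u w0; rewrite e scaler_eq0 negb_or.
  by case/andP.
apply: line_ind => w w0; apply/eqP/orP.
  move/(fixed_lineP u w0) => [c c0 e].
  have /eqP := eigen_char dU w0 e; rewrite hc mulf_eq0 !subr_eq0.
  case/orP=> /eqP ce; rewrite ce in e; [left|right]; rewrite eq_line_dt //;
  apply/eqP; exact: (eigen_same hU n1 nN1 w0 _ e).
case=> /eqP ->; apply/fixed_lineP => //.
  by exists c1 => //; apply: nz e1.
by exists c2 => //; apply: nz e2.
Qed.
End Lines.

(** * Orbits of lines and the count of fixed lines *)

Section Counting.
Variable R : realType.
Local Notation C := (R[i]).
Local Notation line := {vspace 'cV[C]_2}.
Implicit Types (U V : 'M[C]_2) (l : line) (A B g : 'M[R]_3).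

Lemma spin_exists A : exists U, in_SO3 A -> in_SU2 U /\ double_cover U = A.
Proof.
case: (pselect (in_SO3 A)) => [/double_cover_surj [U h]|n]; first by exists U.
by exists 1%:M => /n.
Qed.

Definition spin A : 'M[C]_2 := projT1 (cid (spin_exists A)).

Lemma spinP A : in_SO3 A -> in_SU2 (spin A) /\ double_cover (spin A) = A.
Proof. exact: (projT2 (cid (spin_exists A))). Qed.

Lemma double_cover_eq U V : in_SU2 U -> in_SU2 V ->
  double_cover U = double_cover V -> exists2 c : C, c ^+ 2 = 1 & U = c *: V.
Proof.
move=> hU hV e; have uV := SU2_unit hV.
have hV' := SU2_inv hV; have h := SU2_mul hU hV'.
have UE : U = U *m invmx V *m V by rewrite mulmxKV.
have hd : double_cover (U *m invmx V) = 1%:M.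
  rewrite (double_coverM hU hV') (double_cover_inv hV) e mulmxV.
    by [].
  by case: (double_cover_SO3 hV) => /mulmx1_unit[].
case: (double_cover_ker h hd) => {}e.
  by exists 1; [rewrite expr1n|rewrite UE e mul1mx scale1r].
by exists (- 1); [rewrite sqrrN expr1n|rewrite UE e mulNmx mul1mx scaleN1r].
Qed.

Variable G : seq 'M[R]_3.
Hypothesis Gpoly : is_polyhedral G.

Lemma spin_SU2 g : g \in G -> in_SU2 (spin g).
Proof. by case/(poly_SO3 Gpoly)/spinP. Qed.

Lemma spin_cover g : g \in G -> double_cover (spin g) = g.
Proof. by case/(poly_SO3 Gpoly)/spinP. Qed.

Lemma spin_BG g : g \in G -> in_BG G (spin g).
Proof. by move=> hg; split; rewrite ?spin_cover //; exact: spin_SU2. Qed.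

Lemma BG_spin U : in_BG G U -> exists2 c : C, c ^+ 2 = 1 & U = c *: spin (double_cover U).
Proof.
case=> hU hg; apply: (double_cover_eq hU (spin_SU2 hg)).
by rewrite spin_cover.
Qed.

Lemma sq1_neq0 (c : C) : c ^+ 2 = 1 -> c != 0.
Proof. by move=> e; rewrite -sqrf_eq0 e oner_eq0. Qed.

Lemma BG_mul U V : in_BG G U -> in_BG G V -> in_BG G (U *m V).
Proof.
case=> hU gU [hV gV]; split; first exact: SU2_mul.
by rewrite (double_coverM hU hV); exact: (poly_mul Gpoly gU gV).
Qed.

Lemma BG_inv U : in_BG G U -> in_BG G (invmx U).
Proof.
case=> hU gU; split; first exact: SU2_inv.
by rewrite (double_cover_inv hU); apply: (Defs.poly_inv Gpoly).
Qed.

Lemma BG_unit U : in_BG G U -> U \in unitmx.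
Proof. by case=> /SU2_unit. Qed.

Lemma BG_opp U : in_BG G U -> in_BG G (- U).
Proof. by case=> h g; split; [exact: SU2_opp|rewrite double_coverN]. Qed.

Lemma BG_1 : in_BG G 1%:M.
Proof. by split; [exact: SU2_1|rewrite double_cover1; apply: (poly_one Gpoly)]. Qed.

Definition rotate g l := act_line (spin g) l.

(** Two lifts of a rotation differ by a sign, which lines do not see; so G
itself acts on lines, through arbitrarily chosen lifts. *)
Lemma act_rotate U l : in_BG G U -> act_line U l = rotate (double_cover U) l.
Proof.
move=> /BG_spin [c c1 e]; rewrite [in LHS]e act_lineZ //; exact: sq1_neq0.
Qed.

Lemma rotateM g h l : g \in G -> h \in G -> rotate (g *m h) l = rotate g (rotate h l).
Proof.
move=> hg hh; rewrite [in RHS]/rotate -act_lineM.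
rewrite [RHS]act_rotate; last by apply: BG_mul; apply: spin_BG.
by rewrite (double_coverM (spin_SU2 hg) (spin_SU2 hh)) !spin_cover.
Qed.

Lemma rotate1 l : rotate 1%:M l = l.
Proof. by rewrite -double_cover1 -act_rotate ?act_line1 //; apply: BG_1. Qed.

Lemma poly_unit g : g \in G -> g \in unitmx.
Proof. by case/(poly_SO3 Gpoly) => /mulmx1_unit[]. Qed.

Lemma rotateK g l : g \in G -> rotate (invmx g) (rotate g l) = l.
Proof.
by move=> hg; rewrite -rotateM ?mulVmx ?rotate1 ?poly_unit //; apply: (Defs.poly_inv Gpoly).
Qed.

Lemma perm_translate g : g \in G -> perm_eq [seq g *m h | h <- G] G.
Proof.
move=> hg; apply: uniq_perm (poly_uniq Gpoly) _.
  rewrite map_inj_in_uniq ?(poly_uniq Gpoly) // => x y _ _ e.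
  by rewrite -(mulKmx (poly_unit hg) x) e mulKmx ?poly_unit.
move=> h; apply/mapP/idP => [[h' hh' ->]|hh]; first exact: (poly_mul Gpoly).
exists (invmx g *m h); last by rewrite mulKVmx ?poly_unit.
by apply: (poly_mul Gpoly) => //; apply: (Defs.poly_inv Gpoly).
Qed.

Lemma stab_orderE l : stab_order G l = count (fun g => rotate g l == l) G.
Proof.
apply: eq_in_count => g hg; apply/asboolP/eqP => [[U [hU gU e]]|e].
  by rewrite -{2}e act_rotate ?gU //; split; rewrite ?gU.
by exists (spin g); split=> //; [exact: spin_SU2|exact: spin_cover].
Qed.

Lemma orbitP S : is_orbit G S -> exists2 l0, \dim l0 = 1%N &
  forall l, l \in S <-> exists2 g, g \in G & l = rotate g l0.
Proof.
case=> _ [l0 d h]; exists l0 => // l; split.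
  move/h => [U hU ->]; exists (double_cover U); first by case: hU.
  by rewrite act_rotate.
by case=> g hg ->; apply/h; exists (spin g) => //; apply: spin_BG.
Qed.

Lemma orbit_rotate S l : is_orbit G S -> l \in S ->
  forall l', l' \in S <-> exists2 g, g \in G & l' = rotate g l.
Proof.
move=> /orbitP[l0 d h] /h[g hg ->] l'; rewrite h; split=> -[k hk ->].
  exists (k *m invmx g); first by apply: (poly_mul Gpoly) => //; apply: (Defs.poly_inv Gpoly).
  by rewrite rotateM ?rotateK //; apply: (Defs.poly_inv Gpoly).
by exists (k *m g); [apply: (poly_mul Gpoly)|rewrite rotateM].
Qed.

Lemma orbit_dim S l : is_orbit G S -> l \in S -> \dim l = 1%N.
Proof.
move=> /orbitP[l0 d h] /h[g hg ->]; apply: dim_act_line => //.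
by apply: SU2_unit; apply: spin_SU2.
Qed.

Lemma sum_count_fibers (I J : eqType) (s : seq I) (r : seq J) (f : I -> J) :
  uniq r -> {in s, forall x, f x \in r} ->
  (\sum_(y <- r) count (fun x => f x == y) s = size s)%N.
Proof.
move=> ur; elim: s => [|x s IH] h; first by rewrite big1.
rewrite big_split /= IH; last by move=> y ys; apply: h; rewrite inE ys orbT.
rewrite -add1n; congr (_ + _)%N.
have xr : f x \in r by apply: h; rewrite inE eqxx.
rewrite (bigD1_seq (f x)) //= eqxx big1 // => y ny.
by rewrite eq_sym (negbTE ny).
Qed.

Lemma orbit_fibre S l l' : is_orbit G S -> l \in S -> l' \in S ->
  count (fun g => rotate g l == l') G = stab_order G l.
Proof.
move=> hS lS /(orbit_rotate hS lS)[h hh ->].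
rewrite stab_orderE -[in LHS](permP (perm_translate hh)) count_map.
apply: eq_in_count => g hg /=; rewrite rotateM //.
apply/eqP/eqP => [e|->//].
by rewrite -(rotateK (rotate g l) hh) e rotateK.
Qed.

Lemma rotate_mem S l g : is_orbit G S -> l \in S -> g \in G -> rotate g l \in S.
Proof. by move=> hS lS hg; apply/(orbit_rotate hS lS); exists g. Qed.

Lemma orbit_stabiliser S l : is_orbit G S -> l \in S ->
  (size S * stab_order G l = size G)%N.
Proof.
move=> hS lS.
have hf : {in G, forall g, rotate g l \in S} by move=> g; apply: rotate_mem.
rewrite -(sum_count_fibers (proj1 hS) hf) -sum1_size big_distrl /=.
by apply: eq_big_seq => l' l'S; rewrite mul1n (orbit_fibre hS lS l'S).
Qed.

Lemma prod_count_fibers (A : comNzRingType) (I J : eqType) (s : seq I)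
    (r : seq J) (f : I -> J) (F : J -> A) :
  uniq r -> {in s, forall x, f x \in r} ->
  \prod_(x <- s) F (f x) = \prod_(y <- r) F y ^+ count (fun x => f x == y) s.
Proof.
move=> ur; elim: s => [|x s IH] h; first by rewrite big_nil big1.
rewrite big_cons IH; last by move=> y ys; apply: h; rewrite inE ys orbT.
have xr : f x \in r by apply: h; rewrite inE eqxx.
under [RHS]eq_bigr do rewrite /= exprD.
rewrite big_split /=; congr (_ * _).
rewrite (bigD1_seq (f x)) //= eqxx expr1 big1 ?mulr1 // => y ny.
by rewrite eq_sym (negbTE ny).
Qed.

Lemma orbit_size_gt0 S : is_orbit G S -> (0 < size S)%N.
Proof.
move=> hS; case/orbitP: (hS) => l0 d h.
have : rotate 1%:M l0 \in S by apply/h; exists 1%:M => //; apply: (poly_one Gpoly).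
by case: (S).
Qed.

Variables (Omega : finType) (S : Omega -> seq line) (nu : Omega -> nat).
Hypothesis Sexc : is_exceptional_orbits G S nu.

Lemma orbit_nonempty T : is_orbit G T -> exists l, l \in T.
Proof. by move=> /orbit_size_gt0; case: T => // l T _; exists l; rewrite inE eqxx. Qed.

Lemma exc_size i : (size (S i) * nu i = size G)%N.
Proof.
have hS := exc_orbit Sexc i; have [l lS] := orbit_nonempty hS.
by rewrite -(exc_stab Sexc lS); apply: orbit_stabiliser.
Qed.

(** Both fixed lines of a nontrivial rotation have a nontrivial stabiliser, so
each of them occurs in exactly one of the S i. *)
Lemma rotation_fixed_lines g : g \in G -> g != 1%:M ->
  (\sum_i \sum_(l <- S i) (rotate g l == l) = 2)%N.
Proof.
move=> hg ng.
have [|||l1 [l2 [n12 d1 d2 hl]]] := @SU2_two_lines _ (spin g).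
- exact: spin_SU2.
- by move=> e; case/eqP: ng; rewrite -(spin_cover hg) e double_cover1.
- by move=> e; case/eqP: ng;
  rewrite -(spin_cover hg) e double_coverN ?double_cover1 //; exact: SU2_1.
have ex l : \dim l = 1%N -> rotate g l == l -> exists i, l \in S i.
  move=> d e; apply: (exc_all Sexc) => //; rewrite stab_orderE.
  rewrite (permP (perm_to_rem (poly_one Gpoly))) /= rotate1 eqxx add1n ltnS.
  rewrite -has_count; apply/hasP; exists g => //.
  by rewrite mem_rem_uniq ?(poly_uniq Gpoly) // inE ng.
have one l : \dim l = 1%N -> rotate g l == l -> (\sum_i \sum_(l' <- S i) (l' == l) = 1)%N.
  move=> d e; have [i li] := ex l d e.
  rewrite (bigD1 i) //= (bigD1_seq l) //=; last by case: (exc_orbit Sexc i).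
  rewrite eqxx !big1 // => [j nj|l' /negbTE -> //].
  rewrite big_seq big1 // => l' l'j; case: eqP => // l'E.
  by case/eqP: nj; apply: (exc_distinct Sexc _ li); rewrite -l'E.
have f1 : rotate g l1 == l1 by rewrite /rotate hl // eqxx.
have f2 : rotate g l2 == l2 by rewrite /rotate hl // eqxx orbT.
transitivity (\sum_i \sum_(l <- S i) (l == l1) + \sum_i \sum_(l <- S i) (l == l2))%N;
  last by rewrite (one l1) // (one l2).
rewrite -big_split; apply: eq_bigr => i _.
rewrite -big_split; apply: eq_big_seq => l li /=.
rewrite /rotate hl; last exact: orbit_dim (exc_orbit Sexc i) li.
by case: eqP => [->|_]; case: eqP => // e; case/eqP: n12.
Qed.

(** The pairs of a rotation and a fixed exceptional line, counted by lines and
by rotations; every rotation but the identity contributes 2. *)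
Lemma exc_count : (\sum_i size (S i) * nu i + 2 = \sum_i size (S i) + 2 * size G)%N.
Proof.
have e : (\sum_i size (S i) * nu i = \sum_(g <- G) \sum_i \sum_(l <- S i) (rotate g l == l))%N.
  rewrite exchange_big /=; apply: eq_bigr => i _; rewrite exchange_big /=.
  rewrite -sum1_size big_distrl /=; apply: eq_big_seq => l li.
  by rewrite mul1n -(exc_stab Sexc li) stab_orderE -sum1_count big_mkcond.
rewrite {}e (perm_big _ (perm_to_rem (poly_one Gpoly))) big_cons /= -addnA.
congr (_ + _)%N.
  apply: eq_bigr => i _; rewrite -sum1_size; apply: eq_bigr => l _.
  by rewrite rotate1 eqxx.
transitivity (\sum_(g <- rem 1%:M G) 2 + 2)%N.
  congr (_ + _)%N; apply: eq_big_seq => g.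
  rewrite mem_rem_uniq ?(poly_uniq Gpoly) // inE => /andP[ng hg].
  exact: rotation_fixed_lines.
have -> (s : seq 'M[R]_3) : (\sum_(g <- s) 2 = 2 * size s)%N.
  by rewrite -sum1_size big_distrr.
rewrite size_rem ?(poly_one Gpoly) //.
by rewrite -[X in (_ + X)%N]muln1 -mulnDr addn1 prednK //; case: (G) (poly_one Gpoly).
Qed.
End Counting.

(** * Binary forms as functions *)

HB.lock Definition ev (R : realType) (p : {mpoly R[i][2]}) (w : 'cV[R[i]]_2) : R[i] :=
  p.@[fun i => w i 0].

HB.lock Definition sub (R : realType) (U : 'M[R[i]]_2) (p : {mpoly R[i][2]}) :
  {mpoly R[i][2]} := subst_poly U p.

Section Forms.
Variable R : realType.
Local Notation C := (R[i]).
Implicit Types (U V : 'M[C]_2) (w v : 'cV[C]_2) (p q : {mpoly C[2]}).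

Lemma poly_vanish_eq0 (P : {poly C}) : (forall t, t != 0 -> P.[t] = 0) -> P = 0.
Proof.
move=> h; apply: (@roots_geq_poly_eq0 _ _ [seq i.+1%:R | i <- iota 0 (size P)]).
- by apply/allP => _ /mapP[i _ ->]; apply/rootP/h; rewrite pnatr_eq0.
- rewrite map_inj_uniq ?iota_uniq // => i j /eqP.
  by rewrite eqr_nat => /eqP [].
- by rewrite size_map size_iota.
Qed.

Lemma evE p w : ev p w = \sum_(m <- msupp p) p@_m * (w 0 0 ^+ m 0%R * w 1 0 ^+ m 1%R).
Proof.
rewrite ev.unlock mevalE; apply: eq_bigr => m _; congr (_ * _).
rewrite !big_ord_recl big_ord0 mulr1; congr (w _ _ ^+ m _ * w _ _ ^+ m _); exact: val_inj.
Qed.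

Definition cvec (x y : C) : 'cV[C]_2 := \col_(i < 2) if i == 0 then x else y.
Lemma cvecE x y : (cvec x y 0 0 = x) * (cvec x y 1 0 = y).
Proof. by split; rewrite mxE. Qed.

Lemma cvec_neq0 x y : (x != 0) || (y != 0) -> cvec x y != 0.
Proof.
apply: contraL => /eqP/matrixP h; have := h 0 0; have := h 1 0.
by rewrite !cvecE !mxE => -> ->; rewrite eqxx.
Qed.

Lemma mnm2P (m m' : 'X_{1..2}) : m 0%R = m' 0%R -> m 1%R = m' 1%R -> m = m'.
Proof. by move=> e0 e1; apply/mnmP; elim/ord2P. Qed.

Lemma mdeg2 (m : 'X_{1..2}) : mdeg m = (m 0%R + m 1%R)%N.
Proof.
rewrite mdegE !big_ord_recl big_ord0 addn0; congr (m _ + m _)%N; exact: val_inj.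
Qed.

(** Kronecker substitution: on the curve (t, t^N) with N larger than the degree
distinct monomials have distinct powers of t. *)
Lemma ev_eq0 p : (forall w, ev p w = 0) -> p = 0.
Proof.
move=> h; pose N := msize p.
pose P : {poly C} := \sum_(m <- msupp p) p@_m *: 'X^(m 0%R + N * m 1%R).
have P0 : P = 0.
  apply: poly_vanish_eq0 => t _; rewrite -[RHS](h (cvec t (t ^+ N))) evE horner_sum.
  by apply: eq_bigr => m _; rewrite hornerZ hornerXn !cvecE exprD exprM.
apply/mpolyP => m; rewrite mcoeff0.
case: (boolP (m \in msupp p)) => [mp|]; last by rewrite -mcoeff_eq0 => /eqP.
have := congr1 (fun Q : {poly C} => Q`_(m 0%R + N * m 1%R)) P0.
rewrite coef0 coef_sum (bigD1_seq m) ?msupp_uniq //= coefZ coefXn eqxx mulr1.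
rewrite big_seq_cond big1 ?addr0 // => m' /andP[m'p n].
rewrite coefZ coefXn; case: eqP => [e|_]; last by rewrite mulr0.
have small (k : 'X_{1..2}) : k \in msupp p -> (k 0%R < N)%N.
  by move=> /msize_mdeg_lt; rewrite mdeg2; apply: leq_ltn_trans; rewrite leq_addr.
case/eqP: n; have N0 : (0 < N)%N by apply: leq_ltn_trans (small _ mp).
have e1 : m 1%R = m' 1%R.
  have := congr1 (divn^~ N) e; rewrite !(addnC _ (N * _)%N) !(mulnC N) !divnMDl //.
  by rewrite !divn_small ?small // !addn0.
by apply: mnm2P => //; move/eqP: e; rewrite e1 eqn_add2r => /eqP.
Qed.

Lemma evP p q : (forall w, ev p w = ev q w) -> p = q.
Proof.
move=> h; apply/eqP; rewrite -subr_eq0; apply/eqP/ev_eq0 => w.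
by rewrite ev.unlock mevalB; have := h w; rewrite ev.unlock => ->; rewrite subrr.
Qed.

Lemma evM p q w : ev (p * q) w = ev p w * ev q w. Proof. by rewrite ev.unlock mevalM. Qed.
Lemma evD p q w : ev (p + q) w = ev p w + ev q w. Proof. by rewrite ev.unlock mevalD. Qed.
Lemma evB p q w : ev (p - q) w = ev p w - ev q w. Proof. by rewrite ev.unlock mevalB. Qed.
Lemma evN p w : ev (- p) w = - ev p w. Proof. by rewrite ev.unlock mevalN. Qed.
Lemma evZ c p w : ev (c *: p) w = c * ev p w. Proof. by rewrite ev.unlock mevalZ. Qed.
Lemma evC c w : ev c%:MP w = c. Proof. by rewrite ev.unlock mevalC. Qed.
Lemma ev0 w : ev 0 w = 0. Proof. by rewrite ev.unlock meval0. Qed.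
Lemma ev1 w : ev 1 w = 1. Proof. by rewrite ev.unlock meval1. Qed.
Lemma evX i w : ev 'X_i w = w i 0. Proof. by rewrite ev.unlock mevalXU. Qed.
Lemma evXn p n w : ev (p ^+ n) w = ev p w ^+ n. Proof. by rewrite ev.unlock rmorphXn. Qed.
Lemma ev_prod (I : Type) (r : seq I) (Q : pred I) (f : I -> {mpoly C[2]}) w :
  ev (\prod_(i <- r | Q i) f i) w = \prod_(i <- r | Q i) ev (f i) w.
Proof. by rewrite ev.unlock rmorph_prod. Qed.

Lemma ev_sub U p w : ev (sub U p) w = ev p (U *m w).
Proof.
rewrite ev.unlock sub.unlock /subst_poly comp_mpoly_meval; apply: meval_eq => i.
rewrite tnth_mktuple mxE raddf_sum /=; apply: eq_bigr => j _.
by rewrite mevalZ mevalXU.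
Qed.

Lemma sub0 U : sub U 0 = 0.
Proof. by rewrite sub.unlock; exact: comp_mpoly0. Qed.

Lemma subM U V p : sub (U *m V) p = sub V (sub U p).
Proof. by apply: evP => w; rewrite !ev_sub mulmxA. Qed.

Lemma sub1 p : sub 1%:M p = p.
Proof. by apply: evP => w; rewrite ev_sub mul1mx. Qed.

Lemma sub_eq0 U p : U \in unitmx -> (sub U p == 0) = (p == 0).
Proof.
move=> u; apply/eqP/eqP => [e|->]; last by exact: sub0.
apply: ev_eq0 => w; rewrite -(mulKVmx u w) -ev_sub e ev0 //.
Qed.

Lemma sub_mul U p q : sub U (p * q) = sub U p * sub U q.
Proof. by apply: evP => w; rewrite evM !ev_sub evM. Qed.
Lemma sub_add U p q : sub U (p + q) = sub U p + sub U q.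
Proof. by apply: evP => w; rewrite evD !ev_sub evD. Qed.
Lemma sub_sub U p q : sub U (p - q) = sub U p - sub U q.
Proof. by apply: evP => w; rewrite evB !ev_sub evB. Qed.
Lemma subZ U c p : sub U (c *: p) = c *: sub U p.
Proof. by apply: evP => w; rewrite evZ !ev_sub evZ. Qed.
Lemma sub_prod U (I : Type) (r : seq I) (f : I -> {mpoly C[2]}) :
  sub U (\prod_(i <- r) f i) = \prod_(i <- r) sub U (f i).
Proof.
by apply: evP => w; rewrite ev_sub !ev_prod; apply: eq_bigr => i _; rewrite ev_sub.
Qed.

Lemma sub_exp U p n : sub U (p ^+ n) = sub U p ^+ n.
Proof. by apply: evP => w; rewrite evXn !ev_sub evXn. Qed.
Lemma scale_inj p (c d : C) : p != 0 -> c *: p = d *: p -> c = d.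
Proof.
move=> p0 /eqP; rewrite -subr_eq0 -scalerBl -mul_mpolyC mulf_eq0 (negbTE p0) orbF.
by rewrite mpolyC_eq0 subr_eq0 => /eqP.
Qed.

Lemma subC U c : sub U c%:MP = c%:MP.
Proof. by apply: evP => w; rewrite ev_sub !evC. Qed.

(** An integral degree lets differences of degrees appear before they are known
to be nonnegative; the condition on values makes products, quotients and
substitutions immediate. *)
Definition hom (z : int) p := forall (c : C) w, c != 0 -> ev p (c *: w) = c ^ z * ev p w.

Lemma homog_hom d p : p \is d.-homog -> hom d%:Z p.
Proof.
move=> /dhomogP h c w c0; rewrite !evE mulr_sumr !big_seq; apply: eq_bigr => m mp.
have <- : mdeg m = d by apply: h.
by rewrite !mxE mdeg2 !exprMn -exprnP exprD; ring.
Qed.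

(** Scaling by 2 multiplies a monomial of degree m by 2^m, and these factors are
distinct. *)
Lemma hom_homog d p : hom d%:Z p -> p \is d.-homog.
Proof.
move=> h; pose q := \sum_(m <- msupp p) (p@_m * (2 ^+ mdeg m - 2 ^+ d)) *: 'X_[m] : {mpoly C[2]}.
have q0 : q = 0.
  apply: ev_eq0 => w; rewrite /q ev.unlock raddf_sum /=.
  transitivity (ev p (2 *: w) - 2 ^+ d * ev p w); last first.
    by rewrite h ?pnatr_eq0 // subrr.
  rewrite !evE mulr_sumr -sumrB; apply: eq_bigr => m _.
  rewrite mevalZ mevalX !big_ord_recl big_ord0 mulr1 !mxE mdeg2.
  rewrite (_ : lift ord0 ord0 = 1); last exact: val_inj.
  by rewrite !exprMn exprD; ring.
apply/dhomogP => m mp.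
have := congr1 (fun Q => Q@_m) q0; rewrite mcoeff0 /q raddf_sum /= (bigD1_seq m) ?msupp_uniq //=.
rewrite mcoeffZ mcoeffX eqxx mulr1 big1 ?addr0 => [|m' n]; last first.
  by rewrite mcoeffZ mcoeffX (negbTE n) mulr0.
move/eqP; rewrite mulf_eq0 mcoeff_eq0 mp /= subr_eq0 -!natrX eqr_nat eqn_exp2l //.
by move/eqP.
Qed.

Lemma homM z z' p q : hom z p -> hom z' q -> hom (z + z') (p * q).
Proof.
move=> hp hq c w c0; rewrite !evM hp // hq // expfzDr //; ring.
Qed.

Lemma homB z p q : hom z p -> hom z q -> hom z (p - q).
Proof. by move=> hp hq c w c0; rewrite !evB hp // hq // mulrBr. Qed.

(** A nonzero factor can be cancelled from the substitution identity that
expresses homogeneity, also where it has zeros. *)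
Lemma homMl z z' p q : q != 0 -> hom z (q * p) -> hom z' q -> hom (z - z') p.
Proof.
move=> q0 hqp hq c w c0.
have e : sub c%:M p = (c ^ (z - z')) *: p.
  apply: (mulfI q0); apply: evP => v.
  rewrite !evM ev_sub evZ mul_scalar_mx.
  apply: (mulfI (expfz_neq0 z' c0)); rewrite mulrA -hq // -evM hqp // evM.
  have -> : c ^ z = c ^ z' * c ^ (z - z') by rewrite -expfzDr // addrC subrK.
  by ring.
by rewrite -evZ -e ev_sub mul_scalar_mx.
Qed.

Lemma hom_sub z U p : hom z p -> hom z (sub U p).
Proof. by move=> h c w c0; rewrite !ev_sub -scalemxAr h. Qed.

Lemma hom_prod (I : Type) (r : seq I) (f : I -> {mpoly C[2]}) (z : I -> int) :
  (forall i, hom (z i) (f i)) -> hom (\sum_(i <- r) z i) (\prod_(i <- r) f i).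
Proof.
move=> h; elim: r => [|i r IH]; last by rewrite !big_cons; apply: homM.
by rewrite !big_nil => c w c0; rewrite !ev1 expr0z mulr1.
Qed.

Lemma homX z p n : hom z p -> hom (n%:Z * z) (p ^+ n).
Proof.
move=> h c w c0; rewrite !evXn h // exprMn; congr (_ * _).
by rewrite exprnP exprz_exp mulrC.
Qed.

End Forms.

(** * Linear factors, Euler identity and Jacobians *)

Section LinearForms.
Variable R : realType.
Local Notation C := (R[i]).
Implicit Types (U V : 'M[C]_2) (w v : 'cV[C]_2) (p q : {mpoly C[2]}).

(** The linear form whose zeros are the multiples of w. *)
Definition lf w : {mpoly C[2]} := w 0 0 *: 'X_1 - w 1 0 *: 'X_0.

Lemma ev_lf w v : ev (lf w) v = dt w v.
Proof. by rewrite /lf evB !evZ !evX. Qed.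

Lemma sub_lf U w : \det U = 1 -> sub U (lf w) = lf (invmx U *m w).
Proof.
move=> dU; have u : U \in unitmx by rewrite unitmxE dU unitr1.
apply: evP => v; rewrite ev_sub !ev_lf.
by rewrite -[in LHS](mulKVmx u w) dt_mul dU mul1r.
Qed.

Lemma lfZ c w : lf (c *: w) = c *: lf w.
Proof. by apply: evP => v; rewrite evZ !ev_lf dtZl. Qed.

Lemma hom_lf w : hom 1 (lf w).
Proof. by move=> c v c0; rewrite !ev_lf dtZr expr1z. Qed.

Lemma lf_neq0 w : w != 0 -> lf w != 0.
Proof.
move=> w0; apply/negP => /eqP e.
have h v : dt w v = 0 by rewrite -ev_lf e ev0.
have := h (cvec 0 1); have := h (cvec 1 0); rewrite /dt !cvecE.
rewrite !mulr1 !mulr0 sub0r subr0 => /eqP; rewrite oppr_eq0 => /eqP w1 w00.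
by case/orP: (vec2_neq0 w0); rewrite ?w1 ?w00 eqxx.
Qed.

Lemma X0_dvd p : (forall t, t != 0 -> ev p (cvec 0 t) = 0) -> exists q, p = 'X_0 * q.
Proof.
move=> h.
pose P : {poly C} := \sum_(m <- msupp p) (if m 0 == 0%N then p@_m else 0) *: 'X^(m 1%R).
have P0 : P = 0.
  apply: poly_vanish_eq0 => t t0; rewrite -[RHS](h t t0) evE horner_sum.
  apply: eq_bigr => m _; rewrite hornerZ hornerXn !cvecE expr0n; case: eqP => _.
    by rewrite mul1r.
  by rewrite !mul0r mulr0.
have supp m : m \in msupp p -> (0 < m 0%R)%N.
  move=> mp; rewrite lt0n; apply/negP => m0.
  have := congr1 (fun Q : {poly C} => Q`_(m 1)) P0.
  rewrite coef0 coef_sum (bigD1_seq _ mp) ?msupp_uniq //= m0 coefZ coefXn eqxx mulr1.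
  rewrite big1 ?addr0 => [/eqP|m' n].
    by rewrite mcoeff_eq0 mp.
  rewrite coefZ coefXn; case: eqP => [m'0|_]; last by rewrite mul0r.
  case: eqP => [e|_]; last by rewrite mulr0.
  by case/eqP: n; apply: mnm2P => //; rewrite (eqP m0) m'0.
exists (\sum_(m <- msupp p) p@_m *: 'X_[m - U_(0)]).
rewrite {1}[p]mpolyE mulr_sumr !big_seq; apply: eq_bigr => m /supp m0.
by rewrite -scalerAr -mpolyXD addmC submK // lep1mP -lt0n.
Qed.

Lemma dt_complement w : w != 0 -> exists u, dt u w = 1.
Proof.
case/vec2_neq0/orP => n.
  exists (cvec 0 (- (w 0 0)^-1)); rewrite /dt !cvecE; by field.
exists (cvec (w 1 0)^-1 0); rewrite /dt !cvecE; by field.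
Qed.

(** A linear change of variables moves the line of w to the line X_0 = 0. *)
Lemma lf_dvd p w : w != 0 -> (forall t, t != 0 -> ev p (t *: w) = 0) ->
  exists q, p = lf w * q.
Proof.
move=> w0 h; have [u uw] := dt_complement w0.
pose M := mx2 (u 0 0) (w 0 0) (u 1 0) (w 1 0).
have dM : \det M = 1 by rewrite det_mx2 -uw /dt mulrC [w 0 0 * _]mulrC.
have uM : M \in unitmx by rewrite unitmxE dM unitr1.
have Mv v : M *m v = v 0 0 *: u + v 1 0 *: w.
  by apply: vec2P; rewrite mulmx2E !mxE /=; ring.
have [q e] : exists q, sub M p = 'X_0 * q.
  apply: X0_dvd => t t0; rewrite ev_sub Mv !cvecE scale0r add0r; exact: h.
exists (- sub (invmx M) q).
have -> : p = sub (invmx M) (sub M p) by rewrite -subM mulmxV // sub1.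
rewrite e sub_mul mulrN -mulNr; congr (_ * _); apply: evP => v.
rewrite ev_sub evN ev_lf evX -[in RHS](mulKVmx uM v) Mv.
rewrite /dt !mxE -[LHS]mulr1 -uw /dt; ring.
Qed.

Lemma msize_homog d p : p != 0 -> p \is d.-homog -> msize p = d.+1.
Proof.
move=> p0 h; have /(dhomog_uniq p0 h) -> := dhomog_msize h.
by rewrite prednK // lt0n mmeasure_poly_eq0.
Qed.

Lemma msize_lf w : w != 0 -> msize (lf w) = 2%N.
Proof.
by move=> w0; apply: msize_homog (lf_neq0 w0) _; apply: hom_homog; apply: hom_lf.
Qed.

(** Splitting off the exact order of vanishing along a line. *)
Lemma lf_order p w : p != 0 -> w != 0 ->
  exists s q, p = lf w ^+ s * q /\ exists2 t, t != 0 & ev q (t *: w) != 0.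
Proof.
move=> + w0; have [n] := ubnP (msize p); elim: n p => // n IH p hn p0.
case: (pselect (forall t, t != 0 -> ev p (t *: w) = 0)) => [h|h]; last first.
  exists 0%N, p; split; first by rewrite mul1r.
  apply: contrapT => h'; apply: h => t t0; apply/eqP; apply: contrapT => /negP n0.
  by apply: h'; exists t.
have [q e] := lf_dvd w0 h.
have q0 : q != 0 by apply: contra p0 => /eqP q0; rewrite e q0 mulr0.
have : (msize q < n)%N.
  by move: hn; rewrite e msizeM ?lf_neq0 // msize_lf // ltnS.
case/IH=> // s [q' [e' h']]; exists s.+1, q'; split=> //.
by rewrite e e' exprS mulrA.
Qed.

(** A factor without zeros on the line of w is prime to the linear form of w. *)
Lemma lf_dvd_coprime w s a q p : w != 0 -> (forall t, t != 0 -> ev a (t *: w) != 0) ->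
  a * q = lf w ^+ s * p -> exists q', q = lf w ^+ s * q'.
Proof.
move=> w0 ha; elim: s q p => [|s IH] q p e; first by exists q; rewrite mul1r.
have [q' e'] : exists q', q = lf w * q'.
  apply: lf_dvd => // t t0; apply: (mulfI (ha t t0)).
  by rewrite -evM e evM evXn ev_lf dtZr dtxx mulr0 expr0n mul0r mulr0.
have [q'' e''] : exists q'', q' = lf w ^+ s * q''.
  apply: (IH _ p); apply: (mulfI (lf_neq0 w0)).
  by rewrite mulrCA -e' e exprS mulrA.
by exists q''; rewrite e' e'' exprS mulrA.
Qed.

(** Linear forms of distinct lines are pairwise coprime, as each has no zero on
the lines of the others. *)
Lemma prod_lf_dvd (I : eqType) (r : seq I) (w : I -> 'cV[C]_2) (s : I -> nat) p :
  uniq r -> {in r, forall i, w i != 0} ->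
  {in r &, forall i j, i != j -> dt (w i) (w j) != 0} ->
  {in r, forall i, exists q, p = lf (w i) ^+ s i * q} ->
  exists q, p = (\prod_(i <- r) lf (w i) ^+ s i) * q.
Proof.
elim: r => [|i r IH] /=; first by exists p; rewrite big_nil mul1r.
case/andP=> ir ur w0 wd hp.
have [|||q e] := IH ur.
- by move=> j jr; apply: w0; rewrite inE jr orbT.
- by move=> j k jr kr; apply: wd; rewrite inE ?jr ?kr orbT.
- by move=> j jr; apply: hp; rewrite inE jr orbT.
have ii : i \in i :: r by rewrite inE eqxx.
have [q1 e1] := hp i ii.
have [q' e'] : exists q', q = lf (w i) ^+ s i * q'.
  apply: (lf_dvd_coprime (a := \prod_(i <- r) lf (w i) ^+ s i) (p := q1)).
  - exact: w0.
  - move=> t t0; rewrite ev_prod prodf_seq_neq0; apply/allP => j jr /=.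
    rewrite evXn ev_lf dtZr expf_neq0 // mulf_neq0 // wd // ?inE ?jr ?orbT //.
    by apply: contra ir => /eqP <-.
  - by rewrite -e.
by exists q'; rewrite big_cons e e' mulrCA mulrA.
Qed.

Lemma homog_const p : hom 0 p -> exists c, p = c%:MP.
Proof.
move=> h; have hp : p \is 0%N.-homog by apply: hom_homog.
have [->|p0] := eqVneq p 0; first by exists 0; rewrite mpolyC0.
have /msize_poly1P [c _ ->] : msize p == 1%N by rewrite (msize_homog p0 hp).
by exists c.
Qed.

(** After dehomogenising this is the fundamental theorem of algebra; the root at
infinity is treated apart. *)
Lemma form_zero d p : hom d%:Z p -> (0 < d)%N -> exists2 w, w != 0 & ev p w = 0.
Proof.
move=> h d0; have hp := hom_homog h.
have [e|n0] := eqVneq (ev p (cvec 1 0)) 0.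
  by exists (cvec 1 0) => //; rewrite cvec_neq0 // oner_eq0.
pose P : {poly C} := \sum_(m <- msupp p) p@_m *: 'X^(m 0%R).
have PE t : P.[t] = ev p (cvec t 1).
  rewrite evE horner_sum; apply: eq_bigr => m _.
  by rewrite hornerZ hornerXn !cvecE expr1n mulr1.
have Pd : P`_d = ev p (cvec 1 0).
  rewrite evE coef_sum big_seq [RHS]big_seq; apply: eq_bigr => m mp.
  have := dhomog_mf hp mp; rewrite /= mdeg2 => dm.
  rewrite coefZ coefXn !cvecE expr1n mul1r expr0n; congr (_ * _%:R).
  by rewrite -dm -{2}[m 0]addn0 eqn_add2l.
have sP : size P != 1%N.
  apply/negP => /eqP e; case/eqP: n0; rewrite -Pd; apply: nth_default.
  by rewrite e.
have [x /rootP] := closed_rootP P sP; rewrite PE => e.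
by exists (cvec x 1) => //; rewrite cvec_neq0 // oner_eq0 orbT.
Qed.

Lemma hom_ge0 z p : p != 0 -> hom z p -> 0 <= z.
Proof.
move=> p0 h; rewrite leNgt; apply/negP => z0.
have w0 : cvec 0 1 != 0 :> 'cV[C]_2 by rewrite cvec_neq0 // oner_eq0 orbT.
have hz : (`|z|%N%:Z * 1 + z : int) = 0 by rewrite mulr1; lia.
have := homM (homX `|z|%N (hom_lf (cvec 0 1))) h; rewrite hz => /homog_const[c e].
have := congr1 (fun q => ev q (cvec 0 1)) e.
rewrite evM evXn ev_lf dtxx expr0n evC absz_eq0 (lt_eqF z0) mul0r => c0.
move/eqP: e; rewrite -c0 mpolyC0 mulf_eq0 (negbTE p0) orbF.
by rewrite expf_eq0 (negbTE (lf_neq0 w0)) andbF.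
Qed.

(** Forms of positive degree have zeros, so a form that has lost all its zeros
by splitting off linear factors is a constant. *)
Lemma form_nozero z p : p != 0 -> hom z p -> (forall v, v != 0 -> ev p v != 0) ->
  z = 0 /\ exists2 c, c != 0 & p = c%:MP.
Proof.
move=> p0 h nz; have := hom_ge0 p0 h; case: z h => // n h _.
have n0 : n = 0%N.
  case: (posnP n) => // n0; have [v v0 /eqP] := form_zero h n0.
  by rewrite (negbTE (nz v v0)).
rewrite n0 in h *; split=> //; have [c e] := homog_const h; exists c => //.
by apply: contra p0 => /eqP c0; rewrite e c0 mpolyC0.
Qed.

Lemma euler d p : hom d%:Z p -> 'X_0 * p^`M(0) + 'X_1 * p^`M(1) = d%:R *: p.
Proof.
move=> /hom_homog /dhomogP h.
have xd i (m : 'X_{1..2}) : 'X_i * ('X_[m] : {mpoly C[2]})^`M(i) = (m i)%:R *: 'X_[m].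
  rewrite mderivX -scalerAr -mpolyXD; have [->|n] := eqVneq (m i) 0%N.
    by rewrite !scale0r.
  by rewrite addmC submK // lep1mP.
rewrite [p]mpolyE !raddf_sum /= !mulr_sumr -big_split /= !big_seq.
apply: eq_bigr => m /h dm.
rewrite !mderivZ -!scalerAr !xd !scalerA -scalerDl -mulrDr -natrD -mdeg2.
by rewrite (dm : mdeg m = d) mulrC.
Qed.

Lemma leibniz_scale (A : algType C) (a b : C) (x y x0 x1 y0 y1 : A) :
  (a *: x0 + b *: x1) * y + x * (a *: y0 + b *: y1) =
  a *: (x0 * y + x * y0) + b *: (x1 * y + x * y1).
Proof. by rewrite !scalerDr mulrDl mulrDr -!scalerAl -!scalerAr addrACA. Qed.

Lemma mderiv_subD U j p q :
  (sub U p)^`M(j) = U 0 j *: sub U p^`M(0) + U 1 j *: sub U p^`M(1) ->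
  (sub U q)^`M(j) = U 0 j *: sub U q^`M(0) + U 1 j *: sub U q^`M(1) ->
  (sub U (p + q))^`M(j) =
  U 0 j *: sub U (p + q)^`M(0) + U 1 j *: sub U (p + q)^`M(1).
Proof.
move=> hp hq; rewrite sub_add !mderivD hp hq !sub_add !scalerDr; exact: addrACA.
Qed.

Lemma mderiv_subM U j p q :
  (sub U p)^`M(j) = U 0 j *: sub U p^`M(0) + U 1 j *: sub U p^`M(1) ->
  (sub U q)^`M(j) = U 0 j *: sub U q^`M(0) + U 1 j *: sub U q^`M(1) ->
  (sub U (p * q))^`M(j) =
  U 0 j *: sub U (p * q)^`M(0) + U 1 j *: sub U (p * q)^`M(1).
Proof.
move=> hp hq; rewrite (sub_mul U p q) [LHS]mderivM hp hq [LHS]leibniz_scale.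
have h i : sub U p^`M(i) * sub U q + sub U p * sub U q^`M(i) = sub U (p * q)^`M(i).
  by rewrite [in RHS]mderivM [RHS]sub_add !sub_mul.
rewrite (h 0) (h 1); exact: erefl.
Qed.

Lemma sub_X U i : sub U 'X_i = U i 0 *: 'X_0 + U i 1 *: 'X_1.
Proof.
by apply: evP => w; rewrite ev_sub evD !evZ !evX !mxE sum2E.
Qed.

(** The chain rule for linear substitutions. *)
Lemma mderiv_sub U j p :
  (sub U p)^`M(j) = U 0 j *: sub U p^`M(0) + U 1 j *: sub U p^`M(1).
Proof.
have mX (i k : 'I_2) : ('X_i : {mpoly C[2]})^`M(k) = (i == k)%:R%:MP.
  rewrite mderivX mnm1E; case: eqP => [->|_]; last by rewrite scale0r mpolyC0.
  rewrite scale1r (_ : (U_(k) - U_(k))%MM = 0%MM) ?mpolyX0 ?mpolyC1 //.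
  by apply/mnmP => l; rewrite mnmBE subnn mnm0E.
have hX i : (sub U 'X_i)^`M(j) = U 0 j *: sub U 'X_i^`M(0) + U 1 j *: sub U 'X_i^`M(1).
  rewrite sub_X mderivD !mderivZ !mX !subC -!mul_mpolyC -!mpolyCM -!mpolyCD.
  congr (_%:MP); elim/ord2P: i; elim/ord2P: j; rewrite /=; ring.
have hC c : (sub U c%:MP)^`M(j) = U 0 j *: sub U (c%:MP)^`M(0) + U 1 j *: sub U (c%:MP)^`M(1).
  by rewrite subC !mderivC !sub0 !scaler0 addr0.
have hXn i n : (sub U ('X_i ^+ n))^`M(j) =
    U 0 j *: sub U ('X_i ^+ n)^`M(0) + U 1 j *: sub U ('X_i ^+ n)^`M(1).
  elim: n => [|n IH]; first by rewrite expr0 -mpolyC1; apply: hC.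
  by rewrite exprS; apply: mderiv_subM; [exact: hX|exact: IH].
elim/mpolyind: p => [|c m p _ _ IH]; first by rewrite -mpolyC0; apply: hC.
apply: mderiv_subD; last exact: IH.
rewrite -mul_mpolyC; apply: mderiv_subM; first exact: hC.
rewrite mpolyXE_id !big_ord_recl big_ord0 mulr1.
by apply: mderiv_subM; [exact: (hXn 0)|exact: (hXn (lift ord0 ord0))].
Qed.

Definition jac p q := p^`M(0) * q^`M(1) - p^`M(1) * q^`M(0).

Lemma jac_sub U p q : jac (sub U p) (sub U q) = \det U *: sub U (jac p q).
Proof.
rewrite /jac !mderiv_sub sub_sub !sub_mul det2E.
rewrite -!mul_mpolyC mpolyCB !mpolyCM; ring.
Qed.

Lemma jacZ c d p q : jac (c *: p) (d *: q) = (c * d) *: jac p q.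
Proof. rewrite /jac !mderivZ -!mul_mpolyC mpolyCM; ring. Qed.

Lemma hom_mderiv z p i : hom z p -> hom (z - 1) p^`M(i).
Proof.
move=> h c w c0.
have e : sub c%:M p = c ^ z *: p.
  by apply: evP => v; rewrite ev_sub evZ mul_scalar_mx h.
have := mderiv_sub c%:M i p; rewrite e mderivZ !mxE => /(congr1 (fun q => ev q w)).
rewrite evD !evZ !ev_sub mul_scalar_mx expfzDr // exprN1 => e'.
have {}e' : c * (c ^ z / c * ev p^`M(i) w) = c * ev p^`M(i) (c *: w).
  rewrite [LHS](_ : _ = c ^ z * ev p^`M(i) w); last by move: (c ^ z) => x; field.
  by rewrite e'; elim/ord2P: i {e'}; rewrite /= !mulr1n !mulr0n mul0r ?addr0 ?add0r.
exact/esym/(mulfI c0).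
Qed.

Lemma hom_jac z z' p q : hom z p -> hom z' q -> hom (z + z' - 2) (jac p q).
Proof.
move=> hp hq; have -> : z + z' - 2 = (z - 1) + (z' - 1) by ring.
have h i j := homM (hom_mderiv i hp) (hom_mderiv j hq).
exact: (homB (h 0 1) (h 1 0)).
Qed.
End LinearForms.

(** * Forms supported on an orbit *)

Section OrbitForms.
Variable R : realType.
Local Notation C := (R[i]).
Local Notation line := {vspace 'cV[C]_2}.
Implicit Types (U V : 'M[C]_2) (w v : 'cV[C]_2) (p q : {mpoly C[2]}) (l : line).
Variable G : seq 'M[R]_3.
Hypothesis Gpoly : is_polyhedral G.

(** One factor for each rotation, not for each line of the orbit: the degree is
|G| for every w, and a line occurs as often as its stabiliser demands. *)
Definition norm_form w : {mpoly C[2]} := \prod_(g <- G) lf (spin g *m w).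

Lemma BG_det U : in_BG G U -> \det U = 1.
Proof. by case=> -[]. Qed.

(** Substitution by U permutes the factors, up to scalars that come from
comparing U^-1 spin g with the chosen lift of the product. These scalars do not
involve w, so all norm forms have the same character. *)
Lemma norm_form_char U : in_BG G U ->
  exists c : C, forall w, sub U (norm_form w) = c *: norm_form w.
Proof.
move=> hU; have hV := BG_inv Gpoly hU.
have h0 g : exists c : C, g \in G -> invmx U *m spin g = c *: spin (double_cover (invmx U) *m g).
  case: (boolP (g \in G)) => hg; last by exists 0.
  have hb := BG_mul Gpoly hV (spin_BG Gpoly hg).
  have [c _ e] := BG_spin Gpoly hb; exists c => _.
  by rewrite [LHS]e (double_coverM (proj1 hV) (spin_SU2 Gpoly hg)) (spin_cover Gpoly hg).
have [s sE] := choice h0.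
exists (\prod_(g <- G) s g) => w.
rewrite [in LHS]/norm_form sub_prod.
have hg0 : double_cover (invmx U) \in G := proj2 hV.
have -> : norm_form w =
    \prod_(g <- G) lf (spin (double_cover (invmx U) *m g) *m w).
  by rewrite /norm_form -[LHS](perm_big _ (perm_translate Gpoly hg0)) big_map.
rewrite -mul_mpolyC rmorph_prod -big_split /=; apply: eq_big_seq => g hg.
by rewrite sub_lf ?BG_det // mulmxA sE // -scalemxAl lfZ mul_mpolyC.
Qed.

Definition lline l := lf (vpick l).
Definition orbit_poly (S : seq line) : {mpoly C[2]} := \prod_(l <- S) lline l.

Lemma vpick_line w : w != 0 -> exists2 c, c != 0 & vpick <[w]>%VS = c *: w.
Proof.
move=> w0; have d : \dim <[w]>%VS = 1%N by rewrite dim_vline w0.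
have [e n0] := line_vpick d.
have /eqP/(eq_lineP w0 n0) [c c0 h] := e.
by exists c.
Qed.

Lemma lline_neq0 l : \dim l = 1%N -> lline l != 0.
Proof. by case/line_vpick=> _; apply: lf_neq0. Qed.

Lemma dt_vpick l l' : \dim l = 1%N -> \dim l' = 1%N -> l != l' ->
  dt (vpick l) (vpick l') != 0.
Proof.
move=> /line_vpick[e n] /line_vpick[e' n'].
by rewrite -eq_line_dt // -e -e'.
Qed.

Lemma rotate_vpick g l : \dim l = 1%N -> g \in G ->
  exists2 c, c != 0 & spin g *m vpick l = c *: vpick (rotate g l).
Proof.
move=> d hg; have [e n] := line_vpick d.
have n' := mulmx_neq0 (SU2_unit (spin_SU2 Gpoly hg)) n.
have [c c0 h] := vpick_line n'.
exists c^-1; first by rewrite invr_eq0.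
by rewrite [in RHS]e /rotate act_lineE h scalerA mulVf // scale1r.
Qed.

Lemma size_sum1 (I : Type) (s : seq I) : (size s)%:Z = \sum_(i <- s) 1.
Proof. by elim: s => [|i s IH]; rewrite ?big_nil // big_cons -IH -intS. Qed.

Lemma hom_orbit_poly S : hom (size S)%:Z (orbit_poly S).
Proof.
have -> : (size S)%:Z = \sum_(l <- S) 1.
  exact: size_sum1.
by apply: hom_prod => l; apply: hom_lf.
Qed.

Lemma hom_norm_form w : hom (size G)%:Z (norm_form w).
Proof.
have -> : (size G)%:Z = \sum_(g <- G) 1.
  exact: size_sum1.
by apply: hom_prod => l; apply: hom_lf.
Qed.

Lemma orbit_poly_neq0 S : is_orbit G S -> orbit_poly S != 0.
Proof.
move=> hS; rewrite prodf_seq_neq0; apply/allP => l lS /=.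
by apply: lline_neq0; exact: (orbit_dim Gpoly hS lS).
Qed.

(** Each line of the orbit is met as often as its stabiliser has elements. *)
Lemma norm_form_orbit S l : is_orbit G S -> l \in S ->
  exists2 c, c != 0 & norm_form (vpick l) = c *: orbit_poly S ^+ stab_order G l.
Proof.
move=> hS lS; have d := orbit_dim Gpoly hS lS.
have h0 g : exists c : C, g \in G -> c != 0 /\ spin g *m vpick l = c *: vpick (rotate g l).
  case: (boolP (g \in G)) => hg; last by exists 0.
  by have [c c0 e] := rotate_vpick d hg; exists c.
have [s sE] := choice h0.
exists (\prod_(g <- G) s g).
  by rewrite prodf_seq_neq0; apply/allP => g /sE[].
rewrite /norm_form /orbit_poly -prodrXl.
transitivity ((\prod_(g <- G) s g)%:MP_[2] * \prod_(g <- G) lline (rotate g l)).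
  rewrite rmorph_prod -big_split /=; apply: eq_big_seq => g /sE[_ ->].
  by rewrite lfZ mul_mpolyC.
rewrite mul_mpolyC; congr (_ *: _).
rewrite (prod_count_fibers _ (proj1 hS)); last by move=> g; apply: rotate_mem.
by apply: eq_big_seq => l' l'S; rewrite (orbit_fibre Gpoly hS lS).
Qed.

Lemma vanish_vpick p l : \dim l = 1%N -> vanishes p l -> forall t : C, ev p (t *: vpick l) = 0.
Proof.
move=> d h t; rewrite ev.unlock; apply: h.
by rewrite memvZ ?memv_pick.
Qed.

(** A form vanishing on S is divisible by the linear forms of the lines of S,
and their number is its degree. *)
Lemma ground_formE S p : is_orbit G S -> is_ground_form S p ->
  exists2 c, c != 0 & p = c *: orbit_poly S.
Proof.
move=> hS [p0 hp hv]; have hd := orbit_dim Gpoly hS.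
have [||||q e] := @prod_lf_dvd R line S (fun l => vpick l) (fun=> 1%N) p.
- by case: hS.
- by move=> l /hd/line_vpick[].
- by move=> l l' lS l'S; apply: dt_vpick; apply: hd.
- move=> l lS; rewrite expr1; apply: lf_dvd; first by case: (line_vpick (hd l lS)).
  by move=> t _; apply: vanish_vpick; [apply: hd|apply: hv].
have {}e : p = orbit_poly S * q.
  by rewrite e; congr (_ * _); apply: eq_bigr => l _; rewrite expr1.
have hq : hom 0 q.
  rewrite -(subrr (size S)%:Z); apply: homMl (orbit_poly_neq0 hS) _ (hom_orbit_poly S).
  by rewrite -e; apply: homog_hom.
have [c qc] := homog_const hq; exists c; last by rewrite e qc mulrC mul_mpolyC.
by apply: contra p0 => /eqP c0; rewrite e qc c0 mpolyC0 mulr0.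
Qed.

Variables (T : seq line) (P : {mpoly C[2]}).
Hypothesis Torbit : is_orbit G T.
Hypothesis Pform : is_orbit_form G T P.

Lemma hom_P : hom (size G)%:Z P.
Proof. by case: Pform => /homog_hom. Qed.

Lemma P_char U : in_BG G U -> exists c, sub U P = c *: P.
Proof.
move=> hU; case: Pform => _ _ /(_ _ (BG_inv Gpoly hU)) [c e]; exists c.
by rewrite sub.unlock -e invmxK.
Qed.

Lemma size_poly_gt0 : (0 < size G)%N.
Proof. by case: (G) (poly_one Gpoly). Qed.

Lemma expn2_gt1 d : (0 < d)%N -> (1 < 2 ^ d)%N.
Proof. by move=> d0; rewrite -{1}(expn0 2) ltn_exp2l. Qed.

Lemma hom_ev0 d p : (0 < d)%N -> hom d%:Z p -> ev p 0 = 0.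
Proof.
move=> d0 /(_ 2 0); rewrite pnatr_eq0 => /(_ isT); rewrite scaler0 -exprnP => e.
apply/eqP; have : (2 ^+ d - 1) * ev p 0 == 0 by rewrite mulrBl mul1r -e subrr.
rewrite mulf_eq0 subr_eq0 -natrX -[1]/(1%:R) eqr_nat => /orP[|//].
by rewrite (gtn_eqF (expn2_gt1 d0)).
Qed.

Lemma P_zero w : w != 0 -> (ev P w == 0) = (<[w]>%VS \in T).
Proof.
move=> w0; case: Pform => _ h _.
have d : \dim <[w]>%VS = 1%N by rewrite dim_vline w0.
apply/eqP/idP => [e|/(h _ d) hv].
  apply/(h _ d) => v /vlineP[t ->]; have [->|t0] := eqVneq t 0.
    by rewrite scale0r; have := hom_ev0 size_poly_gt0 hom_P; rewrite ev.unlock.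
  by have := hom_P w t0; rewrite e mulr0 ev.unlock.
by rewrite ev.unlock; apply: hv; rewrite memv_line.
Qed.

Lemma outside_lines (s : seq line) : exists2 w : 'cV[C]_2, w != 0 & <[w]>%VS \notin s.
Proof.
pose f n : 'cV[C]_2 := cvec n%:R 1.
have f0 n : f n != 0 by rewrite cvec_neq0 // oner_eq0 orbT.
case: (pselect (exists n, <[f n]>%VS \notin s)) => [[n h]|h]; first by exists (f n).
have hs : {subset [seq <[f n]>%VS | n <- iota 0 (size s).+1] <= s}.
  by move=> _ /mapP[n _ ->]; apply: contrapT => /negP n0; apply: h; exists n.
(* the lines of the vectors (n, 1) are distinct *)
have hu : uniq [seq <[f n]>%VS | n <- iota 0 (size s).+1].
  rewrite map_inj_uniq ?iota_uniq // => i j /eqP; rewrite eq_line_dt //.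
  by rewrite /dt !cvecE mulr1 mul1r subr_eq0 eqr_nat => /eqP.
by have := uniq_leq_size hu hs; rewrite size_map size_iota ltnn.
Qed.

Lemma P_neq0 : P != 0.
Proof.
have [w w0 h] := outside_lines T.
by apply: contra h => /eqP P0; rewrite -P_zero // P0 ev0.
Qed.

Lemma char_neq0 U p c : U \in unitmx -> p != 0 -> sub U p = c *: p -> c != 0.
Proof.
move=> u p0 e; apply: contra p0 => /eqP c0.
by rewrite -(sub_eq0 p u) e c0 scale0r.
Qed.

(** A rotation carrying one line of the orbit to the other transports the
divisibility, since p is semi-invariant. *)
Lemma lline_transport S l l' s p : is_orbit G S -> l \in S -> l' \in S ->
  (forall U, in_BG G U -> exists c, sub U p = c *: p) -> p != 0 ->
  (exists q, p = lline l ^+ s * q) -> exists q, p = lline l' ^+ s * q.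
Proof.
move=> hS lS l'S hp p0 [q e].
have /(orbit_rotate Gpoly hS l'S)[g hg e'] := lS.
have hU := spin_BG Gpoly hg.
have u := BG_unit hU.
have [c ce] := hp _ hU; have c0 := char_neq0 u p0 ce.
have d := orbit_dim Gpoly hS l'S.
have [b b0 be] := rotate_vpick d hg.
have h : sub (spin g) (lline l) = b^-1 *: lline l'.
  rewrite /lline e' sub_lf ?(BG_det hU) //.
  have -> : vpick (rotate g l') = b^-1 *: (spin g *m vpick l').
    by rewrite be scalerA mulVf // scale1r.
  by rewrite -scalemxAr mulKmx // lfZ.
exists ((c^-1 * b^-1 ^+ s) *: sub (spin g) q).
have -> : p = c^-1 *: sub (spin g) p by rewrite ce scalerA mulVf // scale1r.
by rewrite {1}e sub_mul sub_exp h exprZn -scalerAr -scalerAl scalerA.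
Qed.

(** By semi-invariance all lines of T occur in P with the same multiplicity, and
no others do; the degree of P forces this multiplicity to be the order of the
stabiliser, as in the norm form. *)
Lemma orbit_formE t : t \in T -> exists2 c, c != 0 & P = c *: norm_form (vpick t).
Proof.
move=> tT; have dT := orbit_dim Gpoly Torbit.
have [et nt] := line_vpick (dT t tT).
have [s [q [e [r r0 qr]]]] := lf_order P_neq0 nt.
have hs l : l \in T -> exists q, P = lline l ^+ s * q.
  move=> lT; apply: (lline_transport Torbit tT lT P_char P_neq0).
  by exists q.
have [||||q' e'] := @prod_lf_dvd R line T (fun l => vpick l) (fun=> s) P.
- by case: Torbit.
- by move=> l /dT/line_vpick[].
- by move=> l l' lS l'S; apply: dt_vpick; apply: dT.
- exact: hs.
rewrite prodrXl -/(orbit_poly T) in e'.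
have B0 := orbit_poly_neq0 Torbit.
have hq' : hom ((size G)%:Z - s%:Z * (size T)%:Z) q'.
  apply: (@homMl R _ _ _ (orbit_poly T ^+ s)).
  - by rewrite expf_neq0.
  - by rewrite -e'; apply: hom_P.
  - by apply: homX; apply: hom_orbit_poly.
have nz v : v != 0 -> ev q' v != 0.
  move=> v0; apply/negP => /eqP z.
  have lT : <[v]>%VS \in T by rewrite -P_zero // e' evM z mulr0.
  have [a a0 va] := vpick_line v0.
  have [q2 e2] : exists q2, q' = lline <[v]>%VS * q2.
    apply: lf_dvd => [|x x0]; first by rewrite va scaler_eq0 negb_or a0.
    by rewrite va scalerA hq' ?mulf_neq0 // z mulr0.
  have [q3 e3] : exists q3, P = lline t ^+ s.+1 * q3.
    apply: (lline_transport Torbit lT tT P_char P_neq0).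
    exists ((\prod_(l <- rem <[v]>%VS T) lline l ^+ s) * q2).
    rewrite e' e2 /orbit_poly -prodrXl (perm_big _ (perm_to_rem lT)) big_cons /=.
    by rewrite exprS; ring.
  have q4 : q = lline t * q3.
    apply: (mulfI (expf_neq0 s (lline_neq0 (dT t tT)))).
    by rewrite -/(lline t) in e; rewrite -e e3 exprSr mulrA.
  by move: qr; rewrite q4 evM ev_lf dtZr dtxx mulr0 mul0r eqxx.
have q'0 : q' != 0 by apply: contra P_neq0 => /eqP q'0; rewrite e' q'0 mulr0.
have [deg [c c0 q'c]] := form_nozero q'0 hq' nz.
have sE : s = stab_order G t.
  have T0 : (0 < size T)%N by case: (T) tT.
  apply/eqP; rewrite -(eqn_pmul2l T0) (orbit_stabiliser Gpoly Torbit tT) mulnC.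
  by apply/eqP; move/eqP: deg; rewrite subr_eq0 -PoszM => /eqP [].
have [c' c'0 e2] := norm_form_orbit Torbit tT.
exists (c / c'); first by rewrite mulf_neq0 ?invr_eq0.
by rewrite e2 -sE scalerA divfK // e' q'c mulrC mul_mpolyC.
Qed.
End OrbitForms.

(** * Stabilisers of lines in the binary group *)

Section RootsOfUnity.
Variable F : fieldType.

(** A finite set of nonzero scalars closed under product is a group of roots of
unity, and it is cyclic: an exponent killing all of it, reduced modulo its
cardinal, would give a polynomial X^r - 1 with too many roots. *)
Lemma scalar_group_exponent (s : seq F) (e : int) :
  uniq s -> {in s, forall x, x != 0} -> {in s &, forall x y, x * y \in s} ->
  {in s, forall x, x ^ e = 1} -> (0 < size s)%N -> ((size s)%:Z %| e)%Z.
Proof.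
move=> us s0 sM se sz.
have hN x : x \in s -> x ^+ size s = 1.
  move=> xs; have pm : perm_eq [seq x * y | y <- s] s.
    apply: uniq_perm => //.
      by rewrite map_inj_uniq // => y z; apply: mulfI; apply: s0.
    have [] := uniq_min_size (s1 := [seq x * y | y <- s]) (s2 := s).
    - by rewrite map_inj_uniq // => y z; apply: mulfI; apply: s0.
    - by move=> _ /mapP[y ys ->]; apply: sM.
    - by rewrite size_map.
    by [].
  have p0 : \prod_(y <- s) y != 0 by rewrite prodf_seq_neq0; apply/allP => y /s0.
  apply: (mulIf p0); rewrite mul1r -[RHS](perm_big _ pm) big_map /= big_split /=.
  by congr (_ * _); rewrite big_const_seq count_predT iter_mulr_1.
have [n0|n0] := eqVneq (e %% (size s)%:Z)%Z 0; first exact/dvdz_mod0P.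
pose r := `|(e %% (size s)%:Z)%Z|%N.
have rE : r%:Z = (e %% (size s)%:Z)%Z by rewrite /r gez0_abs // modz_ge0 //; lia.
have r0 : (0 < r)%N by rewrite absz_gt0.
have rs : (r < size s)%N by rewrite -ltz_nat rE; apply: ltz_pmod; lia.
have hr x : x \in s -> x ^+ r = 1.
  move=> xs; have x0 := s0 x xs.
  rewrite exprnP rE -[RHS](se x xs) [in RHS](divz_eq e (size s)%:Z) [in RHS]expfzDr //.
  by rewrite [X in _ = x ^ X * _]mulrC -exprz_exp -exprnP hN // exp1rz mul1r.
have /(max_unity_roots r0) : all r.-unity_root s.
  by apply/allP => x /hr e'; rewrite unity_rootE e'.
by move=> /(_ us); rewrite leqNgt rs.
Qed.
End RootsOfUnity.

Section Stabiliser.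
Variable R : realType.
Local Notation C := (R[i]).
Local Notation line := {vspace 'cV[C]_2}.
Implicit Types (U V : 'M[C]_2) (w v : 'cV[C]_2) (p q : {mpoly C[2]}) (l : line).
Variable G : seq 'M[R]_3.
Hypothesis Gpoly : is_polyhedral G.

(** The stabiliser of a line in the binary group acts on it by a faithful
character, so by a group of roots of unity of twice the order of the rotational
stabiliser. *)
Lemma stabiliser_exponent l (e : int) : \dim l = 1%N ->
  (forall U c, in_BG G U -> U *m vpick l = c *: vpick l -> c ^ e = 1) ->
  ((2 * stab_order G l)%N%:Z %| e)%Z.
Proof.
move=> dl he; have [el n0] := line_vpick dl; set w := vpick l in he el n0 *.
have [u uw] := dt_complement n0.
pose lam U := dt u (U *m w).
have lamE U c : U *m w = c *: w -> lam U = c.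
  by move=> h; rewrite /lam h dtZr uw mulr1.
pose st := [seq g <- G | rotate g l == l].
have hst g : g \in st -> in_BG G (spin g) /\ spin g *m w = lam (spin g) *: w.
  rewrite mem_filter => /andP[/eqP e' hg]; have hU := spin_BG Gpoly hg.
  split=> //; move: e'; rewrite /rotate el => /(fixed_lineP (BG_unit hU) n0)[c c0 h].
  by rewrite (lamE _ c).
(* the eigenvalues of both lifts, U and - U, of each rotation fixing the line *)
pose s := [seq lam (spin g) | g <- st] ++ [seq - lam (spin g) | g <- st].
have mem_s U c : in_BG G U -> U *m w = c *: w -> c \in s.
  move=> hU h; have [b b1 e'] := BG_spin Gpoly hU.
  have u' := BG_unit hU.
  have c0 : c != 0.
    by have := mulmx_neq0 u' n0; rewrite h scaler_eq0 negb_or => /andP[].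
  have gs : double_cover U \in st.
    rewrite mem_filter (proj2 hU) andbT -(act_rotate Gpoly l hU) el; apply/eqP.
    by apply/(fixed_lineP u' n0); exists c.
  have [_ h'] := hst _ gs.
  have cE : c = b * lam (spin (double_cover U)).
    by rewrite -(lamE _ _ h) [in LHS]e' /lam -scalemxAl dtZr.
  move/eqP: b1; rewrite sqrf_eq1 mem_cat => /orP[]/eqP b1; apply/orP; [left|right].
    by apply/mapP; exists (double_cover U) => //; rewrite cE b1 mul1r.
  by apply/mapP; exists (double_cover U) => //; rewrite cE b1 mulN1r.
have s_mem c : c \in s -> exists U, in_BG G U /\ U *m w = c *: w.
  rewrite mem_cat => /orP[]/mapP[g /hst[hU h] ->]; first by exists (spin g).
  by exists (- spin g); split; [apply: BG_opp|rewrite mulNmx h scaleNr].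
have inj U V c : in_BG G U -> in_BG G V -> U *m w = c *: w -> V *m w = c *: w -> U = V.
  move=> hU hV h h'; have uV := BG_unit hV.
  have h1 : invmx V *m U = 1%:M.
    have hVU := BG_mul Gpoly (BG_inv Gpoly hV) hU.
    by apply: (SU2_eigen1 (proj1 hVU) n0); rewrite -mulmxA h -h' mulKmx.
  by rewrite -[LHS](mulKVmx uV) h1 mulmx1.
have injst : {in st &, injective (fun g => lam (spin g))}.
  move=> g h gs hs e'; have [hg eg] := hst g gs; have [hh eh] := hst h hs.
  move: gs hs; rewrite !mem_filter => /andP[_ gG] /andP[_ hG].
  rewrite -e' in eh; rewrite -(spin_cover Gpoly gG) -(spin_cover Gpoly hG).
  by rewrite (inj _ _ _ hg hh eg eh).
have ss : size s = (2 * stab_order G l)%N.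
  by rewrite size_cat !size_map mul2n -addnn size_filter (stab_orderE Gpoly).
rewrite -ss; apply: scalar_group_exponent.
- rewrite cat_uniq !map_inj_in_uniq //; last first.
    by move=> g h gs hs /oppr_inj; apply: injst.
  rewrite filter_uniq ?(poly_uniq Gpoly) //= andbT; apply/hasPn.
  move=> _ /mapP[g gs ->]; apply/negP => /mapP[h hs e'].
  have [hg eg] := hst g gs; have [hh eh] := hst h hs.
  have eN : - spin g *m w = lam (spin h) *: w by rewrite mulNmx eg -scaleNr e'.
  have := inj _ _ _ (BG_opp hg) hh eN eh.
  move: gs hs; rewrite !mem_filter => /andP[_ gG] /andP[_ hG] e2.
  have := congr1 (@double_cover R) e2.
  rewrite (double_coverN (proj1 hg)) (spin_cover Gpoly gG) (spin_cover Gpoly hG) => e3.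
  have := e'; rewrite e3 => /eqP; rewrite eqNr.
  move/eqP => l0; have := mulmx_neq0 (BG_unit hh) n0.
  by rewrite eh l0 scale0r eqxx.
- move=> c /s_mem[U [hU h]]; have := mulmx_neq0 (BG_unit hU) n0.
  by rewrite h scaler_eq0 negb_or => /andP[].
- move=> c d /s_mem[U [hU h]] /s_mem[V [hV h']]; apply: (mem_s (U *m V)).
    exact: BG_mul.
  by rewrite -mulmxA h' -scalemxAr h scalerA mulrC.
- by move=> c /s_mem[U [hU h]]; apply: (he U).
- rewrite ss muln_gt0 /= (stab_orderE Gpoly) -has_count; apply/hasP.
  by exists 1%:M; [apply: (poly_one Gpoly)|rewrite (rotate1 Gpoly)].
Qed.
End Stabiliser.

(** * Orders of vanishing on exceptional orbits *)

Section Exceptional.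
Variable R : realType.
Local Notation C := (R[i]).
Local Notation line := {vspace 'cV[C]_2}.
Implicit Types (U V : 'M[C]_2) (w v : 'cV[C]_2) (p q : {mpoly C[2]}) (l : line).
Variable G : seq 'M[R]_3.
Hypothesis Gpoly : is_polyhedral G.
Variables (T : seq line) (P : {mpoly C[2]}).
Hypothesis Torbit : is_orbit G T.
Hypothesis Pform : is_orbit_form G T P.
Variables (Omega : finType) (S : Omega -> seq line) (nu : Omega -> nat).
Hypothesis Sexc : is_exceptional_orbits G S nu.
Variable Pi : Omega -> {mpoly C[2]}.
Hypothesis Piform : forall i, is_ground_form (S i) (Pi i).

Lemma Pi_neq0 i : Pi i != 0.
Proof. by case: (Piform i). Qed.

Lemma hom_Pi i : hom (size (S i))%:Z (Pi i).
Proof. by case: (Piform i) => _ /homog_hom. Qed.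

Lemma nu_gt0 i : (0 < nu i)%N.
Proof. by apply: ltn_trans (exc_nontrivial Sexc i). Qed.

Lemma Pi_norm_form i l : l \in S i ->
  exists2 c, c != 0 & Pi i ^+ nu i = c *: norm_form G (vpick l).
Proof.
move=> lS; have hS := exc_orbit Sexc i.
have [c c0 e] := ground_formE Gpoly hS (Piform i).
have [d d0 e'] := norm_form_orbit Gpoly hS lS.
exists (c ^+ nu i / d); first by rewrite mulf_neq0 ?expf_neq0 ?invr_eq0.
by rewrite e' (exc_stab Sexc lS) scalerA divfK // e exprZn.
Qed.

(** P and the powers Pi i ^+ nu i are norm forms up to scalars, and the
character of a norm form does not depend on the chosen line. *)
Lemma common_char U : in_BG G U -> exists c, [/\ c != 0,
  forall w, sub U (norm_form G w) = c *: norm_form G w, sub U P = c *: P &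
  forall i, sub U (Pi i ^+ nu i) = c *: Pi i ^+ nu i].
Proof.
move=> hU; have [c cE] := norm_form_char Gpoly hU.
have [t tT] := orbit_nonempty Gpoly Torbit.
have [a a0 Pa] := orbit_formE Gpoly Torbit Pform tT.
have eP : sub U P = c *: P by rewrite Pa subZ cE !scalerA mulrC.
exists c; split=> //; first exact: char_neq0 (BG_unit hU) (P_neq0 Gpoly Pform) eP.
move=> i; have [l lS] := orbit_nonempty Gpoly (exc_orbit Sexc i).
have [b b0 ->] := Pi_norm_form lS.
rewrite subZ cE [LHS]scalerA [RHS]scalerA [b * c]mulrC; exact: erefl.
Qed.

(** Stated with the m-th power of the character of P, so that it holds for p
exactly when p / P^m is invariant. *)
Definition semi_inv (m : nat) p :=
  forall U c, in_BG G U -> sub U P = c *: P -> sub U p = c ^+ m *: p.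

Lemma semi_inv_char m p U : semi_inv m p -> in_BG G U -> exists c, sub U p = c *: p.
Proof.
by move=> hp hU; have [c [_ _ e _]] := common_char hU; exists (c ^+ m); apply: hp.
Qed.

Lemma semi_inv_norm_form w : semi_inv 1 (norm_form G w).
Proof.
move=> U c hU e; have [d [_ h e' _]] := common_char hU.
have -> : c = d by apply: (scale_inj (P_neq0 Gpoly Pform)); rewrite -e.
exact: h.
Qed.

Definition nexp (k : int) i : nat := `|nres nu k i|%N.

Lemma nresE k i : nres nu k i = (nexp k i)%:Z.
Proof.
rewrite /nexp gez0_abs // modz_ge0 //; have := nu_gt0 i; lia.
Qed.

(** Insert in the semi-invariance of p = lline l ^+ s * q an eigenvector of an
element of the stabiliser, with eigenvalue c. The character of P is c^|G|
because P does not vanish there, and what remains is c^(k - 2 s) = 1. As c runs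
through the roots of unity of order 2 nu, s equals k/2 modulo nu, so s is at
least the residue of k/2. *)
Lemma local_order k (m : nat) p i l s q : (2 %| k)%Z ->
  hom (k + (m * size G)%N%:Z) p -> semi_inv m p ->
  l \in S i -> l \notin T -> p = lline l ^+ s * q -> ev q (vpick l) != 0 ->
  (nexp k i <= s)%N.
Proof.
move=> k2 hp sp lS lT e qw.
have dl := orbit_dim Gpoly (exc_orbit Sexc i) lS.
have [el n0] := line_vpick dl.
have lN := lline_neq0 dl.
have hq : hom (k + (m * size G)%N%:Z - s%:Z * 1) q.
  apply: (@homMl R _ _ _ (lline l ^+ s)); first by rewrite expf_neq0.
    by rewrite -e.
  by apply: homX; apply: hom_lf.
have Pw : ev P (vpick l) != 0.
  by rewrite (P_zero Gpoly Pform) // -el.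
have /(stabiliser_exponent Gpoly dl) : forall U c, in_BG G U ->
    U *m vpick l = c *: vpick l -> c ^ (k - 2 * s%:Z) = 1.
  move=> U c hU h; have u := BG_unit hU.
  have c0 : c != 0.
    by have := mulmx_neq0 u n0; rewrite h scaler_eq0 negb_or => /andP[].
  have [x [x0 _ xP _]] := common_char hU.
  have xE : x = c ^+ size G.
    have := congr1 (fun f => ev f (vpick l)) xP.
    by rewrite ev_sub evZ h (hom_P Pform) // => /(mulIf Pw).
  have hl : sub U (lline l) = c^-1 *: lline l.
    rewrite /lline sub_lf ?(BG_det hU) //.
    have -> : invmx U *m vpick l = c^-1 *: vpick l.
      by rewrite -[LHS]scale1r -(mulVf c0) -scalerA scalemxAr -h mulKmx.
    by rewrite lfZ.
  have := sp U x hU xP; rewrite {1}e sub_mul sub_exp hl exprZn -scalerAl.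
  rewrite {1}e !scalerAr => /(mulfI (expf_neq0 s lN)).
  move/(congr1 (fun f => ev f (vpick l))); rewrite !evZ ev_sub h hq //.
  rewrite mulrA => /(mulIf qw); rewrite xE -exprM exprnP (exprnP _ (_ * _)%N) exprz_inv.
  rewrite -expfzDr // => e1.
  have -> : k - 2 * s%:Z = - s%:Z + (k + (m * size G)%N%:Z - s%:Z * 1) - (size G * m)%N%:Z.
    by rewrite mulnC; ring.
  by rewrite expfzDr // e1 -expfzDr // subrr expr0z.
rewrite (exc_stab Sexc lS) => hd.
have hd' : ((nu i)%:Z %| (k %/ 2)%Z - s%:Z)%Z.
  move: hd; rewrite PoszM; case/dvdzP: k2 => k' ->; rewrite mulzK //.
  have -> : k' * 2 - 2 * s%:Z = 2 * (k' - s%:Z) by ring.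
  by rewrite dvdz_mul2l.
have : ((k %/ 2)%Z = s%:Z %[mod (nu i)%:Z])%Z by apply/eqP; rewrite eqz_mod_dvd.
rewrite -lez_nat -nresE /nres => ->.
by rewrite modz_nat lez_nat leq_mod.
Qed.

Lemma lline_dvd k (m : nat) p i l : (2 %| k)%Z ->
  hom (k + (m * size G)%N%:Z) p -> semi_inv m p ->
  l \in S i -> l \notin T -> exists q, p = lline l ^+ nexp k i * q.
Proof.
move=> k2 hp sp lS lT; have [->|p0] := eqVneq p 0; first by exists 0; rewrite mulr0.
have dl := orbit_dim Gpoly (exc_orbit Sexc i) lS.
have [el n0] := line_vpick dl.
have [s [q [e [t t0 qt]]]] := lf_order p0 n0.
have hq : hom (k + (m * size G)%N%:Z - s%:Z * 1) q.
  apply: (@homMl R _ _ _ (lline l ^+ s)); first by rewrite expf_neq0 ?lline_neq0.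
    by rewrite -e.
  by apply: homX; apply: hom_lf.
have qw : ev q (vpick l) != 0.
  by move: qt; rewrite hq // mulf_eq0 negb_or => /andP[].
have le := local_order k2 hp sp lS lT e qw.
exists (lline l ^+ (s - nexp k i) * q).
by rewrite mulrA -exprD subnKC.
Qed.

Lemma prod_Pi_dvd (n : Omega -> nat) p :
  (forall i l, l \in S i -> exists q, p = lline l ^+ n i * q) ->
  exists q, p = (\prod_i Pi i ^+ n i) * q.
Proof.
move=> hp; pose r : seq (Omega * line) := [seq (i, l) | i <- enum Omega, l <- S i].
have rP i l : (i, l) \in r -> l \in S i.
  by case/allpairsPdep=> j [l' [_ l'S [-> ->]]].
have rd i l : (i, l) \in r -> \dim l = 1%N.
  by move/rP; apply: (orbit_dim Gpoly (exc_orbit Sexc i)).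
have [||||q e] := @prod_lf_dvd R _ r (fun x => vpick x.2) (fun x => n x.1) p.
- apply: allpairs_uniq_dep; first exact: enum_uniq.
    by move=> i _; case: (exc_orbit Sexc i).
  by move=> [i l] [j l'] _ _ /= [-> ->].
- by move=> [i l] /rd/line_vpick[].
- move=> [i l] [j l'] xr yr ne /=; apply: dt_vpick (rd _ _ xr) (rd _ _ yr) _.
  apply: contra ne => /eqP el; rewrite -el in yr *.
  by rewrite (exc_distinct Sexc (rP _ _ xr) (rP _ _ yr)).
- by move=> [i l] /rP; apply: hp.
have hc i : exists c, c != 0 /\ Pi i = c *: orbit_poly (S i).
  by have [c c0 h] := ground_formE Gpoly (exc_orbit Sexc i) (Piform i); exists c.
have [c cE] := choice hc.
exists ((\prod_i c i ^+ n i)^-1 *: q).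
have c0 : \prod_i c i ^+ n i != 0.
  by apply/prodf_neq0 => i _; rewrite expf_neq0 //; case: (cE i).
rewrite -scalerAr scalerAl e; congr (_ * _).
have -> : \prod_i Pi i ^+ n i = (\prod_i c i ^+ n i) *: \prod_i orbit_poly (S i) ^+ n i.
  rewrite -mul_mpolyC rmorph_prod -big_split /=; apply: eq_bigr => i _.
  by have [_ ->] := cE i; rewrite exprZn mul_mpolyC.
rewrite scalerA mulVf // scale1r big_allpairs_dep big_enum /=.
by apply: eq_bigr => i _; rewrite prodrXl.
Qed.

(** If T is an exceptional orbit, P is the power of its ground form, so this
ground form is a unit in the localisation. *)
Lemma orbit_sameP i l : l \in S i -> l \in T ->
  exists2 c, c != 0 & P = c *: Pi i ^+ nu i.
Proof.
move=> lS lT; have [c c0 e] := orbit_formE Gpoly Torbit Pform lT.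
have [d d0 e'] := Pi_norm_form lS.
exists (c / d); first by rewrite mulf_neq0 ?invr_eq0.
by rewrite e' scalerA divfK.
Qed.

End Exceptional.

(** * The Jacobian of a norm form and P *)

Section Jacobian.
Variable R : realType.
Local Notation C := (R[i]).
Local Notation line := {vspace 'cV[C]_2}.
Implicit Types (U V : 'M[C]_2) (w v : 'cV[C]_2) (p q : {mpoly C[2]}) (l : line).
Variable G : seq 'M[R]_3.
Hypothesis Gpoly : is_polyhedral G.
Variables (T : seq line) (P : {mpoly C[2]}).
Hypothesis Torbit : is_orbit G T.
Hypothesis Pform : is_orbit_form G T P.
Variables (Omega : finType) (S : Omega -> seq line) (nu : Omega -> nat).
Hypothesis Sexc : is_exceptional_orbits G S nu.
Variable Pi : Omega -> {mpoly C[2]}.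
Hypothesis Piform : forall i, is_ground_form (S i) (Pi i).

(** A line outside T on which G acts freely: its norm form has simple zeros and
no zero in common with P. *)
Definition generic w :=
  [/\ w != 0, <[w]>%VS \notin T &
      forall g, g \in G -> rotate g <[w]>%VS = <[w]>%VS -> g = 1%:M].

Lemma generic_exists : exists w, generic w.
Proof.
have [w w0] := outside_lines (T ++ flatten [seq S i | i <- enum Omega]).
rewrite mem_cat negb_or => /andP[nT nS]; exists w; split=> // g hg e.
apply/eqP; apply: contraNT nS => ng.
have [||i li] := exc_all Sexc (l := <[w]>%VS).
- by rewrite dim_vline w0.
- rewrite (stab_orderE Gpoly) (permP (perm_to_rem (poly_one Gpoly))) /=.
  rewrite (rotate1 Gpoly) eqxx add1n ltnS -has_count; apply/hasP; exists g.
    by rewrite mem_rem_uniq ?(poly_uniq Gpoly) // inE ng.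
  by rewrite e.
by apply/flattenP; exists (S i) => //; apply/mapP; exists i => //; rewrite mem_enum.
Qed.

Lemma spin_neq0 g w : w != 0 -> g \in G -> spin g *m w != 0.
Proof. by move=> w0 hg; apply: mulmx_neq0 (SU2_unit (spin_SU2 Gpoly hg)) w0. Qed.

Lemma generic_dt w g h : generic w -> g \in G -> h \in G -> g != h ->
  dt (spin g *m w) (spin h *m w) != 0.
Proof.
move=> [w0 _ hw] hg hh; apply: contra => /eqP e.
have := eq_line_dt (spin_neq0 w0 hg) (spin_neq0 w0 hh); rewrite e eqxx.
rewrite -!act_lineE -!/(rotate _ _) => /eqP e'.
have hV := Defs.poly_inv Gpoly hg.
have := hw _ (poly_mul Gpoly hV hh); rewrite (rotateM Gpoly) // -e' (rotateK Gpoly) //.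
move=> /(_ erefl) e1; apply/eqP.
by rewrite -[LHS]mulmx1 -e1 mulKVmx // (poly_unit Gpoly).
Qed.

(** The rotated copies of a generic line are distinct, so their linear forms are
coprime. *)
Lemma norm_form_dvd w p : generic w ->
  (forall g t, g \in G -> t != 0 -> ev p (t *: (spin g *m w)) = 0) ->
  exists q, p = norm_form G w * q.
Proof.
move=> hw hp; have w0 : w != 0 by case: hw.
have [||||q e] := @prod_lf_dvd R _ G (fun g => spin g *m w) (fun=> 1%N) p.
- exact: poly_uniq Gpoly.
- by move=> g; apply: spin_neq0.
- by move=> g h hg hh; apply: generic_dt.
- by move=> g hg; rewrite expr1; apply: lf_dvd (spin_neq0 w0 hg) _ => t; apply: hp.
by exists q; rewrite e; congr (_ * _); apply: eq_bigr => g _; rewrite expr1.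
Qed.

Lemma norm_form_split w : generic w ->
  exists2 q, norm_form G w = lf w * q & ev q w != 0.
Proof.
move=> hw; have w0 : w != 0 by case: hw.
have h1 := poly_one Gpoly.
have [b b1 e] := BG_spin Gpoly (BG_1 Gpoly).
have b0 := sq1_neq0 b1.
rewrite double_cover1 in e.
have es : spin (1%:M : 'M[R]_3) *m w = b^-1 *: w.
  by rewrite -{2}[w]mul1mx e -scalemxAl scalerA mulVf // scale1r.
exists (b^-1 *: \prod_(g <- rem 1%:M G) lf (spin g *m w)).
  by rewrite /norm_form (perm_big _ (perm_to_rem h1)) big_cons /= es lfZ -scalerAl -scalerAr.
rewrite evZ mulf_neq0 ?invr_eq0 // ev_prod prodf_seq_neq0; apply/allP => g.
rewrite mem_rem_uniq ?(poly_uniq Gpoly) // inE => /andP[ng hg] /=.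
have := generic_dt hw hg h1 ng; rewrite es dtZr mulf_eq0 negb_or => /andP[_].
by rewrite ev_lf.
Qed.

Lemma norm_form_neq0 w : generic w -> norm_form G w != 0.
Proof.
move=> hw; have [w0 _ _] := hw; rewrite prodf_seq_neq0; apply/allP => g hg /=.
by apply: lf_neq0; apply: spin_neq0.
Qed.

Lemma norm_form_ev w : generic w -> ev (norm_form G w) w = 0.
Proof.
by move=> hw; have [q -> _] := norm_form_split hw; rewrite evM ev_lf dtxx mul0r.
Qed.

Lemma generic_P w : generic w -> ev P w != 0.
Proof. by case=> w0 nT _; rewrite (P_zero Gpoly Pform). Qed.

(** If the Jacobian vanished then, by Euler's identity, P times the gradient of
the norm form would be divisible by the norm form, which would have a double
zero at w, against genericity. *)
Lemma jac_neq0 w : generic w -> jac (norm_form G w) P != 0.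
Proof.
move=> hw; apply/negP => /eqP J0; set F := norm_form G w in J0.
have [q FE qw] := norm_form_split hw.
have [w0 _ _] := hw.
have n0 : (size G)%:R != 0 :> C by rewrite pnatr_eq0 -lt0n (size_poly_gt0 Gpoly).
have eF := euler (hom_norm_form G w); have eP := euler (hom_P Pform).
rewrite -/F in eF.
have key j : ev F^`M(j) w * ev P w = 0.
  have : (size G)%:R *: (F^`M(j) * P - F * P^`M(j)) = 0.
    rewrite scalerBr scalerAr scalerAl -eP -eF.
    have J0' : F^`M(0) * P^`M(1) = F^`M(1) * P^`M(0).
      by apply/eqP; rewrite -subr_eq0; apply/eqP.
    elim/ord2P: j.
      transitivity ('X_1 * (F^`M(0) * P^`M(1) - F^`M(1) * P^`M(0))); first by ring.
      by rewrite J0' subrr mulr0.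
    transitivity ('X_0 * (F^`M(1) * P^`M(0) - F^`M(0) * P^`M(1))); first by ring.
    by rewrite J0' subrr mulr0.
  move/(congr1 (fun f => ev f w)); rewrite ev0 evZ => /eqP.
  rewrite mulf_eq0 (negbTE n0) /= evB !evM (norm_form_ev hw) mul0r subr0.
  by move/eqP.
have dF j : ev F^`M(j) w = ev (lf w)^`M(j) w * ev q w.
  by rewrite /F FE mderivM evD !evM ev_lf dtxx mul0r addr0.
have d0 : ev (lf w)^`M(0) w = - w 1 0 /\ ev (lf w)^`M(1) w = w 0 0.
  rewrite /lf !mderivB !mderivZ !mderivX !mnm1E /= !scale0r !scaler0 sub0r subr0 !scale1r.
  have z (k : 'I_2) : (U_(k) - U_(k))%MM = 0%MM.
    by apply/mnmP => l; rewrite mnmBE subnn mnm0E.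
  by rewrite !z mpolyX0 evN !evZ !ev1 !mulr1.
case: d0 => d0 d1.
have := key 1; have := key 0; rewrite !dF d0 d1 => /eqP.
rewrite !mulf_eq0 (negbTE qw) (negbTE (generic_P hw)) !orbF oppr_eq0 => /eqP h1 /eqP.
rewrite !mulf_eq0 (negbTE qw) (negbTE (generic_P hw)) !orbF => /eqP h0.
by case/orP: (vec2_neq0 w0); rewrite ?h0 ?h1 eqxx.
Qed.

Lemma mderiv_exp q n j : (q ^+ n.+1)^`M(j) = n.+1%:R *: (q ^+ n * q^`M(j)).
Proof.
elim: n => [|n IH]; first by rewrite expr1 expr0 mul1r scale1r.
rewrite exprS mderivM IH -scalerAr mulrA -exprS.
by rewrite -[n.+2]add1n natrD scalerDl scale1r mulrC exprS.
Qed.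

Lemma nexpN2 i : nexp nu (-2) i = (nu i).-1.
Proof.
have n0 := nu_gt0 Sexc i.
rewrite /nexp /nres (_ : (-2 %/ 2)%Z = Negz 0) // modNz_nat // mod0n subr0; lia.
Qed.

Lemma jac_semi_inv w : semi_inv G P 2 (jac (norm_form G w) P).
Proof.
move=> U c hU e; have := jac_sub U (norm_form G w) P.
rewrite (BG_det hU) scale1r => <-; rewrite e.
by rewrite (semi_inv_norm_form Gpoly Torbit Pform Sexc Piform w hU e) jacZ expr1.
Qed.

(** The Jacobian is a semi-invariant of degree 2 |G| - 2, so the local analysis
with k = -2 gives it zeros of order at least nu - 1 on the exceptional orbits,
and by the count of fixed lines there is no room for another zero. On the orbit
T the local analysis does not apply, but there P itself is a nu-th power and its
derivatives are divisible by the power nu - 1. *)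
Lemma jac_Pi w : generic w ->
  exists2 c, c != 0 & jac (norm_form G w) P = c *: \prod_i Pi i ^+ (nu i).-1.
Proof.
move=> hw; have J0 := jac_neq0 hw.
have hJ0 := hom_jac (hom_norm_form G w) (hom_P Pform).
have hJ : hom (-2 + (2 * size G)%N%:Z) (jac (norm_form G w) P).
  rewrite (_ : -2 + _ = (size G)%:Z + (size G)%:Z - 2) //.
  by rewrite mul2n -addnn PoszD addrC.
have [|q e] := prod_Pi_dvd Gpoly Sexc Piform (n := fun i => (nu i).-1)
    (p := jac (norm_form G w) P).
  move=> i l lS; case: (boolP (l \in T)) => lT; last first.
    rewrite -nexpN2.
    exact: (lline_dvd Gpoly Torbit Pform Sexc Piform _ hJ (jac_semi_inv w) lS lT).
  have [c c0 ->] := orbit_sameP Gpoly Torbit Pform Sexc Piform lS lT.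
  have [d d0 Pd] := ground_formE Gpoly (exc_orbit Sexc i) (Piform i).
  have [q2 e2] : exists q2, Pi i = lline l * q2.
    exists (d *: \prod_(l' <- rem l (S i)) lline l').
    by rewrite Pd /orbit_poly (perm_big _ (perm_to_rem lS)) big_cons /= scalerAr.
  rewrite -(prednK (nu_gt0 Sexc i)) /= /jac !mderivZ !mderiv_exp.
  set n := (nu i).-1.
  exists (q2 ^+ n * (c *: (n.+1%:R *: ((norm_form G w)^`M(0) * (Pi i)^`M(1)
     - (norm_form G w)^`M(1) * (Pi i)^`M(0))))).
  have jE (a b x y z : {mpoly C[2]}) (u v : C) :
      a * (u *: (v *: (z * x))) - b * (u *: (v *: (z * y))) =
      z * (u *: (v *: (a * x - b * y))).
    by rewrite -!scalerAr -!scalerBr mulrBr [a * (_ * _)]mulrCA [b * (_ * _)]mulrCA.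
  have -> : Pi i ^+ n = lline l ^+ n * q2 ^+ n by rewrite [in LHS]e2 exprMn.
  by rewrite jE mulrA.
have q0 : q != 0 by apply: contra J0 => /eqP q0; rewrite e q0 mulr0.
have B0 : \prod_i Pi i ^+ (nu i).-1 != 0.
  by apply/prodf_neq0 => i _; rewrite expf_neq0 // (Pi_neq0 Piform).
have hB : hom (\sum_i (nu i).-1%:Z * (size (S i))%:Z) (\prod_i Pi i ^+ (nu i).-1).
  by apply: hom_prod => i; apply: homX; apply: hom_Pi.
have hq : hom 0 q.
  (* the degrees on both sides agree, by the count of fixed lines *)
  have dE : -2 + (2 * size G)%N%:Z - \sum_i (nu i).-1%:Z * (size (S i))%:Z = 0.
    have := exc_count Gpoly Sexc.
    have -> : (\sum_i size (S i) * nu i = \sum_i (nu i).-1 * size (S i) + \sum_i size (S i))%N.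
      rewrite -big_split; apply: eq_bigr => i _ /=.
      by rewrite -{1}(prednK (nu_gt0 Sexc i)) mulnS addnC mulnC.
    have -> : \sum_i (nu i).-1%:Z * (size (S i))%:Z = (\sum_i (nu i).-1 * size (S i))%N%:Z.
      by rewrite (big_morph Posz PoszD erefl); apply: eq_bigr => i _; rewrite PoszM.
    lia.
  by rewrite -dE; apply: homMl B0 _ hB; rewrite -e.
have [c qc] := homog_const hq; exists c; last by rewrite e qc mulrC mul_mpolyC.
by apply: contra q0 => /eqP c0; rewrite qc c0 mpolyC0.
Qed.
End Jacobian.

(** * Rational functions: substitution, localisation and degree *)

Lemma frac_repr (D : idomainType) (f : {fraction D}) :
  f = tofrac \n_(repr f) / tofrac \d_(repr f).
Proof.
have d0 := denom_ratioP (repr f).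
have t0 : tofrac \d_(repr f) != 0 by rewrite tofrac_eq0.
apply: (canRL (mulfK t0)).
rewrite -[X in X * _](generic_quotient.reprK f); unlock FracField.tofrac.
rewrite -[LHS]FracField.pi_mul; apply/generic_quotient.eqmodP => /=.
by rewrite FracField.equivfE /FracField.mulf !numden_Ratio ?mulf_neq0 ?oner_eq0 // !mulr1 mulrC.
Qed.

Section GenericFractions.
Variable D : idomainType.
Implicit Types p q : D.

Lemma tofrac_neq0 p : p != 0 -> tofrac p != 0.
Proof. by rewrite tofrac_eq0. Qed.

Lemma frac_eq p q p' q' : q != 0 -> q' != 0 ->
  tofrac p / tofrac q = tofrac p' / tofrac q' <-> p * q' = p' * q.
Proof.
move=> /tofrac_neq0 t0 /tofrac_neq0 t'0.
split=> [/eqP|e].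
  by rewrite (eqr_div _ _ t0 t'0) -!tofracM tofrac_eq => /eqP.
by apply/eqP; rewrite (eqr_div _ _ t0 t'0) -!tofracM e.
Qed.

Lemma frac_add p q p' q' : q != 0 -> q' != 0 ->
  tofrac p / tofrac q + tofrac p' / tofrac q' = tofrac (p * q' + p' * q) / tofrac (q * q').
Proof.
move=> /tofrac_neq0 t0 /tofrac_neq0 t'0.
by rewrite (addf_div _ _ t0 t'0) -!tofracM -tofracD.
Qed.

Lemma frac_opp p q : - (tofrac p / tofrac q) = tofrac (- p) / tofrac q.
Proof. by rewrite tofracN mulNr. Qed.

Lemma frac_mul p q p' q' :
  tofrac p / tofrac q * (tofrac p' / tofrac q') = tofrac (p * p') / tofrac (q * q').
Proof. by rewrite mulf_div -!tofracM. Qed.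
End GenericFractions.

HB.lock Definition sfr (R : realType) (U : 'M[R[i]]_2) (f : {fraction {mpoly R[i][2]}}) :
  {fraction {mpoly R[i][2]}} := subst_frac U f.

Section Fractions.
Variable R : realType.
Local Notation C := (R[i]).
Local Notation K := {fraction {mpoly C[2]}}.
Implicit Types (U V : 'M[C]_2) (w v : 'cV[C]_2) (p q : {mpoly C[2]}) (f g : K).

Lemma frac_ind (Q : K -> Prop) :
  (forall p q, q != 0 -> Q (tofrac p / tofrac q)) -> forall f, Q f.
Proof. by move=> h f; rewrite (frac_repr f); apply: h; apply: denom_ratioP. Qed.

(** The definition of the substitution refers to a chosen fraction; injectivity
of the substitution on polynomials makes the choice irrelevant. *)
Lemma sfrE U p q : U \in unitmx -> q != 0 ->
  sfr U (tofrac p / tofrac q) = tofrac (sub U p) / tofrac (sub U q).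
Proof.
move=> u q0; rewrite sfr.unlock /subst_frac.
set f := tofrac p / tofrac q.
have d0 := denom_ratioP (repr f).
have e := proj1 (frac_eq p _ q0 d0) (frac_repr f).
have es pp : subst_poly U pp = sub U pp by rewrite sub.unlock.
rewrite !es.
have s0 : sub U q != 0 by rewrite (sub_eq0 q u).
have s1 : sub U \d_(repr f) != 0 by rewrite (sub_eq0 _ u).
by apply: (proj2 (frac_eq _ _ s1 s0)); rewrite -!sub_mul e.
Qed.

Lemma sub_1 U : sub U 1 = 1.
Proof. by rewrite -mpolyC1 subC. Qed.

Lemma sfr_tofrac U p : U \in unitmx -> sfr U (tofrac p) = tofrac (sub U p).
Proof.
move=> u; rewrite -[tofrac p]divr1 -tofrac1 sfrE ?oner_eq0 //.
by rewrite sub_1 tofrac1 divr1.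
Qed.

Lemma sfr_morph U : U \in unitmx -> zmod_morphism (sfr U) /\ monoid_morphism (sfr U).
Proof.
move=> u; split; last split.
- elim/frac_ind=> p q q0; elim/frac_ind=> p' q' q'0.
  have s0 : sub U q != 0 by rewrite (sub_eq0 q u).
  have s'0 : sub U q' != 0 by rewrite (sub_eq0 q' u).
  rewrite (sfrE p u q0) (sfrE p' u q'0) !frac_opp (frac_add _ _ q0 q'0) (frac_add _ _ s0 s'0).
  rewrite (sfrE _ u (mulf_neq0 q0 q'0)).
  by rewrite sub_add !sub_mul -[- p']sub0r sub_sub sub0 sub0r.
- by rewrite -tofrac1 sfr_tofrac // sub_1.
elim/frac_ind=> p q q0; elim/frac_ind=> p' q' q'0.
rewrite (sfrE p u q0) (sfrE p' u q'0) !frac_mul (sfrE _ u (mulf_neq0 q0 q'0)).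
by rewrite !sub_mul.
Qed.

Definition sfr_rmorphism U (u : U \in unitmx) : {rmorphism K -> K} :=
  HB.pack (sfr U) (GRing.isZmodMorphism.Build K K (sfr U) (proj1 (sfr_morph u)))
    (GRing.isMonoidMorphism.Build K K (sfr U) (proj2 (sfr_morph u))).

Lemma sfr_rmorphismE U (u : U \in unitmx) f : sfr_rmorphism u f = sfr U f.
Proof. by []. Qed.

Lemma constKM : {morph @constK R : c d / c * d}.
Proof. by move=> c d; rewrite /constK mpolyCM tofracM. Qed.
Lemma constK1 : @constK R 1 = 1.
Proof. by rewrite /constK mpolyC1 tofrac1. Qed.
Lemma constK0 : @constK R 0 = 0.
Proof. by rewrite /constK mpolyC0 tofrac0. Qed.
Lemma constKB : zmod_morphism (@constK R).
Proof. by move=> c d; rewrite /constK mpolyCB tofracB. Qed.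

HB.instance Definition _ := GRing.isZmodMorphism.Build C K (@constK R) constKB.
HB.instance Definition _ := GRing.isMonoidMorphism.Build C K (@constK R) (constK1, constKM).

Lemma constK_eq0 (c : C) : (constK c == 0) = (c == 0).
Proof. by rewrite /constK tofrac_eq0 mpolyC_eq0. Qed.

Lemma tofracZ c p : tofrac (c *: p) = constK c * tofrac p.
Proof. by rewrite -mul_mpolyC tofracM. Qed.

Lemma sfr_const U c : U \in unitmx -> sfr U (constK c) = constK c.
Proof. by move=> u; rewrite /constK sfr_tofrac // subC. Qed.

Variable P : {mpoly C[2]}.
Hypothesis P0 : P != 0.

Let tP0 : tofrac P != 0. Proof. by rewrite tofrac_eq0. Qed.

Lemma in_loc_tofrac p : in_loc P (tofrac p).
Proof. by exists p, 0%N; rewrite expr0 divr1. Qed.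
Lemma in_loc_const c : in_loc P (constK c).
Proof. exact: in_loc_tofrac. Qed.
Lemma in_loc0 : in_loc P 0. Proof. by rewrite -constK0; apply: in_loc_const. Qed.
Lemma in_loc1 : in_loc P 1. Proof. by rewrite -constK1; apply: in_loc_const. Qed.
Lemma in_locD f g : in_loc P f -> in_loc P g -> in_loc P (f + g).
Proof.
case=> p [m ->] [q [n ->]]; exists (p * P ^+ n + q * P ^+ m), (m + n)%N.
by rewrite (addf_div _ _ (expf_neq0 m tP0) (expf_neq0 n tP0)) tofracD !tofracM !tofracXn exprD.
Qed.

Lemma in_locM f g : in_loc P f -> in_loc P g -> in_loc P (f * g).
Proof.
case=> p [m ->] [q [n ->]]; exists (p * q), (m + n)%N.
by rewrite mulf_div tofracM exprD.
Qed.

Lemma in_locN f : in_loc P f -> in_loc P (- f).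
Proof. by case=> p [m ->]; exists (- p), m; rewrite tofracN mulNr. Qed.
Lemma in_loc_exp f n : in_loc P f -> in_loc P (f ^+ n).
Proof.
by move=> h; elim: n => [|n IH]; [exact: in_loc1|rewrite exprS; apply: in_locM].
Qed.

Lemma in_loc_sum (I : Type) (r : seq I) (Q : pred I) (F : I -> K) :
  (forall i, Q i -> in_loc P (F i)) -> in_loc P (\sum_(i <- r | Q i) F i).
Proof.
by move=> h; elim/big_ind: _ => //; [exact: in_loc0|exact: in_locD].
Qed.

Lemma in_loc_prod (I : Type) (r : seq I) (Q : pred I) (F : I -> K) :
  (forall i, Q i -> in_loc P (F i)) -> in_loc P (\prod_(i <- r | Q i) F i).
Proof.
by move=> h; elim/big_ind: _ => //; [exact: in_loc1|exact: in_locM].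
Qed.

Lemma in_loc_divP f n : in_loc P f -> in_loc P (f / tofrac P ^+ n).
Proof.
by case=> p [m ->]; exists p, (m + n)%N; rewrite -mulrA -invfM exprD.
Qed.

Lemma in_loc_Pz (z : int) : in_loc P (tofrac P ^ z).
Proof.
case: z => n; first by rewrite -exprnP; apply: in_loc_exp; apply: in_loc_tofrac.
by rewrite NegzE -invr_expz -exprnP -div1r; apply: in_loc_divP; apply: in_loc1.
Qed.

(** Homogeneity as weight under the scalar substitutions, which is visibly
compatible with products, inverses and the invariance under the binary group. *)
Definition deg (z : int) f := forall c : C, c != 0 -> sfr c%:M f = constK (c ^ z) * f.

Lemma scalar_unit (c : C) : c != 0 -> c%:M \in @unitmx C 2.
Proof. by move=> c0; rewrite unitmxE det_scalar unitrX // unitfE. Qed.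

Lemma deg_tofrac z p : deg z (tofrac p) <-> hom z p.
Proof.
split=> h c => [w c0|c0].
  have := h c c0; rewrite sfr_tofrac ?scalar_unit // -tofracZ => /eqP.
  rewrite tofrac_eq => /eqP /(congr1 (fun q => ev q w)).
  by rewrite ev_sub evZ mul_scalar_mx.
rewrite sfr_tofrac ?scalar_unit // -tofracZ; congr tofrac.
by apply: evP => w; rewrite ev_sub evZ mul_scalar_mx h.
Qed.

Lemma degM z z' f g : deg z f -> deg z' g -> deg (z + z') (f * g).
Proof.
move=> hf hg c c0; have := sfr_morph (scalar_unit c0) => -[_ [_ e]].
by rewrite e hf // hg // expfzDr // constKM; ring.
Qed.

Lemma degV z f : deg z f -> deg (- z) f^-1.
Proof.
move=> hf c c0; rewrite -(sfr_rmorphismE (scalar_unit c0)) fmorphV sfr_rmorphismE hf //.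
by rewrite invfM -invr_expz fmorphV.
Qed.

Lemma deg_const c : deg 0 (constK c).
Proof. by move=> d d0; rewrite sfr_const ?scalar_unit // expr0z constK1 mul1r. Qed.

Lemma degX z f n : deg z f -> deg (n%:Z * z) (f ^+ n).
Proof.
move=> h c c0; rewrite -(sfr_rmorphismE (scalar_unit c0)) rmorphXn sfr_rmorphismE h //.
by rewrite exprMn -rmorphXn /= (exprnP (c ^ z)) exprz_exp mulrC [z * _]mulrC mulrC.
Qed.

Lemma deg_Xz z f (n : int) : deg z f -> deg (n * z) (f ^ n).
Proof.
case: n => n h; first by apply: degX.
by rewrite NegzE mulNr -invr_expz; apply: degV; apply: degX.
Qed.

Lemma degD z f g : deg z f -> deg z g -> deg z (f + g).
Proof.
move=> hf hg c c0; rewrite -(sfr_rmorphismE (scalar_unit c0)) rmorphD !sfr_rmorphismE.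
by rewrite hf // hg // mulrDr.
Qed.

Lemma deg_prod (I : Type) (r : seq I) (z : I -> int) (F : I -> K) :
  (forall i, deg (z i) (F i)) -> deg (\sum_(i <- r) z i) (\prod_(i <- r) F i).
Proof.
move=> h; elim: r => [|i r IH]; last by rewrite !big_cons; apply: degM.
by rewrite !big_nil -constK1; apply: deg_const.
Qed.

Lemma homog0_deg f : homog0 f -> deg 0 f.
Proof.
case=> d [p [q [hp hq q0 ->]]]; rewrite -(subrr d%:Z); apply: degM.
  by apply/deg_tofrac; apply: homog_hom.
by apply: degV; apply/deg_tofrac; apply: homog_hom.
Qed.

Lemma in_loc_repr d z f : hom d%:Z P -> in_loc P f -> deg z f ->
  exists p m, f = tofrac p / tofrac P ^+ m /\ hom (z + (m * d)%N%:Z) p.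
Proof.
move=> hP [p [m e]] hf; exists p, m; split=> //; apply/deg_tofrac.
have -> : tofrac p = f * tofrac P ^+ m by rewrite e (divfK (expf_neq0 m tP0)).
by apply: degM => //; rewrite PoszM; apply: degX; apply/deg_tofrac.
Qed.

Lemma deg_homog0 d f : hom d%:Z P -> in_loc P f -> deg 0 f -> homog0 f.
Proof.
move=> hP lf /(in_loc_repr hP lf) [p [m [-> hp]]].
exists (m * d)%N, p, (P ^+ m); split; last by rewrite tofracXn.
- by apply: hom_homog; rewrite -[X in hom X]add0r.
- by apply: hom_homog; rewrite PoszM; apply: homX.
- by rewrite expf_neq0.
Qed.

Definition binv (G : seq 'M[R]_3) f := forall U, in_BG G U -> sfr U f = f.

End Fractions.

(** * The ring of invariants of degree zero *)

Section InvariantRing.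
Variable R : realType.
Local Notation C := (R[i]).
Local Notation K := {fraction {mpoly C[2]}}.
Local Notation line := {vspace 'cV[C]_2}.
Implicit Types (U V : 'M[C]_2) (w v : 'cV[C]_2) (p q : {mpoly C[2]}) (f g : K).
Variable G : seq 'M[R]_3.
Hypothesis Gpoly : is_polyhedral G.
Variables (T : seq line) (P : {mpoly C[2]}).
Hypothesis Torbit : is_orbit G T.
Hypothesis Pform : is_orbit_form G T P.
Variables (Omega : finType) (S : Omega -> seq line) (nu : Omega -> nat).
Hypothesis Sexc : is_exceptional_orbits G S nu.
Variable Pi : Omega -> {mpoly C[2]}.
Hypothesis Piform : forall i, is_ground_form (S i) (Pi i).

Local Notation P0 := (P_neq0 Gpoly Pform).
Local Notation tP0 := (tofrac_neq0 P0).
Local Notation tPm0 m := (expf_neq0 m tP0).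
Local Notation hP := (hom_P Pform).

Lemma binvM f g : binv G f -> binv G g -> binv G (f * g).
Proof.
move=> hf hg U hU; have := sfr_morph (BG_unit hU) => -[_ [_ e]].
by rewrite e hf // hg.
Qed.

Lemma binvD f g : binv G f -> binv G g -> binv G (f + g).
Proof.
move=> hf hg U hU; rewrite -(sfr_rmorphismE (BG_unit hU)) rmorphD !sfr_rmorphismE.
by rewrite hf // hg.
Qed.

Lemma binv_const c : binv G (constK c).
Proof. by move=> U hU; apply: sfr_const (BG_unit hU). Qed.

Lemma binvV f : binv G f -> binv G f^-1.
Proof.
move=> hf U hU; rewrite -(sfr_rmorphismE (BG_unit hU)) fmorphV sfr_rmorphismE.
by rewrite hf.
Qed.

Lemma in_inv_ringP f : in_inv_ring G P f <-> [/\ in_loc P f, deg 0 f & binv G f].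
Proof.
split=> -[lf hf bf]; split=> //.
- exact: homog0_deg.
- move=> U hU; have := bf _ (BG_inv Gpoly hU); rewrite invmxK.
  by rewrite sfr.unlock.
- exact: (deg_homog0 P0 hP).
- by move=> U hU; have := bf _ (BG_inv Gpoly hU); rewrite sfr.unlock.
Qed.

(** Passing to numerators: clearing the denominator P^m costs m copies of the
character of P. *)
Lemma binv_semi m p f : f = tofrac p / tofrac P ^+ m -> binv G f -> semi_inv G P m p.
Proof.
move=> e bf U c hU hc; have u := BG_unit hU.
have e1 : tofrac p = f * tofrac P ^+ m by rewrite e (divfK (tPm0 m)).
apply/eqP; rewrite -tofrac_eq tofracZ; apply/eqP.
rewrite -(sfr_tofrac p u) [in LHS]e1 -(sfr_rmorphismE u) rmorphM rmorphXn !sfr_rmorphismE.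
rewrite (bf U hU) (sfr_tofrac P u) hc tofracZ exprMn e1 rmorphXn /=.
by rewrite mulrCA.
Qed.

Lemma semi_binv m p : semi_inv G P m p -> binv G (tofrac p / tofrac P ^+ m).
Proof.
move=> hp U hU; have u := BG_unit hU.
have [c [c0 _ hc _]] := common_char Gpoly Torbit Pform Sexc Piform hU.
rewrite -(sfr_rmorphismE u) rmorphM fmorphV rmorphXn !sfr_rmorphismE.
rewrite (sfr_tofrac _ u) (sfr_tofrac _ u) hc (hp U c hU hc) !tofracZ exprMn rmorphXn /=.
have k0 : constK c ^+ m != 0 by apply: expf_neq0; rewrite constK_eq0.
by rewrite invfM mulrACA (divff k0) mul1r.
Qed.

Lemma evalC_C (I : K) c : evalC I c%:P = constK c.
Proof. by rewrite /evalC map_polyC hornerC. Qed.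

Lemma evalCMXaddC (I : K) (q : {poly C}) c : evalC I (q * 'X + c%:P) = evalC I q * I + constK c.
Proof. by rewrite /evalC rmorphD rmorphM /= map_polyX map_polyC hornerMXaddC. Qed.

Section Generator.
Variable w : 'cV[C]_2.
Hypothesis hw : generic G T w.
Let F := norm_form G w.
Let I0 : K := tofrac F / tofrac P.

Let F_semi : semi_inv G P 1 F.
Proof. exact: (semi_inv_norm_form Gpoly Torbit Pform Sexc Piform w). Qed.

Lemma I0_inv : in_inv_ring G P I0.
Proof.
apply/in_inv_ringP; split.
- by exists F, 1%N.
- rewrite -(subrr (size G)%:Z); apply: degM; first by apply/deg_tofrac/hom_norm_form.
  by apply: degV; apply/deg_tofrac; exact: hP.
- by have := semi_binv F_semi; rewrite expr1.
Qed.

(** Subtracting from p the multiple of P^m with the same value at the generic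
point leaves a form vanishing on its whole orbit, so divisible by the norm form,
with a quotient of smaller degree. *)
Lemma semi_inv_polynomial m p : hom (m * size G)%N%:Z p -> semi_inv G P m p ->
  exists q : {poly C}, tofrac p / tofrac P ^+ m = evalC I0 q.
Proof.
elim: m p => [|m IH] p hp sp.
  have [c ->] := homog_const hp; exists c%:P.
  by rewrite evalC_C expr0 divr1.
have Pw := generic_P Gpoly Pform hw.
pose c := ev p w / ev P w ^+ m.+1; pose p' := p - c *: P ^+ m.+1.
have hPm : hom (m.+1 * size G)%N%:Z (P ^+ m.+1) by rewrite PoszM; apply: homX; exact: hP.
have hp' : hom (m.+1 * size G)%N%:Z p'.
  move=> a v a0; rewrite /p' !evB !evZ hp // hPm //; ring.
have sp' : semi_inv G P m.+1 p'.
  move=> U a hU ha; rewrite /p' sub_sub subZ sub_exp ha (sp U a hU ha) exprZn.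
  by rewrite scalerBr !scalerA mulrC.
have p'w : ev p' w = 0.
  by rewrite /p' evB evZ evXn /c (divfK (expf_neq0 _ Pw)) subrr.
have [q pE] : exists q, p' = F * q.
  apply: (norm_form_dvd Gpoly hw) => g t hg t0; rewrite hp' // -ev_sub.
  have [a ha] := semi_inv_char Gpoly Torbit Pform Sexc Piform sp' (spin_BG Gpoly hg).
  by rewrite ha evZ p'w mulr0 mulr0.
have F0 : F != 0 := norm_form_neq0 Gpoly hw.
have hq : hom (m * size G)%N%:Z q.
  have -> : (m * size G)%N%:Z = (m.+1 * size G)%N%:Z - (size G)%:Z.
    by rewrite mulSn PoszD addrC addKr.
  by apply: homMl F0 _ (hom_norm_form G w); rewrite -pE.
have sq : semi_inv G P m q.
  move=> U a hU ha; have := sp' U a hU ha.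
  have a0 := char_neq0 (BG_unit hU) P0 ha.
  rewrite pE sub_mul (F_semi hU ha) expr1 exprS -scalerA -scalerAl.
  by move/(scalerI a0); rewrite scalerAr => /(mulfI F0).
have [q' e'] := IH q hq sq; exists (q' * 'X + c%:P).
rewrite evalCMXaddC -e' /I0.
have -> : p = F * q + c *: P ^+ m.+1 by rewrite -pE /p' subrK.
rewrite tofracD tofracM tofracZ tofracXn mulrDl (mulfK (tPm0 m.+1)).
congr (_ + _); rewrite exprSr mulf_div; congr (_ / _).
by rewrite mulrC.
Qed.

Lemma in_inv_ring_const c : in_inv_ring G P (constK c).
Proof.
apply/in_inv_ringP; split; [exact: in_loc_const|exact: deg_const|exact: binv_const].
Qed.

Lemma in_inv_ringM f g : in_inv_ring G P f -> in_inv_ring G P g -> in_inv_ring G P (f * g).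
Proof.
move=> /in_inv_ringP[l1 d1 b1] /in_inv_ringP[l2 d2 b2].
apply/in_inv_ringP; split; [exact: in_locM|exact: (degM d1 d2)|exact: binvM].
Qed.

Lemma in_inv_ringD f g : in_inv_ring G P f -> in_inv_ring G P g -> in_inv_ring G P (f + g).
Proof.
move=> /in_inv_ringP[l1 d1 b1] /in_inv_ringP[l2 d2 b2].
apply/in_inv_ringP; split; [exact: (in_locD P0)|exact: (degD d1 d2)|exact: binvD].
Qed.

Lemma I0_nonconst c : I0 <> constK c.
Proof.
move=> e; have : F = c *: P.
  by apply/eqP; rewrite -tofrac_eq tofracZ -e /I0 (divfK tP0).
move=> FE; have := norm_form_ev Gpoly hw; rewrite -/F FE evZ => /eqP.
rewrite mulf_eq0 (negbTE (generic_P Gpoly Pform hw)) orbF => /eqP c0.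
by have := norm_form_neq0 Gpoly hw; rewrite -/F FE c0 scale0r eqxx.
Qed.

(** Algebraic independence is cheap: over an algebraically closed field a
polynomial relation splits into linear ones, and the generator is not
constant. *)
Lemma I0_generator : is_inv_generator G P I0.
Proof.
split=> [f|q].
  split=> [/in_inv_ringP[lf df bf]|[q ->]].
    have [p [m [e hp]]] := in_loc_repr P0 hP lf df.
    rewrite add0r in hp; have [q qe] := semi_inv_polynomial hp (binv_semi e bf).
    by exists q; rewrite e.
  elim/poly_ind: q => [|q c IH]; first by rewrite -polyC0 evalC_C; apply: in_inv_ring_const.
  rewrite evalCMXaddC; apply: in_inv_ringD; last exact: in_inv_ring_const.
  by apply: in_inv_ringM => //; apply: I0_inv.
have [r e] := closed_field_poly_normal q.
move=> z; apply/eqP; rewrite -lead_coef_eq0; apply: contrapT => /negP l0.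
move: z; rewrite e /evalC map_polyZ /= hornerZ rmorph_prod horner_prod => /eqP.
rewrite mulf_eq0 constK_eq0 (negbTE l0) /= prodf_seq_eq0 => /hasP[x _ /=].
rewrite rmorphB /= map_polyX map_polyC hornerXsubC subr_eq0 => /eqP.
exact: I0_nonconst.
Qed.
End Generator.

Lemma inv_generator_exists : exists I, is_inv_generator G P I.
Proof.
have [w hw] := generic_exists Gpoly T Sexc.
by exists (tofrac (norm_form G w) / tofrac P); apply: I0_generator.
Qed.
End InvariantRing.

(** * Invariants of degree k *)

Section EigenForms.
Variable R : realType.
Local Notation C := (R[i]).
Local Notation K := {fraction {mpoly C[2]}}.
Local Notation line := {vspace 'cV[C]_2}.
Implicit Types (U V : 'M[C]_2) (w v : 'cV[C]_2) (p q : {mpoly C[2]}) (f g : K).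
Variable G : seq 'M[R]_3.
Hypothesis Gpoly : is_polyhedral G.
Variables (T : seq line) (P : {mpoly C[2]}).
Hypothesis Torbit : is_orbit G T.
Hypothesis Pform : is_orbit_form G T P.
Variables (Omega : finType) (S : Omega -> seq line) (nu : Omega -> nat).
Hypothesis Sexc : is_exceptional_orbits G S nu.
Variable Pi : Omega -> {mpoly C[2]}.
Hypothesis Piform : forall i, is_ground_form (S i) (Pi i).

Local Notation P0 := (P_neq0 Gpoly Pform).
Local Notation tP0 := (tofrac_neq0 P0).
Local Notation tPm0 m := (expf_neq0 m tP0).
Local Notation hP := (hom_P Pform).
Local Notation Pk := (Pk G P S nu Pi).

(** The quotient belonging to the residue nres. Quotients, unlike residues, turn
the coboundary of omega2 and the exponent ell into integral expressions. *)
Definition qnu (k : int) i : int := ((k %/ 2)%Z %/ (nu i)%:Z)%Z.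

Lemma nresD k i : nres nu k i = (k %/ 2)%Z - qnu k i * (nu i)%:Z.
Proof. by rewrite /nres /qnu {2}(divz_eq (k %/ 2)%Z (nu i)%:Z) addrC addKr. Qed.

Lemma size_G_mul i : (size (S i))%:Z * (nu i)%:Z = (size G)%:Z.
Proof. by rewrite -PoszM (exc_size Gpoly Sexc). Qed.

(** The count of fixed lines, solved for the degrees of the ground forms by
means of orbit_stabiliser. *)
Lemma sum_size : \sum_i (size (S i))%:Z = (#|Omega|%:Z - 2) * (size G)%:Z + 2.
Proof.
have := exc_count Gpoly Sexc.
have -> : (\sum_i size (S i) * nu i = #|Omega| * size G)%N.
  by rewrite -sum_nat_const; apply: eq_bigr => i _; rewrite (exc_size Gpoly Sexc).
move/(congr1 Posz); rewrite !PoszD !PoszM (big_morph Posz PoszD erefl) => e.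
apply: (addIr (2 * (size G)%:Z)); rewrite -e; ring.
Qed.

(** Exactness of the division defining ell: by the count of fixed lines the
numerator is visibly a multiple of |G|. *)
Lemma ellE k : (2 %| k)%Z ->
  ell G S nu k = (2 - #|Omega|%:Z) * (k %/ 2)%Z + \sum_i qnu k i.
Proof.
move=> k2; rewrite /ell.
have kE : k = (k %/ 2)%Z * 2 by rewrite divzK.
have -> : k - \sum_i nres nu k i * (size (S i))%:Z =
    ((2 - #|Omega|%:Z) * (k %/ 2)%Z + \sum_i qnu k i) * (size G)%:Z.
  rewrite [in LHS]kE; set h := (k %/ 2)%Z.
  have -> : \sum_i nres nu (h * 2) i * (size (S i))%:Z =
      h * \sum_i (size (S i))%:Z - (\sum_i qnu k i) * (size G)%:Z.
    rewrite mulr_sumr mulr_suml -sumrB; apply: eq_bigr => i _.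
    by rewrite -kE nresD -/h mulrBl -(size_G_mul i); ring.
  by rewrite sum_size; ring.
by rewrite mulzK // eqz_nat -lt0n (size_poly_gt0 Gpoly).
Qed.

Lemma PkE k : (2 %| k)%Z ->
  Pk k = tofrac P ^ ell G S nu k * \prod_i tofrac (Pi i) ^+ nexp nu k i.
Proof.
move=> k2; rewrite /Defs.Pk k2; congr (_ * _); apply: eq_bigr => i _.
by rewrite (nresE Sexc).
Qed.

Lemma Pk_neq0 k : (2 %| k)%Z -> Pk k != 0.
Proof.
move=> k2; rewrite (PkE k2); apply: mulf_neq0; first exact: expfz_neq0 tP0.
apply/prodf_neq0 => i _; apply: expf_neq0; apply: tofrac_neq0; exact: Pi_neq0 Piform i.
Qed.

Lemma Pk_odd k : ~~ (2 %| k)%Z -> Pk k = 0.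
Proof. by move=> /negbTE k2; rewrite /Defs.Pk k2. Qed.

Lemma Pk_in_loc k : (2 %| k)%Z -> in_loc P (Pk k).
Proof.
move=> k2; rewrite (PkE k2); apply: in_locM; first exact: in_loc_Pz.
by apply: in_loc_prod => i _; apply: in_loc_exp; apply: in_loc_tofrac.
Qed.

Lemma Pk_deg k : (2 %| k)%Z -> deg k (Pk k).
Proof.
move=> k2; rewrite (PkE k2).
have kE : k = ell G S nu k * (size G)%:Z + \sum_i (nexp nu k i)%:Z * (size (S i))%:Z.
  have -> : \sum_i (nexp nu k i)%:Z * (size (S i))%:Z =
    \sum_i nres nu k i * (size (S i))%:Z.
    by apply: eq_bigr => i _; rewrite (nresE Sexc).
  have -> : \sum_i nres nu k i * (size (S i))%:Z =
      (k %/ 2)%Z * \sum_i (size (S i))%:Z - (\sum_i qnu k i) * (size G)%:Z.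
    rewrite mulr_sumr mulr_suml -sumrB; apply: eq_bigr => i _.
    by rewrite nresD mulrBl -(size_G_mul i); ring.
  rewrite (ellE k2) sum_size -{1}(divzK k2); ring.
rewrite [X in deg X _]kE; apply: degM; first by apply: deg_Xz; apply/deg_tofrac; exact: hP.
by apply: deg_prod => i; apply: degX; apply/deg_tofrac; apply: hom_Pi.
Qed.

Lemma sub_ground_form U i : in_BG G U -> is_ground_form (S i) (sub U (Pi i)).
Proof.
move=> hU; have u := BG_unit hU; have hS := exc_orbit Sexc i.
have [Pi0 _ hv] := Piform i; split; first by rewrite (sub_eq0 _ u).
  by apply: hom_homog; apply: hom_sub; apply: hom_Pi.
move=> l lS v vl; have := ev_sub U (Pi i) v; rewrite {1}ev.unlock => ->.
have lS' : act_line U l \in S i.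
  rewrite (act_rotate Gpoly l hU); apply: (rotate_mem Gpoly hS lS); exact: proj2 hU.
have := hv _ lS' (U *m v); rewrite ev.unlock; apply.
by apply/memv_imgP; exists v => //; rewrite lfunE.
Qed.

Lemma char_Pi U i : in_BG G U -> exists x, x != 0 /\ sub U (Pi i) = x *: Pi i.
Proof.
move=> hU; have hS := exc_orbit Sexc i.
have [c c0 e] := ground_formE Gpoly hS (Piform i).
have [d d0 e'] := ground_formE Gpoly hS (sub_ground_form i hU).
exists (d / c); split; first by rewrite mulf_neq0 // invr_eq0.
by rewrite e' e scalerA divfK.
Qed.

(** By jac_Pi the product of the Pi i ^+ (nu i).-1 is, up to a scalar, a
Jacobian of two forms with the character of P, so its character is the square of
that of P. *)
Lemma prod_char U c (x : Omega -> C) : in_BG G U -> sub U P = c *: P ->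
  (forall i, sub U (Pi i) = x i *: Pi i) -> \prod_i x i ^+ (nu i).-1 = c ^+ 2.
Proof.
move=> hU hc hx; have [w hw] := generic_exists Gpoly T Sexc.
have J := jac_semi_inv Gpoly Torbit Pform Sexc Piform w hU hc.
have [a a0 e] := jac_Pi Gpoly Torbit Pform Sexc Piform hw.
have B0 : \prod_i Pi i ^+ (nu i).-1 != 0.
  by apply/prodf_neq0 => i _; apply: expf_neq0; exact: Pi_neq0 Piform i.
move: J; rewrite e subZ sub_prod.
have -> : \prod_i sub U (Pi i ^+ (nu i).-1) =
    (\prod_i x i ^+ (nu i).-1) *: \prod_i Pi i ^+ (nu i).-1.
  rewrite -mul_mpolyC rmorph_prod -big_split /=; apply: eq_bigr => i _.
  by rewrite sub_exp hx exprZn mul_mpolyC.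
by rewrite !scalerA mulrC => /(scale_inj B0)/(mulIf a0).
Qed.

(** If x i is the character of Pi i and c that of P, then x i ^+ nu i = c. With
prod_char the product of all x i is therefore a power of c, namely c ^ (#|Omega|
- 2), and ell is the exponent that cancels what remains. *)
Lemma Pk_binv k : (2 %| k)%Z -> binv G (Pk k).
Proof.
move=> k2 U hU; have u := BG_unit hU.
have [c [c0 _ hc hn]] := common_char Gpoly Torbit Pform Sexc Piform hU.
have [x xE] := choice (fun i => char_Pi i hU).
have x0 i : x i != 0 by case: (xE i).
have xP i : sub U (Pi i) = x i *: Pi i by case: (xE i).
have xn i : x i ^+ nu i = c.
  by have := hn i; rewrite sub_exp xP exprZn => /(scale_inj (expf_neq0 _ (Pi_neq0 Piform i))).
have xprod : \prod_i x i = c ^ (#|Omega|%:Z - 2).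
  have c20 : c ^+ 2 != 0 by apply: expf_neq0.
  rewrite (expfzDr _ _ c0) -invr_expz -!exprnP.
  apply: (mulIf c20); rewrite (divfK c20) -(prod_char hU hc xP) -big_split /=.
  rewrite -[#|_|]/(#|(mem predT : {pred Omega})|) -prodr_const; apply: eq_bigr => i _.
  by rewrite -exprS (prednK (nu_gt0 Sexc i)).
rewrite (PkE k2) -(sfr_rmorphismE u) rmorphM fmorphXz rmorph_prod !sfr_rmorphismE.
rewrite (sfr_tofrac _ u) hc tofracZ.
have -> : \prod_i (sfr_rmorphism u) (tofrac (Pi i) ^+ nexp nu k i) =
   constK (\prod_i x i ^ nres nu k i) * \prod_i tofrac (Pi i) ^+ nexp nu k i.
  rewrite rmorph_prod -big_split /=; apply: eq_bigr => i _.
  rewrite -(sfr_rmorphismE u) rmorphXn sfr_rmorphismE (sfr_tofrac _ u) xP tofracZ.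
  by rewrite exprMn (nresE Sexc) -exprnP rmorphXn.
rewrite expfzMl mulrACA.
rewrite -[RHS]mul1r; congr (_ * _).
rewrite -fmorphXz -rmorphM /= -constK1; congr constK.
have -> : \prod_i x i ^ nres nu k i =
    (\prod_i x i) ^ (k %/ 2)%Z * c ^ (- \sum_i qnu k i).
  have -> : c ^ (- \sum_i qnu k i) = \prod_i c ^ (- qnu k i).
    rewrite -sumrN; apply: (big_morph (fun z : int => c ^ z)); last exact: expr0z.
    by move=> a b; rewrite expfzDr.
  have -> : (\prod_i x i) ^ (k %/ 2)%Z = \prod_i x i ^ (k %/ 2)%Z.
    apply: (big_morph (fun z : C => z ^ (k %/ 2)%Z)); last exact: exp1rz.
    by move=> a b; rewrite expfzMl.
  rewrite -big_split /=; apply: eq_bigr => i _.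
  rewrite nresD (expfzDr _ _ (x0 i)); congr (_ * _).
  by rewrite -mulNr mulrC -exprz_exp -exprnP xn.
rewrite xprod exprz_exp -!expfzDr // (ellE k2).
by rewrite -[RHS](expr0z c); congr (_ ^ _); ring.
Qed.
End EigenForms.

Section EigenCoefficients.
Variable R : realType.
Local Notation C := (R[i]).
Local Notation K := {fraction {mpoly C[2]}}.
Local Notation line := {vspace 'cV[C]_2}.
Implicit Types (U V : 'M[C]_2) (w v : 'cV[C]_2) (p q : {mpoly C[2]}) (f g : K).
Variable G : seq 'M[R]_3.
Hypothesis Gpoly : is_polyhedral G.
Variables (T : seq line) (P : {mpoly C[2]}).
Hypothesis Torbit : is_orbit G T.
Hypothesis Pform : is_orbit_form G T P.
Variables (Omega : finType) (S : Omega -> seq line) (nu : Omega -> nat).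
Hypothesis Sexc : is_exceptional_orbits G S nu.
Variable Pi : Omega -> {mpoly C[2]}.
Hypothesis Piform : forall i, is_ground_form (S i) (Pi i).

Local Notation P0 := (P_neq0 Gpoly Pform).
Local Notation tP0 := (tofrac_neq0 P0).
Local Notation tPm0 m := (expf_neq0 m tP0).
Local Notation hP := (hom_P Pform).
Local Notation Pk := (Pk G P S nu Pi).

(** The binary group contains -1, which multiplies degree k by (-1)^k. *)
Lemma odd_invariant_eq0 k f : ~~ (2 %| k)%Z -> deg k f -> binv G f -> f = 0.
Proof.
move=> k2 hf bf; have hN : in_BG G (-1)%:M.
  have -> : (-1)%:M = - 1%:M :> 'M[C]_2 by rewrite raddfN.
  by apply: BG_opp; apply: BG_1.
have n10 : -1 != 0 :> C by rewrite oppr_eq0 oner_eq0.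
have := hf (-1) n10; rewrite (bf _ hN).
have -> : (-1 : C) ^ k = -1.
  have kE : k = (k %/ 2)%Z * 2 + 1.
    rewrite {1}(divz_eq k 2); congr (_ + _).
    have : (k %% 2)%Z != 0 by apply: contra k2 => /eqP h; apply/dvdz_mod0P.
    have := modz_ge0 k (isT : (2 : int) != 0); have := ltz_pmod k (isT : (0 : int) < 2).
    lia.
  rewrite kE (expfzDr _ _ n10) mulrC -[_ * 2]mulrC -exprz_exp.
  by rewrite -[(-1) ^ 2]/((-1) ^+ 2) sqrrN expr1n exp1rz mulr1 expr1z.
move=> e; have e2 : constK 2 * f = 0.
  have -> : (2 : C) = 1 - (-1) by rewrite opprK.
  by rewrite constKB constK1 mulrBl mul1r -e subrr.
by move/eqP: e2; rewrite mulf_eq0 constK_eq0 pnatr_eq0 /= => /eqP.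
Qed.

Lemma inv_Pi_in_loc i l : l \in S i -> l \in T -> in_loc P (tofrac (Pi i))^-1.
Proof.
move=> lS lT; have [c c0 e] := orbit_sameP Gpoly Torbit Pform Sexc Piform lS lT.
have t0 : tofrac (Pi i) != 0 by apply: tofrac_neq0; exact: Pi_neq0 Piform i.
exists (c *: Pi i ^+ (nu i).-1), 1%N; rewrite expr1.
apply: (mulfI t0); rewrite (divff t0) mulrA -tofracM -scalerAr -exprS.
by rewrite (prednK (nu_gt0 Sexc i)) -e (divff tP0).
Qed.

(** On an orbit other than T an invariant of degree k vanishes at least to the
order of the ground form in Pk k (lline_dvd); on T ground forms are
invertible. *)
Lemma div_Pk_in_loc k f : (2 %| k)%Z -> in_loc P f -> deg k f -> binv G f ->
  in_loc P (f / Pk k).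
Proof.
move=> k2 lf df bf; have [p [m [e hp]]] := in_loc_repr P0 hP lf df.
have sp := binv_semi Gpoly Pform e bf.
(* no divisibility is claimed on T, where P^-1 provides it *)
pose n i := if has (mem T) (S i) then 0%N else nexp nu k i.
have [|q qE] := prod_Pi_dvd Gpoly Sexc Piform (n := n) (p := p).
  move=> i l lS; rewrite /n; case: ifP => [_|/hasPn nT].
    by exists p; rewrite expr0 mul1r.
  exact: (lline_dvd Gpoly Torbit Pform Sexc Piform k2 hp sp lS (nT l lS)).
pose r := \prod_i tofrac (Pi i) ^- (nexp nu k i - n i).
have t0 i : tofrac (Pi i) != 0 by apply: tofrac_neq0; exact: Pi_neq0 Piform i.
have -> : f / Pk k = tofrac q / tofrac P ^+ m * tofrac P ^ (- ell G S nu k) * r.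
  rewrite e qE tofracM rmorph_prod (PkE P Sexc Pi k2) invfM.
  rewrite invr_expz -prodfV.
  have -> : \prod_i tofrac (Pi i ^+ n i) * tofrac q / tofrac P ^+ m *
     (tofrac P ^ (- ell G S nu k) * \prod_i (tofrac (Pi i) ^+ nexp nu k i)^-1) =
     tofrac q / tofrac P ^+ m * tofrac P ^ (- ell G S nu k) *
     (\prod_i tofrac (Pi i ^+ n i) * \prod_i (tofrac (Pi i) ^+ nexp nu k i)^-1).
    by move: (\prod_i _) (\prod_i _) (_ ^ _) (_ ^+ _)^-1 => a b c d; ring.
  congr (_ * _); rewrite -big_split; apply: eq_bigr => i _ /=.
  rewrite tofracXn /n; case: ifP => _; first by rewrite expr0 mul1r subn0.
  by rewrite subnn expr0 invr1; apply: divff; apply: expf_neq0.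
apply: in_locM; first apply: in_locM.
- by exists q, m.
- exact: in_loc_Pz.
apply: in_loc_prod => i _; rewrite /n; case: ifP => [/hasP[l lS lT]|_].
  by rewrite subn0 -exprVn; apply: in_loc_exp; apply: inv_Pi_in_loc lS lT.
by rewrite subnn expr0 invr1; apply: in_loc1.
Qed.

(** Invariants of degree k form a module of rank one: division by Pk k preserves
regularity and invariance and lands in degree 0. The value 0 of Pk k for odd k
matches the absence of odd invariants. *)
Lemma eigen_coefficient k f : in_loc P f -> deg k f -> binv G f ->
  exists2 r, in_inv_ring G P r & f = r * Pk k.
Proof.
move=> lf df bf; case: (boolP (2 %| k)%Z) => k2; last first.
  exists 0; last by rewrite mul0r (odd_invariant_eq0 k2 df bf).
  by rewrite -constK0; apply: (in_inv_ring_const Gpoly Pform).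
have Pk0 := Pk_neq0 Gpoly Pform Sexc Piform k2.
exists (f / Pk k); last by rewrite (divfK Pk0).
apply/(in_inv_ringP Gpoly Pform); split.
- exact: div_Pk_in_loc.
- rewrite -(subrr k); apply: degM => //; apply: degV.
  exact: (Pk_deg Gpoly Pform Sexc Piform k2).
- apply: binvM => //; apply: binvV.
  exact: (Pk_binv Gpoly Torbit Pform Sexc Piform k2).
Qed.

(** Residue and nu times quotient add up to k/2, which is additive; so the
coboundary of the residues is -nu times that of the quotients, and omega2 is
integral. *)
Lemma omega2E (V : zmodType) (k : V -> int) (a b : V) i :
  (2 %| k a)%Z -> (2 %| k b)%Z -> k (a + b) = k a + k b ->
  numq (omega2 nu k a b i) = qnu nu (k (a + b)) i - qnu nu (k a) i - qnu nu (k b) i.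
Proof.
move=> ka kb kab.
have hab : (k (a + b) %/ 2)%Z = (k a %/ 2)%Z + (k b %/ 2)%Z.
  by rewrite kab divzDl.
have -> : omega2 nu k a b i =
    (qnu nu (k (a + b)) i - qnu nu (k a) i - qnu nu (k b) i)%:~R.
  rewrite /omega2 /coboundary !nresD hab.
  have n0 : (nu i)%:R != 0 :> rat by rewrite pnatr_eq0 -lt0n (nu_gt0 Sexc).
  rewrite !rmorphB !rmorphM !rmorphD /= -!pmulrn; by field.
by rewrite numq_int.
Qed.

(** The exponents of the Pi i agree by omega2E. Those of P agree by ellE, as
each quotient Pi i ^+ nu i / P brings its own power of P. *)
Lemma PkM (V : zmodType) (k : V -> int) (a b : V) :
  (2 %| k a)%Z -> (2 %| k b)%Z -> k (a + b) = k a + k b ->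
  Pk (k a) * Pk (k b) = I_omega P nu Pi k a b * Pk (k (a + b)).
Proof.
move=> ka kb kab; have kk : (2 %| k (a + b))%Z by rewrite kab rpredD.
have hab : (k (a + b) %/ 2)%Z = (k a %/ 2)%Z + (k b %/ 2)%Z.
  by rewrite kab divzDl.
rewrite /Defs.Pk ka kb kk /I_omega.
pose o i := qnu nu (k (a + b)) i - qnu nu (k a) i - qnu nu (k b) i.
have t0 i : tofrac (Pi i) != 0 by apply: tofrac_neq0; exact: Pi_neq0 Piform i.
have -> : \prod_i (tofrac (Pi i) ^+ nu i / tofrac P) ^ numq (omega2 nu k a b i) =
   tofrac P ^ (- \sum_i o i) * \prod_i tofrac (Pi i) ^ ((nu i)%:Z * o i).
  have -> : tofrac P ^ (- \sum_i o i) = \prod_i tofrac P ^ (- o i).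
    rewrite -sumrN; apply: (big_morph (fun z : int => tofrac P ^ z)); last exact: expr0z.
    by move=> x y; rewrite (expfzDr _ _ tP0).
  rewrite -big_split; apply: eq_bigr => i _ /=.
  rewrite (omega2E _ ka kb kab) -/(o i) expfzMl mulrC exprz_inv.
  by rewrite (exprnP _ (nu i)) exprz_exp.
rewrite !mulrA [X in X * \prod_i _ ^ nres _ (k (a + b)) _]mulrAC -(expfzDr _ _ tP0).
rewrite -[RHS]mulrA -big_split /= [X in X * _ = _]mulrAC -(expfzDr _ _ tP0).
rewrite -[LHS]mulrA -big_split /=; congr (_ * _).
  congr (_ ^ _); rewrite !(ellE Gpoly Sexc) // hab.
  have -> : \sum_i o i = \sum_i qnu nu (k (a + b)) i - \sum_i qnu nu (k a) i
      - \sum_i qnu nu (k b) i.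
    by rewrite -!sumrB.
  by ring.
apply: eq_bigr => i _; rewrite -!(expfzDr _ _ (t0 i)); congr (_ ^ _).
by rewrite !nresD hab /o; ring.
Qed.
End EigenCoefficients.

(** * From complex points to rational functions *)

Section Specialisation.
Variable R : realType.
Local Notation C := (R[i]).
Local Notation K := {fraction {mpoly C[2]}}.
Implicit Types (U V : 'M[C]_2) (w v : 'cV[C]_2) (p q D : {mpoly C[2]}) (f g : K).

(** The value of f at v, as a relation: f need not be given by a fraction with a
denominator nonzero at v. *)
Definition spec v f (c : C) := exists p q,
  [/\ ev q v != 0, f = tofrac p / tofrac q & c = ev p v / ev q v].

Lemma ev_neq0 p v : ev p v != 0 -> p != 0.
Proof. by apply: contra => /eqP ->; rewrite ev0. Qed.

Lemma spec_uniq v f c d : spec v f c -> spec v f d -> c = d.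
Proof.
case=> p [q [q0 e ->]] [p' [q' [q'0 e' ->]]].
have h := proj1 (frac_eq _ _ (ev_neq0 q0) (ev_neq0 q'0)) (etrans (esym e) e').
apply/eqP; rewrite (eqr_div _ _ q0 q'0) -!evM h; exact: eqxx.
Qed.

Lemma spec_const v c : spec v (constK c) c.
Proof.
exists c%:MP, 1; split.
- by rewrite ev1 oner_eq0.
- by rewrite tofrac1 divr1.
- by rewrite evC ev1 divr1.
Qed.

Lemma spec0 v : spec v 0 0. Proof. by rewrite -constK0; apply: spec_const. Qed.
Lemma spec1 v : spec v 1 1. Proof. by rewrite -constK1; apply: spec_const. Qed.

Lemma specD v f g c d : spec v f c -> spec v g d -> spec v (f + g) (c + d).
Proof.
case=> p [q [q0 -> ->]] [p' [q' [q'0 -> ->]]].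
exists (p * q' + p' * q), (q * q'); split.
- by rewrite evM mulf_neq0.
- exact: frac_add (ev_neq0 q0) (ev_neq0 q'0).
- by rewrite (addf_div _ _ q0 q'0) evD !evM.
Qed.

Lemma specM v f g c d : spec v f c -> spec v g d -> spec v (f * g) (c * d).
Proof.
case=> p [q [q0 -> ->]] [p' [q' [q'0 -> ->]]].
exists (p * p'), (q * q'); split; first by rewrite evM mulf_neq0.
  exact: frac_mul.
by rewrite mulf_div !evM.
Qed.

Lemma specN v f c : spec v f c -> spec v (- f) (- c).
Proof.
move=> h; rewrite -mulN1r -[- c]mulN1r; apply: specM => //.
by rewrite -constK1 -rmorphN; apply: spec_const.
Qed.

Lemma spec_sum v (I : Type) (r : seq I) (f : I -> K) (c : I -> C) :
  (forall i, spec v (f i) (c i)) -> spec v (\sum_(i <- r) f i) (\sum_(i <- r) c i).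
Proof.
move=> h; elim: r => [|i r IH]; first by rewrite !big_nil; apply: spec0.
by rewrite !big_cons; apply: specD.
Qed.

Lemma spec_exp v f c n : spec v f c -> spec v (f ^+ n) (c ^+ n).
Proof.
by move=> h; elim: n => [|n IH]; [exact: spec1|rewrite !exprS; apply: specM].
Qed.

Lemma spec_prod v (I : Type) (r : seq I) (f : I -> K) (c : I -> C) :
  (forall i, spec v (f i) (c i)) -> spec v (\prod_(i <- r) f i) (\prod_(i <- r) c i).
Proof.
move=> h; elim: r => [|i r IH]; first by rewrite !big_nil; apply: spec1.
by rewrite !big_cons; apply: specM.
Qed.

Lemma spec_mmap v n (p : {mpoly C[n]}) (h : 'I_n -> K) (c : 'I_n -> C) :
  (forall i, spec v (h i) (c i)) -> spec v (mmap (@constK R) h p) (mmap idfun c p).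
Proof.
move=> hc; apply: spec_sum => m; apply: specM; first exact: spec_const.
by apply: spec_prod => i; apply: spec_exp.
Qed.

Lemma spec_exists (I : finType) (f : I -> K) :
  exists2 D, D != 0 & forall v, ev D v != 0 -> exists c, forall i, spec v (f i) (c i).
Proof.
have h0 i : exists pq : {mpoly C[2]} * {mpoly C[2]},
    pq.2 != 0 /\ f i = tofrac pq.1 / tofrac pq.2.
  elim/frac_ind: (f i) => p q q0; by exists (p, q).
have [pq pqE] := choice h0.
exists (\prod_i (pq i).2); first by apply/prodf_neq0 => i _; case: (pqE i).
move=> v; rewrite ev_prod => /prodf_neq0 n0.
exists (fun i => ev (pq i).1 v / ev (pq i).2 v) => i.
exists (pq i).1, (pq i).2; split=> //; first exact: n0.
by case: (pqE i).
Qed.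

(** A rational function vanishing at the points of a nonempty Zariski-open set
is zero. This is how identities for matrices of determinant 1 over C pass to
matrices over rational functions: evaluate at generic points. *)
Lemma spec_eq D f g : D != 0 ->
  (forall v, ev D v != 0 -> exists c, spec v f c /\ spec v g c) -> f = g.
Proof.
move=> D0 h; apply/eqP; rewrite -subr_eq0; apply/eqP.
have {h} : forall v, ev D v != 0 -> spec v (f - g) 0.
  by move=> v /h[c [hf hg]]; rewrite -(subrr c); apply: specD hf (specN hg).
elim/frac_ind: (f - g) => p q q0 h.
suff -> : p = 0 by rewrite tofrac0 mul0r.
apply/eqP; have : p * D == 0.
  apply/eqP/ev_eq0 => v; rewrite evM; have [->|n0] := eqVneq (ev D v) 0.
    by rewrite mulr0.
  have [p' [q' [q'0 e e']]] := h v n0.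
  have hpq := proj1 (frac_eq _ _ q0 (ev_neq0 q'0)) e.
  have p'0 : ev p' v = 0.
    by move/eqP: e'; rewrite eq_sym mulf_eq0 invr_eq0 (negbTE q'0) orbF => /eqP.
  have : ev p v * ev q' v = 0 by rewrite -evM hpq evM p'0 mul0r.
  by move/eqP; rewrite mulf_eq0 (negbTE q'0) orbF => /eqP ->; rewrite mul0r.
by rewrite mulf_eq0 (negbTE D0) orbF.
Qed.

Definition spec_mx v m n (M : 'M[K]_(m, n)) (N : 'M[C]_(m, n)) :=
  forall i j, spec v (M i j) (N i j).

Lemma spec_mulmx v m n r (M : 'M[K]_(m, n)) (M' : 'M[K]_(n, r)) N N' :
  spec_mx v M N -> spec_mx v M' N' -> spec_mx v (M *m M') (N *m N').
Proof.
by move=> h h' i j; rewrite !mxE; apply: spec_sum => l; apply: specM.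
Qed.

Lemma spec_det v (M : 'M[K]_2) N : spec_mx v M N -> spec v (\det M) (\det N).
Proof.
move=> h; rewrite !(expand_det_row _ 0) !sum2E /cofactor !det_mx11 !mxE.
have hs (n : nat) : spec v ((-1) ^+ n) ((-1) ^+ n).
  by apply: spec_exp; apply: specN; apply: spec1.
by apply: specD; apply: specM => //; apply: specM.
Qed.

Lemma spec_mx_exists m n (M : 'M[K]_(m, n)) :
  exists2 D, D != 0 & forall v, ev D v != 0 -> exists N, spec_mx v M N.
Proof.
have [D D0 h] := spec_exists (fun ij : 'I_m * 'I_n => M ij.1 ij.2).
exists D => // v /h[c hc]; exists (\matrix_(i, j) c (i, j)) => i j.
by rewrite mxE; apply: (hc (i, j)).
Qed.
End Specialisation.

Section LieSums.
Variables (F : fieldType) (L : vectType F) (br : L -> L -> L).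
Hypothesis Lie : is_lie_bracket br.

Lemma br0l x : br 0 x = 0.
Proof. by have := lie_linl Lie x (-1) 0 0; rewrite scaler0 addr0 scaleN1r addNr. Qed.

Lemma br0r x : br x 0 = 0.
Proof. by have := lie_linr Lie x (-1) 0 0; rewrite scaler0 addr0 scaleN1r addNr. Qed.

Lemma br_suml (I : Type) (r : seq I) (a : I -> F) (x : I -> L) y :
  br (\sum_(i <- r) a i *: x i) y = \sum_(i <- r) a i *: br (x i) y.
Proof.
elim: r => [|i r IH]; first by rewrite !big_nil br0l.
by rewrite !big_cons (lie_linl Lie) IH.
Qed.

Lemma br_sumr (I : Type) (r : seq I) (a : I -> F) (x : I -> L) y :
  br y (\sum_(i <- r) a i *: x i) = \sum_(i <- r) a i *: br y (x i).
Proof.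
elim: r => [|i r IH]; first by rewrite !big_nil br0r.
by rewrite !big_cons (lie_linr Lie) IH.
Qed.
End LieSums.

Section RationalRepresentation.
Variable R : realType.
Local Notation C := (R[i]).
Local Notation K := {fraction {mpoly C[2]}}.
Variables (L : vectType C) (br : L -> L -> L).
Hypothesis Lie : is_lie_bracket br.
Variable rhoP : 'M[{mpoly C[(2 * 2)]}]_(\dim {:L}).
Variable rho : 'M[C]_2 -> 'End(L).
Hypothesis rho_action : is_sl2_action br rhoP rho.
Local Notation n := (\dim {:L}).
Local Notation e := (vbasis {:L}).
Local Notation rC := (rho_eval rhoP idfun).
Local Notation rK := (rho_eval rhoP (@constK R)).

Lemma coord_e (i j : 'I_n) : coord e i e`_j = (i == j)%:R.
Proof.
by rewrite coord_free ?(basis_free (vbasisP _)) // eq_sym.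
Qed.

Lemma e_expand x : x = \sum_i coord e i x *: e`_i.
Proof. by apply: coord_vbasis; apply: memvf. Qed.

Lemma rC_coord (M : 'M[C]_2) i j : \det M = 1 -> rC M i j = coord e i (rho M e`_j).
Proof.
move=> dM; rewrite (sl2_regular rho_action _ _ dM) (bigD1 j) //= big1 ?addr0.
  by rewrite coord_e eqxx mulr1.
by move=> l nl; rewrite coord_e (negbTE nl) mulr0.
Qed.

Lemma rC_M (M M' : 'M[C]_2) : \det M = 1 -> \det M' = 1 -> rC (M *m M') = rC M *m rC M'.
Proof.
move=> dM dM'; apply/matrixP => i j.
rewrite rC_coord ?det_mulmx ?dM ?dM' ?mulr1 // (sl2_mul rho_action dM dM') comp_lfunE.
rewrite (sl2_regular rho_action _ _ dM) mxE; apply: eq_bigr => l _.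
by congr (_ * _); exact/esym/rC_coord.
Qed.

Lemma rC_1 : rC 1%:M = 1%:M.
Proof.
apply/matrixP => i j; rewrite rC_coord ?det1 // (sl2_one rho_action) id_lfunE.
by rewrite coord_e mxE.
Qed.

Lemma spec_rho v (M : 'M[K]_2) N : spec_mx v M N -> spec_mx v (rK M) (rC N).
Proof.
move=> h i j; rewrite !mxE; apply: spec_mmap => l.
by case/mxvec_indexP: l => a b; rewrite !mxvecE; apply: h.
Qed.

Lemma rK_const (M : 'M[C]_2) : rK (map_mx (@constK R) M) = map_mx (@constK R) (rC M).
Proof.
apply/matrixP => i j; rewrite !mxE /mmap rmorph_sum /=; apply: eq_bigr => m _.
rewrite rmorphM /= /mmap1 rmorph_prod; congr (_ * _); apply: eq_bigr => l _.
by rewrite rmorphXn; case/mxvec_indexP: l => a b; rewrite !mxvecE mxE.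
Qed.

Lemma rK_1 : rK 1%:M = 1%:M.
Proof. by rewrite -(map_mx1 (@constK R)) rK_const rC_1 map_mx1. Qed.

(** Where its entries are defined, a matrix of determinant 1 over rational
functions has values of determinant 1, on which rho is multiplicative. *)
Lemma rK_M (M M' : 'M[K]_2) : \det M = 1 -> \det M' = 1 -> rK (M *m M') = rK M *m rK M'.
Proof.
move=> dM dM'; apply/matrixP => i j.
have [D D0 h] := spec_mx_exists M; have [D' D'0 h'] := spec_mx_exists M'.
apply: (spec_eq (mulf_neq0 D0 D'0)) => v.
rewrite evM mulf_eq0 negb_or => /andP[/h[N hN] /h'[N' hN']].
have dN : \det N = 1.
  by apply: spec_uniq (spec_det hN) _; rewrite dM; apply: spec1.
have dN' : \det N' = 1.
  by apply: spec_uniq (spec_det hN') _; rewrite dM'; apply: spec1.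
exists (rC (N *m N') i j); split; first exact: spec_rho (spec_mulmx hN hN') i j.
rewrite rC_M //; exact: spec_mulmx (spec_rho hN) (spec_rho hN') i j.
Qed.

Definition sc l i j : C := coord e l (br e`_i e`_j).

(** Compatibility of rho with the bracket, in coordinates: an identity between
polynomials in the matrix entries. *)
Lemma rC_br (M : 'M[C]_2) (i j m : 'I_n) : \det M = 1 ->
  \sum_l rC M m l * sc l i j = \sum_i' \sum_j' rC M i' i * rC M j' j * sc m i' j'.
Proof.
move=> dM; rewrite -(sl2_regular rho_action _ _ dM) (sl2_bracket rho_action _ _ dM).
rewrite [rho M e`_i]e_expand (br_suml Lie) linear_sum; apply: eq_bigr => i' _ /=.
rewrite [rho M e`_j]e_expand (br_sumr Lie) scaler_sumr linear_sum; apply: eq_bigr => j' _ /=.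
by rewrite scalerA linearZ /= !rC_coord.
Qed.

Lemma rK_br (M : 'M[K]_2) (i j m : 'I_n) : \det M = 1 ->
  \sum_l rK M m l * constK (sc l i j) =
  \sum_i' \sum_j' rK M i' i * rK M j' j * constK (sc m i' j').
Proof.
move=> dM; have [D D0 h] := spec_mx_exists M.
apply: (spec_eq D0) => v /h[N hN].
have dN : \det N = 1.
  by apply: spec_uniq (spec_det hN) _; rewrite dM; apply: spec1.
have hr := spec_rho hN.
exists (\sum_l rC N m l * sc l i j); split.
  by apply: spec_sum => l; apply: specM; [apply: hr|apply: spec_const].
rewrite rC_br //; apply: spec_sum => i'; apply: spec_sum => j'.
by apply: specM; [apply: specM; apply: hr|apply: spec_const].
Qed.

Local Notation LK := 'cV[K]_n.

Lemma brKE (f g : LK) l : brK br f g l 0 = \sum_i \sum_j f i 0 * g j 0 * constK (sc l i j).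
Proof.
rewrite /brK summxE; apply: eq_bigr => i _; rewrite summxE; apply: eq_bigr => j _.
by rewrite !mxE.
Qed.

Lemma brK_rho (M : 'M[K]_2) (f g : LK) : \det M = 1 ->
  brK br (rK M *m f) (rK M *m g) = rK M *m brK br f g.
Proof.
move=> dM; apply/matrixP => m z; rewrite (ord1 z) {z} brKE mxE.
transitivity (\sum_i \sum_j f i 0 * g j 0 *
    \sum_i' \sum_j' rK M i' i * rK M j' j * constK (sc m i' j')).
  transitivity (\sum_i' \sum_j' \sum_i \sum_j
      f i 0 * g j 0 * (rK M i' i * rK M j' j * constK (sc m i' j'))).
    apply: eq_bigr => i' _; apply: eq_bigr => j' _; rewrite !mxE.
    rewrite -mulrA mulr_suml; apply: eq_bigr => i _.
    rewrite mulr_suml mulr_sumr; apply: eq_bigr => j _; ring.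
  under eq_bigr do rewrite exchange_big.
  rewrite exchange_big; apply: eq_bigr => i _ /=.
  under eq_bigr do rewrite exchange_big.
  rewrite exchange_big; apply: eq_bigr => j _ /=.
  rewrite mulr_sumr; apply: eq_bigr => i' _; rewrite mulr_sumr; apply: eq_bigr => j' _.
  by [].
under [RHS]eq_bigr do rewrite brKE mulr_sumr.
rewrite [RHS]exchange_big; apply: eq_bigr => i _ /=.
under [RHS]eq_bigr do rewrite mulr_sumr.
rewrite [RHS]exchange_big; apply: eq_bigr => j _ /=.
rewrite -(rK_br _ _ _ dM) mulr_sumr; apply: eq_bigr => l _; ring.
Qed.

Lemma extendE x i : extend x i 0 = constK (coord e i x).
Proof. by rewrite mxE. Qed.

Lemma extend_linear (I : Type) (r : seq I) (a : I -> C) (x : I -> L) :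
  extend (\sum_(i <- r) a i *: x i) = \sum_(i <- r) constK (a i) *: extend (x i).
Proof.
apply/matrixP => j z; rewrite (ord1 z) summxE extendE linear_sum rmorph_sum.
by apply: eq_bigr => i _; rewrite mxE extendE linearZ rmorphM.
Qed.

Lemma brK_extend x y : brK br (extend x) (extend y) = extend (br x y).
Proof.
rewrite {2}[x]e_expand (br_suml Lie) extend_linear; apply: eq_bigr => i _.
rewrite {2}[y]e_expand (br_sumr Lie) extend_linear scaler_sumr; apply: eq_bigr => j _.
by rewrite scalerA !extendE.
Qed.

Lemma brKZ (a b : K) (f g : LK) : brK br (a *: f) (b *: g) = (a * b) *: brK br f g.
Proof.
rewrite /brK scaler_sumr; apply: eq_bigr => i _; rewrite scaler_sumr; apply: eq_bigr => j _.
by rewrite scalerA !mxE; congr (_ *: _); ring.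
Qed.

Lemma rho_extend (M : 'M[C]_2) x : \det M = 1 ->
  map_mx (@constK R) (rC M) *m extend x = extend (rho M x).
Proof.
move=> dM; apply/matrixP => i z; rewrite (ord1 z) !mxE (sl2_regular rho_action _ _ dM).
by rewrite rmorph_sum; apply: eq_bigr => j _; rewrite !mxE rmorphM.
Qed.

Lemma sfr_rho U (M : 'M[K]_2) : U \in unitmx ->
  map_mx (sfr U) (rK M) = rK (map_mx (sfr U) M).
Proof.
move=> u; apply/matrixP => i j; rewrite !mxE /mmap -(sfr_rmorphismE u) rmorph_sum /=.
apply: eq_bigr => m _.
rewrite -(sfr_rmorphismE u) rmorphM /mmap1 rmorph_prod !sfr_rmorphismE.
rewrite (sfr_const _ u); congr (_ * _); apply: eq_bigr => l _.
by rewrite rmorphXn; case/mxvec_indexP: l => a b; rewrite !mxvecE mxE.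
Qed.

Lemma rK_in_loc (P : {mpoly C[2]}) (M : 'M[K]_2) : P != 0 ->
  (forall i j, in_loc P (M i j)) -> forall i j, in_loc P (rK M i j).
Proof.
move=> P0 h i j; rewrite mxE; apply: in_loc_sum => // m _.
apply: in_locM; first exact: in_loc_const.
apply: in_loc_prod => l _; apply: in_loc_exp.
by case/mxvec_indexP: l => a b; rewrite mxvecE; apply: h.
Qed.
End RationalRepresentation.

(** * Weights of the torus and the frame *)

Section Weights.
Variable R : realType.
Local Notation C := (R[i]).
Variables (L : vectType C) (br : L -> L -> L).
Variable rhoP : 'M[{mpoly C[(2 * 2)]}]_(\dim {:L}).
Variable rho : 'M[C]_2 -> 'End(L).
Hypothesis rho_action : is_sl2_action br rhoP rho.
Local Notation n := (\dim {:L}).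
Local Notation e := (vbasis {:L}).

(** A Laurent polynomial with coefficients in L vanishing identically has zero
coefficients; t ^ M clears the negative exponents. *)
Lemma laurent_indep (m : nat) (M : int) (A : 'I_m -> L) :
  (forall t : C, t != 0 -> \sum_(j < m) t ^ (j%:Z - M) *: A j = 0) -> forall j, A j = 0.
Proof.
move=> h j; rewrite [A j]e_expand big1 // => i _.
pose P : {poly C} := \poly_(s < m) (if insub s is Some j then coord e i (A j) else 0).
suff P0 : P = 0.
  have := congr1 (fun Q : {poly C} => Q`_j) P0.
  by rewrite coef0 coef_poly ltn_ord valK => ->; rewrite scale0r.
apply: poly_vanish_eq0 => t t0.
rewrite horner_poly.
have := congr1 (coord e i) (h t t0); rewrite linear0 linear_sum => /(congr1 ( *%R (t ^ M))).
rewrite mulr0 => e0; rewrite -[RHS]e0 mulr_sumr; apply: eq_bigr => s _.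
rewrite valK linearZ /= mulrA -expfzDr // addrC subrK mulrC.
by [].
Qed.

Definition torus (t : C) : 'M[C]_2 := mx2 t 0 0 t^-1.

Lemma det_torus t : t != 0 -> \det (torus t) = 1.
Proof. by move=> t0; rewrite det_mx2 mulfV // mulr0 subr0. Qed.

Lemma torusM t s : torus t *m torus s = torus (t * s).
Proof. by rewrite mx2M !mulr0 !mul0r !addr0 !add0r -invfM mulrC. Qed.

Lemma mxvec_big (T : Type) (x : T) (op : Monoid.com_law x) (F : 'I_(2 * 2) -> T) :
  \big[op/x]_l F l = op (op (F (mxvec_index 0 0)) (F (mxvec_index 0 1)))
                        (op (F (mxvec_index 1 0)) (F (mxvec_index 1 1))).
Proof.
rewrite (reindex _ (curry_mxvec_bij _ _)) /=.
transitivity (\big[op/x]_(p : 'I_2 * 'I_2) F (mxvec_index p.1 p.2)).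
  by apply: eq_bigr => -[i j] _.
rewrite -(pair_bigA _ (fun i j => F (mxvec_index i j))) /=.
have b2 (H : 'I_2 -> T) : \big[op/x]_i H i = op (H 0) (H 1).
  rewrite !big_ord_recl big_ord0 Monoid.mulm1; congr (op _ (H _)); exact: val_inj.
by rewrite !b2.
Qed.

Local Notation ia := (mxvec_index 0 0 : 'I_(2 * 2)).
Local Notation ib := (mxvec_index 0 1 : 'I_(2 * 2)).
Local Notation ic := (mxvec_index 1 0 : 'I_(2 * 2)).
Local Notation id := (mxvec_index 1 1 : 'I_(2 * 2)).

Lemma mxvec_index_inj (i j i' j' : 'I_2) :
  mxvec_index i j = mxvec_index i' j' -> i = i' /\ j = j'.
Proof. by move=> /cast_ord_inj/enum_rank_inj[]. Qed.

Definition mwt (m : 'X_{1..(2 * 2)}) : int := (m ia)%:Z - (m id)%:Z.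
Definition mdiag (m : 'X_{1..(2 * 2)}) : bool := (m ib == 0%N) && (m ic == 0%N).

Lemma mmap1_torus t (m : 'X_{1..(2 * 2)}) : t != 0 ->
  \prod_l (mxvec (torus t) 0 l) ^+ m l = (mdiag m)%:R * t ^ mwt m.
Proof.
move=> t0; rewrite mxvec_big /= !mxvecE !mxE /= !expr0n /mwt /mdiag.
rewrite expfzDr // -invr_expz -!exprnP exprVn.
by case: (m ib == 0%N); case: (m ic == 0%N); rewrite /= ?(mulr1, mul1r, mulr0, mul0r).
Qed.

Lemma rC_torus t i j : t != 0 -> rho_eval rhoP idfun (torus t) i j =
  \sum_(m <- msupp (rhoP i j)) (rhoP i j)@_m * ((mdiag m)%:R * t ^ mwt m).
Proof.
move=> t0; rewrite mxE /mmap; apply: eq_bigr => m _.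
by rewrite /mmap1 (mmap1_torus m t0).
Qed.

Lemma sum_sl2H (f : 'I_(2 * 2) -> C) :
  \sum_v f v * mxvec (sl2H C) 0 v = f ia - f id.
Proof.
rewrite mxvec_big /= !mxvecE !mxE /=.
by rewrite !mulr0 expr0 expr1 mulr1 mulrN1 addr0 add0r.
Qed.

Lemma drho_coef i j :
  \sum_v (rhoP i j)^`M(v).@[fun w => mxvec 1%:M 0 w] * mxvec (sl2H C) 0 v =
  \sum_(m <- msupp (rhoP i j)) (rhoP i j)@_m * ((mdiag m)%:R * (mwt m)%:~R).
Proof.
rewrite sum_sl2H.
have dE l : l = ia \/ l = id -> (rhoP i j)^`M(l).@[fun w => mxvec 1%:M 0 w] =
   \sum_(m <- msupp (rhoP i j)) (rhoP i j)@_m * ((mdiag m)%:R * (m l)%:R).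
  move=> hl; rewrite /mderiv raddf_sum /=; apply: eq_bigr => m _.
  rewrite mevalZ mevalX [_%:R * _]mulrC -mulrA; congr (_ * _).
  rewrite mulrC; congr (_ * _).
  rewrite mxvec_big /= !mxvecE !mxE /= !expr1n !mul1r mulr1 !expr0n.
  have nb : (m - U_(l))%MM ib = m ib.
    rewrite mnmBE mnm1E; case: eqP => [lb|_]; last by rewrite subn0.
    by case: hl => hl; rewrite hl in lb; case/mxvec_index_inj: lb.
  have nc : (m - U_(l))%MM ic = m ic.
    rewrite mnmBE mnm1E; case: eqP => [lb|_]; last by rewrite subn0.
    by case: hl => hl; rewrite hl in lb; case/mxvec_index_inj: lb.
  by rewrite nb nc /mdiag; case: (m ib == 0%N); case: (m ic == 0%N); rewrite /= ?mulr0 ?mulr1.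
rewrite !dE; try by [left|right].
rewrite -sumrB; apply: eq_bigr => m _.
by rewrite /mwt rmorphB /= -!pmulrn -mulrBr -mulrBr.
Qed.

Lemma rho_coordE (M : 'M[C]_2) x i : \det M = 1 ->
  coord e i (rho M x) = \sum_j rho_eval rhoP idfun M i j * coord e j x.
Proof. exact: sl2_regular rho_action M x i. Qed.

(** The matrix coefficients of the torus are Laurent polynomials, so the orbit
of x is a Laurent polynomial in t with coefficients in L, and the derivative at
1 is the sum of the coefficients weighted by their exponents. *)
Lemma torus_laurent x : exists (m : nat) (M : int) (A : 'I_m -> L),
  (forall t, t != 0 -> rho (torus t) x = \sum_(s < m) t ^ (s%:Z - M) *: A s) /\
  drho rhoP (sl2H C) x = \sum_(s < m) (s%:Z - M)%:~R *: A s.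
Proof.
(* N bounds all exponents, so the powers of t lie between -N and N *)
pose N := \max_(ij : 'I_n * 'I_n) msize (rhoP ij.1 ij.2).
have hN i j (k : 'X_{1..(2 * 2)}) l : k \in msupp (rhoP i j) -> (k l < N)%N.
  move=> km; have hd : (k l <= mdeg k)%N by rewrite mdegE (bigD1 l) //= leq_addr.
  apply: leq_trans (leq_ltn_trans hd (msize_mdeg_lt km)) _.
  exact: (leq_bigmax (F := fun ij : 'I_n * 'I_n => msize (rhoP ij.1 ij.2)) (i, j)).
pose m := (N + N)%N; pose M := N%:Z.
pose c i j (s : 'I_m) := \sum_(k <- msupp (rhoP i j))
   (rhoP i j)@_k * ((mdiag k)%:R * (s%:Z - M == mwt k)%:R).
pose A (s : 'I_m) := \sum_i (\sum_j c i j s * coord e j x) *: e`_i.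
have hs i j (k : 'X_{1..(2 * 2)}) (f : int -> C) : k \in msupp (rhoP i j) ->
    \sum_(s < m) f (s%:Z - M) * (s%:Z - M == mwt k)%:R = f (mwt k).
  move=> km; have ha := hN i j k ia km; have hd := hN i j k id km.
  have hm : (N + k ia - k id < m)%N by rewrite /m; lia.
  have hE : (Ordinal hm)%:Z - M = mwt k by rewrite /= /M /mwt; lia.
  rewrite (bigD1 (Ordinal hm)) // hE eqxx mulr1 big1 => [|s /= ns]; first exact: addr0.
  case: eqP => [e1|_]; last by rewrite mulr0.
  by case/eqP: ns; apply: val_inj => /=; move: e1; rewrite /M /mwt; lia.
have key (f : int -> C) : \sum_(s < m) f (s%:Z - M) *: A s =
    \sum_i (\sum_j (\sum_(k <- msupp (rhoP i j))
       (rhoP i j)@_k * ((mdiag k)%:R * f (mwt k))) * coord e j x) *: e`_i.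
  under [LHS]eq_bigr do rewrite /A scaler_sumr.
  rewrite exchange_big; apply: eq_bigr => i _ /=.
  under [LHS]eq_bigr do rewrite scalerA.
  rewrite -scaler_suml; congr (_ *: _).
  under [LHS]eq_bigr do rewrite mulr_sumr.
  rewrite exchange_big; apply: eq_bigr => j _ /=.
  under [LHS]eq_bigr do rewrite mulrA.
  rewrite -mulr_suml; congr (_ * _).
  under [LHS]eq_bigr do rewrite /c mulr_sumr.
  rewrite exchange_big; apply: eq_big_seq => k km /=.
  rewrite -(hs i j k f km) !mulr_sumr; apply: eq_bigr => s _; ring.
exists m, M, A; split=> [t t0|].
  rewrite (key (fun z => t ^ z)) [LHS]e_expand; apply: eq_bigr => i _.
  rewrite rho_coordE ?det_torus //; congr (_ *: _); apply: eq_bigr => j _.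
  by rewrite rC_torus.
rewrite (key (fun z => z%:~R)) /drho; apply: eq_bigr => i _.
rewrite -scaler_suml; congr (_ *: _); apply: eq_bigr => j _.
by rewrite drho_coef.
Qed.

(** Integrating an eigenvalue of drho to the torus. Multiplicativity of rho
makes each Laurent coefficient of the orbit of x a weight vector, whose weight
is its exponent; the derivative says that only the exponent k occurs. *)
Lemma torus_weight (k : int) x : drho rhoP (sl2H C) x = k%:~R *: x ->
  forall t, t != 0 -> rho (torus t) x = t ^ k *: x.
Proof.
have [m [M [A [hA hD]]]] := torus_laurent x; rewrite hD => hk.
have xE : x = \sum_(s < m) A s.
  have := hA 1 (oner_neq0 _).
  have -> : torus 1 = 1%:M by rewrite /torus invr1 mx2_1.
  rewrite (sl2_one rho_action) id_lfunE => {1}->.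
  by apply: eq_bigr => s _; rewrite exp1rz scale1r.
have hw t s : t != 0 -> rho (torus t) (A s) = t ^ (s%:Z - M) *: A s.
  move=> t0; apply/eqP; rewrite -subr_eq0; apply/eqP.
  move: s; apply: (laurent_indep (M := M)) => r r0.
  under eq_bigr do rewrite scalerBr.
  rewrite sumrB; apply/eqP; rewrite subr_eq0; apply/eqP.
  transitivity (rho (torus t) (rho (torus r) x)).
    by rewrite (hA r r0) linear_sum; apply: eq_bigr => s _; rewrite linearZ.
  have rt : t * r != 0 by rewrite mulf_neq0.
  rewrite -comp_lfunE -(sl2_mul rho_action) ?det_torus // torusM (hA _ rt).
  by apply: eq_bigr => s _; rewrite scalerA expfzMl mulrC.
have h0 (s : 'I_m) : ((s%:Z - M) - k)%:~R *: A s = 0.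
  move: s; apply: (laurent_indep (M := M)) => t t0.
  transitivity (rho (torus t) (\sum_(s < m) ((s%:Z - M) - k)%:~R *: A s)).
    rewrite linear_sum; apply: eq_bigr => s _.
    by rewrite [RHS]linearZ /= hw // !scalerA mulrC.
  under eq_bigr do rewrite rmorphB scalerBl.
  by rewrite sumrB hk -scaler_sumr -xE subrr linear0.
move=> t t0; rewrite (hA t t0) [in RHS]xE scaler_sumr; apply: eq_bigr => s _.
have /eqP := h0 s; rewrite scaler_eq0 intr_eq0 subr_eq0 => /orP[/eqP -> //|/eqP ->].
by rewrite !scaler0.
Qed.
End Weights.

Section Frame.
Variable R : realType.
Local Notation C := (R[i]).
Local Notation K := {fraction {mpoly C[2]}}.
Variable G : seq 'M[R]_3.
Hypothesis Gpoly : is_polyhedral G.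
Variables (T : seq {vspace 'cV[C]_2}) (P : {mpoly C[2]}).
Hypothesis Pform : is_orbit_form G T P.

Local Notation P0 := (P_neq0 Gpoly Pform).
Local Notation tP0 := (tofrac_neq0 P0).

Lemma msize_P : (msize P).-1 = size G.
Proof. by case: Pform => h _ _; rewrite (msize_homog P0 h). Qed.

Definition dlog (j : 'I_2) : K := constK ((size G)%:R^-1) * (tofrac P^`M(j) / tofrac P).

Lemma size_G_neq0 : (size G)%:R != 0 :> C.
Proof. by rewrite pnatr_eq0 -lt0n (size_poly_gt0 Gpoly). Qed.

Lemma Phi1E : Phi1 P = mx2 (dlog 1) (tofrac 'X_0) (- dlog 0) (tofrac 'X_1).
Proof.
have h j : tofrac P^`M(j) / ((size G)%:R * tofrac P) = dlog j.
  by rewrite /dlog fmorphV rmorph_nat invfM mulrCA.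
by rewrite /Phi1 msize_P !h.
Qed.

(** Euler's identity for P. *)
Lemma det_Phi1 : \det (Phi1 P) = 1.
Proof.
rewrite Phi1E det_mx2 mulrN opprK /dlog.
have := congr1 (@FracField.tofrac _) (euler (hom_P Pform)).
rewrite tofracD !tofracM tofracZ => e.
transitivity (constK (size G)%:R^-1 *
  ((tofrac 'X_0 * tofrac P^`M(0) + tofrac 'X_1 * tofrac P^`M(1)) / tofrac P)).
  by move: (tofrac P)^-1 => x; ring.
rewrite e mulrA mulrA -constKM mulVf ?size_G_neq0 // constK1 mul1r; exact: divff tP0.
Qed.

Lemma Phi1_in_loc i j : in_loc P (Phi1 P i j).
Proof.
have hd l : in_loc P (dlog l).
  by apply: in_locM; [exact: in_loc_const|exists P^`M(l), 1%N; rewrite expr1].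
rewrite Phi1E mxE; case: (i == 0); case: (j == 0) => //; first exact: in_loc_tofrac.
  exact: in_locN.
exact: in_loc_tofrac.
Qed.

(** The gradient of log P transforms by the inverse transpose of U. For
determinant 1, turning it by a right angle makes it transform by U. *)
Lemma sfr_dlog U c : U \in unitmx -> \det U = 1 -> sub U P = c *: P ->
  sfr U (dlog 1) = constK (U 0 0) * dlog 1 - constK (U 0 1) * dlog 0 /\
  sfr U (dlog 0) = constK (U 1 1) * dlog 0 - constK (U 1 0) * dlog 1.
Proof.
move=> u dU hc; have c0 := char_neq0 u P0 hc.
have h0 := mderiv_sub U 0 P; have h1 := mderiv_sub U 1 P.
rewrite hc !mderivZ in h0 h1.
have k0 : constK c != 0 by rewrite constK_eq0.
have s1 : sub U P^`M(1) = c *: (U 0 0 *: P^`M(1) - U 0 1 *: P^`M(0)).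
  rewrite scalerBr !scalerA ![c * _]mulrC -!scalerA h0 h1 -[LHS]scale1r -dU det2E.
  by rewrite -!mul_mpolyC mpolyCB !mpolyCM; ring.
have s0 : sub U P^`M(0) = c *: (U 1 1 *: P^`M(0) - U 1 0 *: P^`M(1)).
  rewrite scalerBr !scalerA ![c * _]mulrC -!scalerA h0 h1 -[LHS]scale1r -dU det2E.
  by rewrite -!mul_mpolyC mpolyCB !mpolyCM; ring.
have hd j (q : {mpoly C[2]}) : sub U P^`M(j) = c *: q ->
    sfr U (dlog j) = constK (size G)%:R^-1 * (tofrac q / tofrac P).
  have sM f g : sfr U (f * g) = sfr U f * sfr U g := rmorphM (sfr_rmorphism u) f g.
  have sV f : sfr U f^-1 = (sfr U f)^-1 := fmorphV (sfr_rmorphism u) f.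
  move=> e; rewrite /dlog !sM sV (sfr_const _ u) !(sfr_tofrac _ u) hc e !tofracZ; congr (_ * _).
  by rewrite invfM mulrACA (divff k0) mul1r.
split; [rewrite [LHS](hd _ _ s1)|rewrite [LHS](hd _ _ s0)];
  rewrite tofracB !tofracZ /dlog; move: (tofrac P)^-1 (tofrac P^`M(0)) (tofrac P^`M(1));
  by move: (constK _) (constK _) (constK _) => a b d x y z; ring.
Qed.

(** The second column of the frame is the identity map and the first is the
turned gradient of log P; both intertwine substitution by U with multiplication
by U. *)
Lemma Phi1_equivariant U : in_BG G U ->
  map_mx (sfr U) (Phi1 P) = map_mx (@constK R) U *m Phi1 P.
Proof.
move=> hU; have u := BG_unit hU; have [c hc] := P_char Gpoly Pform hU.
have [e1 e0] := sfr_dlog u (BG_det hU) hc.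
have hN f : sfr U (- f) = - sfr U f by rewrite -(sfr_rmorphismE u) rmorphN.
rewrite Phi1E mx2_map hN e1 e0 !(sfr_tofrac _ u) !sub_X !tofracD !tofracZ.
rewrite [U in RHS]mx2_eq mx2_map mx2M; congr (mx2 _ _ _ _); ring.
Qed.

(** The columns of the frame are homogeneous of degree -1 and 1. *)
Lemma Phi1_scaling (c : C) : c != 0 ->
  map_mx (sfr c%:M) (Phi1 P) = Phi1 P *m map_mx (@constK R) (torus c^-1).
Proof.
move=> c0; have u := scalar_unit c0.
have hN f : sfr c%:M (- f) = - sfr c%:M f by rewrite -(sfr_rmorphismE u) rmorphN.
have hP := hom_P Pform.
have hd j : sfr c%:M (dlog j) = constK c^-1 * dlog j.
  have d1 : deg (0 + ((size G)%:Z - 1 - (size G)%:Z)) (dlog j).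
    apply: degM; first exact: deg_const.
    apply: degM; first by apply/deg_tofrac; apply: hom_mderiv.
    by apply: degV; apply/deg_tofrac.
  by rewrite (d1 c c0) add0r addrAC subrr add0r exprN1.
have hX i : sfr c%:M (tofrac 'X_i) = constK c * tofrac 'X_i.
  have d1 : deg 1 (tofrac ('X_i : {mpoly C[2]})).
    by apply/deg_tofrac => a w a0; rewrite !evX mxE expr1z.
  by rewrite (d1 c c0) expr1z.
rewrite Phi1E mx2_map hN !hd !hX /torus invrK mx2_map mx2M constK0.
by congr (mx2 _ _ _ _); ring.
Qed.
End Frame.

(** * The module of invariant vectors *)

(** Coordinates as functions of a natural index, so that nothing depends on the
length of a list from which generators will be dropped. *)
Lemma basis_coordinates (F : fieldType) (L : vectType F) (B : Type) (b0 : B)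
    (f : B -> L) (s : seq B) : basis_of fullv [seq f b | b <- s] ->
  exists cf : nat -> L -> F,
  [/\ forall j a x y, cf j (a *: x + y) = a * cf j x + cf j y,
      forall x, x = \sum_(j < size s) cf j x *: f (nth b0 s j) &
      forall i j, (i < size s)%N -> (j < size s)%N -> cf i (f (nth b0 s j)) = (i == j)%:R].
Proof.
move=> hb; have sX : size [seq f b | b <- s] = size s by rewrite size_map.
pose X := in_tuple [seq f b | b <- s]; have bX : basis_of fullv X by [].
have fX : free X := basis_free bX.
pose cf (j : nat) x : F := if insub j is Some i then coord X i x else 0.
exists cf; split.
- move=> j a x y; rewrite /cf; case: insub => [i|]; last by rewrite mulr0 addr0.
  by rewrite linearP.
- move=> x; rewrite {1}(coord_basis bX (memvf x)) /=.
  rewrite -sX; apply: eq_bigr => i _; rewrite /cf valK.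
  by rewrite (nth_map b0) // -sX.
move=> i j; rewrite -{1 2}sX => hi hj; rewrite /cf.
rewrite (insubT (fun i => (i < _)%N) hi).
have -> : f (nth b0 s j) = X`_(Ordinal hj) by rewrite (nth_map b0) // -sX.
by rewrite coord_free // eq_sym.
Qed.

Section Spans.
Variable R : realType.
Local Notation C := (R[i]).
Local Notation K := {fraction {mpoly C[2]}}.
Variable n : nat.
Local Notation LK := 'cV[K]_n.
Variables (B : Type) (b0 : B) (F : B -> LK) (a : B -> K).
Local Notation gens s := [seq a b *: F b | b <- s].
Local Notation nonzero s := [seq y <- s | y != 0].

(** A zero generator contributes nothing, so its coefficient can be left out
along with it. *)
Lemma drop_zero_span (Q : K -> Prop) (s : seq B) (c : nat -> K) : (forall j, Q (c j)) ->
  exists2 c' : nat -> K, (forall j, Q (c' j)) &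
  \sum_(j < size s) c j *: (a (nth b0 s j) *: F (nth b0 s j)) =
  \sum_(j < size (nonzero (gens s))) c' j *: (nonzero (gens s))`_j.
Proof.
elim: s c => [|b s IH] c hc; first by exists c => //; rewrite !big_ord0.
have [c' hc' e] := IH (fun j => c j.+1) (fun j => hc j.+1).
rewrite big_ord_recl /= e; case: eqP => [->|_] /=.
  by exists c' => //; rewrite scaler0 add0r.
exists (fun j => if j is j'.+1 then c' j' else c 0%N); first by case.
by rewrite big_ord_recl.
Qed.

(** Freeness needs the vectors F to be independent, while a generator a b *: F b
may vanish through its coefficient. *)
Lemma drop_zero_free (s : seq B) :
  (forall c : nat -> K, \sum_(j < size s) c j *: F (nth b0 s j) = 0 ->
     forall j, (j < size s)%N -> c j = 0) ->
  forall c : nat -> K, \sum_(j < size (nonzero (gens s))) c j *: (nonzero (gens s))`_j = 0 ->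
    forall j, (j < size (nonzero (gens s)))%N -> c j = 0.
Proof.
move=> free c hc.
have lift_c : exists2 c' : nat -> K,
    \sum_(j < size (nonzero (gens s))) c j *: (nonzero (gens s))`_j =
    \sum_(j < size s) c' j *: F (nth b0 s j) &
    (forall j, (j < size s)%N -> c' j = 0) ->
    forall j, (j < size (nonzero (gens s)))%N -> c j = 0.
  elim: s {free hc} c => [|b s IH] c; first by exists c => //; rewrite !big_ord0.
  rewrite /=; case: eqP => [ab|ab] /=.
    have [c' e h] := IH c; exists (fun j => if j is j'.+1 then c' j' else 0).
      by rewrite e big_ord_recl /= scale0r add0r.
    by move=> z; apply: h => j js; apply: (z j.+1).
  have [c' e h] := IH (fun j => c j.+1).
  exists (fun j => if j is j'.+1 then c' j' else c 0%N * a b).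
    by rewrite !big_ord_recl /= e scalerA.
  move=> z [|j] js; last by apply: h => // l ls; apply: (z l.+1).
  have /eqP := z 0%N isT; rewrite mulf_eq0 => /orP[/eqP //|/eqP a0].
  by case: ab; rewrite a0 scale0r.
have [c' e h] := lift_c; apply: h; apply: free; rewrite -e; exact: hc.
Qed.
End Spans.

Section FreeModule.
Variable R : realType.
Local Notation C := (R[i]).
Local Notation K := {fraction {mpoly C[2]}}.
Variable G : seq 'M[R]_3.
Hypothesis Gpoly : is_polyhedral G.
Variables (T : seq {vspace 'cV[C]_2}) (P : {mpoly C[2]}).
Hypothesis Torbit : is_orbit G T.
Hypothesis Pform : is_orbit_form G T P.
Variables (Omega : finType) (S : Omega -> seq {vspace 'cV[C]_2}) (nu : Omega -> nat).
Hypothesis Sexc : is_exceptional_orbits G S nu.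
Variable Pi : Omega -> {mpoly C[2]}.
Hypothesis Piform : forall i, is_ground_form (S i) (Pi i).
Variables (L : vectType C) (br : L -> L -> L).
Variable rhoP : 'M[{mpoly C[(2 * 2)]}]_(\dim {:L}).
Variable rho : 'M[C]_2 -> 'End(L).
Hypothesis rho_action : is_sl2_action br rhoP rho.
Local Notation n := (\dim {:L}).
Local Notation e := (vbasis {:L}).
Local Notation LK := 'cV[K]_n.
Local Notation P0 := (P_neq0 Gpoly Pform).
Local Notation hP := (hom_P Pform).
Local Notation Pk := (Pk G P S nu Pi).
Local Notation rK := (rho_eval rhoP (@constK R)).
Local Notation M := (Phi1 P).
Local Notation A := (rK M).

(** The adjugate, which for determinant 1 is the inverse and has entries in the
same ring. *)
Definition Phi1V : 'M[K]_2 := mx2 (M 1 1) (- M 0 1) (- M 1 0) (M 0 0).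

Lemma Phi1K : M *m Phi1V = 1%:M.
Proof.
rewrite [M in LHS]mx2_eq /Phi1V mx2M mx2_1 -(det_Phi1 Gpoly Pform) det2E.
by congr (mx2 _ _ _ _); ring.
Qed.

Lemma det_Phi1V : \det Phi1V = 1.
Proof. by rewrite -[RHS](det_Phi1 Gpoly Pform) det_mx2 det2E; ring. Qed.

Lemma rPhi1K : A *m rK Phi1V = 1%:M.
Proof.
by rewrite -(rK_M rho_action (det_Phi1 Gpoly Pform) det_Phi1V) Phi1K (rK_1 rho_action).
Qed.

Lemma rPhi1VK : rK Phi1V *m A = 1%:M.
Proof. exact: mulmx1C rPhi1K. Qed.

Lemma A_in_loc i j : in_loc P (A i j).
Proof. apply: rK_in_loc => [|a b]; first exact: P0.
exact: (Phi1_in_loc Gpoly Pform). Qed.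

Lemma AV_in_loc i j : in_loc P (rK Phi1V i j).
Proof.
have hM := Phi1_in_loc Gpoly Pform.
apply: rK_in_loc => [|a b]; first exact: P0.
rewrite mxE.
by case: (a == 0); case: (b == 0); try apply: in_locN; apply: hM.
Qed.

Lemma mulmx_in_loc (m r s : nat) (X : 'M[K]_(m, r)) (Y : 'M[K]_(r, s)) :
  (forall i j, in_loc P (X i j)) -> (forall i j, in_loc P (Y i j)) ->
  forall i j, in_loc P ((X *m Y) i j).
Proof.
move=> hX hY i j; rewrite mxE; apply: (in_loc_sum P0) => l _.
by apply: in_locM; [apply: hX|apply: hY].
Qed.

Lemma map_sfrM U (m r s : nat) (X : 'M[K]_(m, r)) (Y : 'M[K]_(r, s)) : U \in unitmx ->
  map_mx (sfr U) (X *m Y) = map_mx (sfr U) X *m map_mx (sfr U) Y.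
Proof. by move=> u; have := map_mxM (sfr_rmorphism u) X Y. Qed.

Lemma sfr_A_BG U : in_BG G U ->
  map_mx (sfr U) A = rK (map_mx (@constK R) U) *m A.
Proof.
move=> hU; rewrite (sfr_rho _ _ (BG_unit hU)) (Phi1_equivariant Gpoly Pform hU).
rewrite (rK_M rho_action _ (det_Phi1 Gpoly Pform)) //.
by rewrite det_map_mx (BG_det hU) rmorph1.
Qed.

Lemma sfr_A_scaling (c : C) : c != 0 ->
  map_mx (sfr c%:M) A = A *m map_mx (@constK R) (rho_eval rhoP idfun (torus c^-1)).
Proof.
move=> c0; rewrite (sfr_rho _ _ (scalar_unit c0)) (Phi1_scaling Gpoly Pform c0).
rewrite (rK_M rho_action (det_Phi1 Gpoly Pform)) ?(rK_const) //.
by rewrite det_map_mx det_torus ?invr_eq0 // rmorph1.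
Qed.

Lemma rK_BGK U : in_BG G U ->
  rK (map_mx (@constK R) (invmx U)) *m rK (map_mx (@constK R) U) = 1%:M.
Proof.
move=> hU; have dU := BG_det hU; have dV := BG_det (BG_inv Gpoly hU).
rewrite -(rK_M rho_action) ?det_map_mx ?dU ?dV ?rmorph1 //.
by rewrite -map_mxM mulVmx ?(BG_unit hU) // map_mx1 (rK_1 rho_action).
Qed.

(** Membership in terms of the two commuting actions by substitution: scalars
act trivially, the binary group acts through rho. *)
Lemma in_aLieP (f : LK) : in_aLie G P rhoP f <->
  [/\ forall i, in_loc P (f i 0), forall c : C, c != 0 -> map_mx (sfr c%:M) f = f
    & forall U, in_BG G U -> map_mx (sfr U) f = rK (map_mx (@constK R) U) *m f].
Proof.
split=> -[lf hf bf]; split=> //.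
- move=> c c0; apply/matrixP => i j; rewrite (ord1 j) mxE.
  by rewrite (homog0_deg (hf i)) // expr0z constK1 mul1r.
- move=> U hU; have hV := BG_inv Gpoly hU; have := bf _ hV; rewrite invmxK => e1.
  rewrite -[in RHS]e1 mulmxA; have := rK_BGK hV; rewrite invmxK => ->.
  by rewrite mul1mx sfr.unlock.
- move=> i; apply: (deg_homog0 P0 hP) => // c c0.
  have := hf c c0 => /matrixP/(_ i 0); rewrite mxE => ->.
  by rewrite expr0z constK1 mul1r.
move=> U hU; have hV := BG_inv Gpoly hU; have := bf _ hV; rewrite sfr.unlock => ->.
by rewrite mulmxA; have := rK_BGK hV; rewrite invmxK => ->; rewrite mul1mx.
Qed.

Lemma in_aLieD f g : in_aLie G P rhoP f -> in_aLie G P rhoP g -> in_aLie G P rhoP (f + g).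
Proof.
move=> /in_aLieP[lf hf bf] /in_aLieP[lg hg bg]; apply/in_aLieP.
have hD U : U \in unitmx -> map_mx (sfr U) (f + g) = map_mx (sfr U) f + map_mx (sfr U) g.
  by move=> u; have := map_mxD (sfr_rmorphism u) f g.
split=> [i|c c0|U hU].
- by rewrite mxE; apply: (in_locD P0).
- by rewrite (hD _ (scalar_unit c0)) hf // hg.
- by rewrite (hD _ (BG_unit hU)) bf // bg // mulmxDr.
Qed.

Lemma in_aLieZ r f : in_inv_ring G P r -> in_aLie G P rhoP f -> in_aLie G P rhoP (r *: f).
Proof.
move=> /(in_inv_ringP Gpoly Pform)[lr dr hr] /in_aLieP[lf hf bf]; apply/in_aLieP.
have hZ U : U \in unitmx -> map_mx (sfr U) (r *: f) = sfr U r *: map_mx (sfr U) f.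
  by move=> u; have := map_mxZ (sfr_rmorphism u) r f.
split=> [i|c c0|U hU].
- by rewrite mxE; apply: in_locM.
- by rewrite (hZ _ (scalar_unit c0)) hf // dr // expr0z constK1 mul1r.
- by rewrite (hZ _ (BG_unit hU)) bf // hr // scalemxAr.
Qed.

Lemma in_aLie0 : in_aLie G P rhoP 0.
Proof.
apply/in_aLieP; split=> [i|c c0|U hU]; first by rewrite mxE; apply: in_loc0.
  by have := map_mx0 (sfr_rmorphism (scalar_unit c0)) n 1.
by rewrite mulmx0; have := map_mx0 (sfr_rmorphism (BG_unit hU)) n 1.
Qed.

Lemma map_sfr_extend U (x : L) : U \in unitmx -> map_mx (sfr U) (extend x) = extend x.
Proof. by move=> u; apply/matrixP => i j; rewrite !mxE (sfr_const _ u). Qed.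

(** A vector of weight k for the torus becomes homogeneous of degree -k in the
frame, which Pk k compensates. *)
Lemma generator_in_aLie (k : int) (x : L) : (2 %| k)%Z ->
  drho rhoP (sl2H C) x = k%:~R *: x ->
  in_aLie G P rhoP (Pk k *: Phi_rho P rhoP x).
Proof.
move=> k2 hx; have hw := torus_weight rho_action hx.
have E : Pk k *: Phi_rho P rhoP x = A *m (Pk k *: extend x) by rewrite scalemxAr.
have hZ U : U \in unitmx -> map_mx (sfr U) (Pk k *: extend x) = sfr U (Pk k) *: extend x.
  move=> u; have := map_mxZ (sfr_rmorphism u) (Pk k) (extend x).
  by rewrite (map_sfr_extend x u).
apply/in_aLieP; split=> [i|c c0|U hU].
- rewrite E; apply: mulmx_in_loc => [a b|a b]; first exact: A_in_loc.
  rewrite mxE mxE; apply: in_locM; last exact: in_loc_const.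
  exact: Pk_in_loc.
- rewrite E (map_sfrM _ _ (scalar_unit c0)) (hZ _ (scalar_unit c0)) (sfr_A_scaling c0).
  rewrite (Pk_deg Gpoly Pform Sexc Piform k2 c0) -mulmxA -scalemxAr.
  have cV0 : c^-1 != 0 by rewrite invr_eq0.
  rewrite (rho_extend rho_action x (det_torus cV0)) (hw _ cV0).
  have -> : extend (c^-1 ^ k *: x) = constK (c^-1 ^ k) *: extend x.
    by apply/matrixP => i j; rewrite !mxE linearZ constKM.
  congr (_ *m _); rewrite scalerA mulrAC -constKM exprz_inv -expfzDr // subrr expr0z.
  by rewrite constK1 mul1r.
- rewrite E (map_sfrM _ _ (BG_unit hU)) (hZ _ (BG_unit hU)) (sfr_A_BG hU).
  by rewrite (Pk_binv Gpoly Torbit Pform Sexc Piform k2 hU) mulmxA.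
Qed.

Variable bk : seq (L * int).
Hypothesis bk_basis : basis_of fullv [seq b.1 | b <- bk].
Hypothesis bk_weight : forall b, b \in bk -> drho rhoP (sl2H C) b.1 = b.2%:~R *: b.1.
Local Notation b0 := (0 : L, 0 : int).
Local Notation N := (size bk).
Local Notation x_ j := (nth b0 bk j).1.
Local Notation k_ j := (nth b0 bk j).2.

(** Coordinates over the rational functions in the basis bk; being defined over
C they commute with substitutions and preserve regularity. *)
Lemma bkK_expand : exists cK : nat -> LK -> K,
  [/\ forall j (a : nat -> K), cK j (\sum_(l < N) a l *: extend (x_ l)) =
        \sum_(l < N) a l * cK j (extend (x_ l)),
      forall g : LK, g = \sum_(j < N) cK j g *: extend (x_ j),
      forall i j, (i < N)%N -> (j < N)%N -> cK i (extend (x_ j)) = (i == j)%:R,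
      forall U j (g : LK), U \in unitmx -> sfr U (cK j g) = cK j (map_mx (sfr U) g) &
      forall j (g : LK), (forall i, in_loc P (g i 0)) -> in_loc P (cK j g)].
Proof.
have [cf [cfl cfE cfd]] := basis_coordinates b0 bk_basis.
exists (fun j (g : LK) => \sum_(i < n) g i 0 * constK (cf j e`_i)); split.
- move=> j a; under [RHS]eq_bigr do rewrite mulr_sumr.
  rewrite exchange_big; apply: eq_bigr => i _; rewrite summxE mulr_suml.
  by apply: eq_bigr => l _; rewrite mxE mulrA.
- move=> g; apply/matrixP => l z; rewrite (ord1 z) {z} summxE.
  transitivity (\sum_i g i 0 * extend e`_i l 0).
    rewrite (bigD1 l) //= extendE coord_e eqxx constK1 mulr1 big1 ?addr0 // => i ni.
    by rewrite extendE coord_e eq_sym (negbTE ni) constK0 mulr0.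
  transitivity (\sum_i \sum_(j < N) g i 0 * constK (cf j e`_i) * extend (x_ j) l 0).
    apply: eq_bigr => i _; rewrite {1}[e`_i]cfE extend_linear summxE mulr_sumr.
    by apply: eq_bigr => j _; rewrite mxE mulrA.
  rewrite exchange_big; apply: eq_bigr => j _ /=.
  by rewrite [RHS]mxE mulr_suml.
- move=> i j hi hj; rewrite -[RHS](rmorph_nat (@constK R)) -(cfd i j hi hj).
  rewrite [in RHS](e_expand (x_ j)).
  have -> : cf i (\sum_i0 coord e i0 (x_ j) *: e`_i0) = \sum_i0 coord e i0 (x_ j) * cf i e`_i0.
    have c0 : cf i 0 = 0 by have := cfl i (-1) 0 0; rewrite scaler0 addr0 mulN1r addNr.
    elim: (index_enum _) => [|l r IH]; first by rewrite !big_nil.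
    by rewrite !big_cons cfl IH.
  rewrite rmorph_sum; apply: eq_bigr => l _ /=.
  by rewrite extendE constKM.
- move=> U j g u.
  have sM a b : sfr U (a * b) = sfr U a * sfr U b := rmorphM (sfr_rmorphism u) a b.
  rewrite -[LHS](sfr_rmorphismE u) rmorph_sum; apply: eq_bigr => i _ /=.
  by rewrite sM (sfr_const _ u) mxE.
- move=> j g hg; apply: (in_loc_sum P0) => i _.
  by apply: in_locM; [exact: hg|exact: in_loc_const].
Qed.

Lemma Phi_rho_free (c : nat -> K) :
  \sum_(j < N) c j *: Phi_rho P rhoP (x_ j) = 0 -> forall j, (j < N)%N -> c j = 0.
Proof.
have [cK [cKl _ cKd _ _]] := bkK_expand; move=> h j hj.
have {}h : \sum_(j < N) c j *: extend (x_ j) = 0.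
  rewrite -[LHS]mul1mx -rPhi1VK -mulmxA mulmx_sumr.
  under eq_bigr do rewrite -scalemxAr.
  by rewrite h mulmx0.
have c0 : cK j 0 = 0.
  have := cKl j (fun=> 0); rewrite !big1 // => l _; first by rewrite mul0r.
  exact: scale0r.
have := congr1 (cK j) h; rewrite c0 cKl (bigD1 (Ordinal hj)) //= cKd // eqxx mulr1.
rewrite big1 ?addr0 // => l nl; rewrite cKd //.
by rewrite eq_sym (negbTE (nl : l != j :> nat)) mulr0.
Qed.

(** In the frame the twisted action of the binary group becomes plain
substitution, and homogeneity of degree 0 becomes degree k for the coordinate at
a vector of weight k. So the coordinates are the invariants that
eigen_coefficient describes. *)
Lemma aLie_expand f : in_aLie G P rhoP f -> exists2 r : nat -> K,
  (forall j, in_inv_ring G P (r j)) &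
  f = \sum_(j < N) r j *: (Pk (k_ j) *: Phi_rho P rhoP (x_ j)).
Proof.
move=> /in_aLieP[lf hf bf]; have [cK [cKl cKE cKd cKs cKloc]] := bkK_expand.
pose g := rK Phi1V *m f.
have fE : f = A *m g by rewrite mulmxA rPhi1K mul1mx.
have lg i : in_loc P (g i 0).
  apply: mulmx_in_loc => [a b|a b]; first exact: AV_in_loc.
  by rewrite (ord1 b).
have bg U : in_BG G U -> map_mx (sfr U) g = g.
  move=> hU; have := bf U hU; rewrite {1}fE (map_sfrM _ _ (BG_unit hU)) (sfr_A_BG hU) => h.
  have BC := rK_BGK hU; move: BC h.
  set B := rK (map_mx _ (invmx U)); set D := rK (map_mx _ U); set sg := map_mx _ g => BC h.
  have h2 : A *m sg = f.
    by rewrite -[LHS]mul1mx -BC -(mulmxA B D) (mulmxA D) h (mulmxA B) BC mul1mx.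
  by rewrite /g -h2 mulmxA rPhi1VK mul1mx.
have dg (c : C) : c != 0 -> forall j, (j < N)%N -> sfr c%:M (cK j g) = constK (c ^ k_ j) * cK j g.
  move=> c0 j hj; rewrite (cKs _ _ _ (scalar_unit c0)).
  set g' := map_mx (sfr c%:M) g.
  have := hf c c0; rewrite {1}fE (map_sfrM _ _ (scalar_unit c0)) (sfr_A_scaling c0) -/g' => h.
  have := congr1 (mulmx (rK Phi1V)) h; rewrite -/g !mulmxA rPhi1VK mul1mx => {}h.
  have cV0 : c^-1 != 0 by rewrite invr_eq0.
  have h2 : \sum_(j < N) (constK (c^-1 ^ k_ j) * cK j g') *: extend (x_ j) = g.
    rewrite -[RHS]h {2}[g']cKE mulmx_sumr; apply: eq_bigr => l _.
    rewrite -scalemxAr (rho_extend rho_action _ (det_torus cV0)).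
    rewrite (torus_weight rho_action (bk_weight (mem_nth b0 (ltn_ord l))) cV0).
    have -> : extend (c^-1 ^ k_ l *: x_ l) = constK (c^-1 ^ k_ l) *: extend (x_ l).
      by apply/matrixP => i z; rewrite !mxE linearZ constKM.
    by rewrite scalerA mulrC.
  have := congr1 (cK j) h2; rewrite (cKl j (fun j => constK (c^-1 ^ k_ j) * cK j g')).
  rewrite (bigD1 (Ordinal hj)) //= cKd // eqxx mulr1 big1 ?addr0 => [<-|l nl]; last first.
    by rewrite cKd // eq_sym (negbTE (nl : l != j :> nat)) mulr0.
  by rewrite mulrA -constKM exprz_inv -expfzDr // subrr expr0z constK1 mul1r.
have hr j : exists r, in_inv_ring G P r /\ ((j < N)%N -> cK j g = r * Pk (k_ j)).
  case: (ltnP j N) => hj; last first.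
    exists 0; split=> //; rewrite -constK0; exact: (in_inv_ring_const Gpoly Pform).
  have [||r hr e1] := @eigen_coefficient _ _ Gpoly _ _ Torbit Pform _ _ _ Sexc _ Piform
     (k_ j) (cK j g) (cKloc j g lg).
  - by move=> c c0; apply: dg.
  - by move=> U hU; rewrite (cKs _ _ _ (BG_unit hU)) (bg U hU).
  by exists r.
have [r rE] := choice hr; exists r; first by move=> j; case: (rE j).
rewrite fE {1}[g]cKE mulmx_sumr; apply: eq_bigr => j _.
have [_ ->] := rE j; last exact: ltn_ord.
by rewrite -scalemxAr scalerA.
Qed.

Theorem aLie_free_basis I : is_inv_generator G P I ->
  is_free_basis I [seq y <- [seq Pk b.2 *: Phi_rho P rhoP b.1 | b <- bk] | y != 0]
    (in_aLie G P rhoP).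
Proof.
move=> [hI Iinj]; set gs := [seq _ | b <- bk]; set ngs := [seq _ <- gs | _].
have gs_mem y : y \in ngs -> in_aLie G P rhoP y.
  rewrite mem_filter => /andP[y0 /mapP[b hb yE]]; rewrite yE in y0 *.
  case: (boolP (2 %| b.2)%Z) => k2; first exact: generator_in_aLie (bk_weight hb).
  by rewrite (Pk_odd _ _ _ _ _ k2) scale0r eqxx in y0.
split=> [f|c hc j].
  split=> [/aLie_expand[r hr ->]|[c ->]]; last first.
    elim/big_ind: _ => //; [exact: in_aLie0|exact: in_aLieD|move=> j _].
    by apply: in_aLieZ; [apply/hI; exists (c j)|apply: gs_mem; apply: mem_nth].
  have [c' hc' ->] := drop_zero_span b0 (fun b => Phi_rho P rhoP b.1) (fun b => Pk b.2) bk hr.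
  have [q qE] := choice (fun j => proj1 (hI (c' j)) (hc' j)).
  by exists (fun j => q j); apply: eq_bigr => j _; rewrite -qE.
apply: Iinj.
have := drop_zero_free (b0 := b0) (F := fun b => Phi_rho P rhoP b.1) (a := fun b => Pk b.2)
  Phi_rho_free (c := fun j => if insub j is Some i then evalC I (c i) else 0).
rewrite -/gs -/ngs => h; have := h _ j (ltn_ord j); rewrite valK; apply.
by rewrite -[RHS]hc; apply: eq_bigr => i _; rewrite valK.
Qed.
End FreeModule.

(** * Roots, weights and the brackets *)

Section CartanWeights.
Variable F : numFieldType.
Variables (L : vectType F) (br : L -> L -> L).
Hypothesis Lie : is_lie_bracket br.
Variables (h : {vspace L}) (N : nat).
Local Notation dual := ('Hom(subvs_of h, F^o)).
Variables (Phi : seq dual) (Delta : 'I_N -> dual) (Hs : 'I_N -> subvs_of h)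
  (Hc : dual -> subvs_of h) (A : dual -> L) (eps : dual -> dual -> F).
Hypothesis hrank : \dim h = N.
Hypothesis Phiroots : is_root_system br Phi.
Hypothesis chev : is_chevalley_basis br Phi Delta Hs Hc A eps.
Variables (D : L -> L) (h0 : subvs_of h) (k : dual -> int).
Hypothesis Had : forall x, D x = br (vsval h0) x.
Hypothesis kH : forall a, a \in Phi -> D (A a) = (k a)%:~R *: A a.

Lemma Hs_free : free [seq vsval (Hs i) | i : 'I_N].
Proof. exact: catl_free (basis_free (chev_basis chev)). Qed.

Lemma Hs_span : <<[seq vsval (Hs i) | i : 'I_N]>>%VS = h.
Proof.
apply/eqP; rewrite eqEdim; apply/andP; split.
  by apply/span_subvP => _ /mapP[i _ ->]; apply: subvsP.
by rewrite (eqP Hs_free) size_map size_enum_ord hrank.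
Qed.

Lemma cartan_expand (y : subvs_of h) : exists c : 'I_N -> F, y = \sum_i c i *: Hs i.
Proof.
have : vsval y \in <<[seq vsval (Hs i) | i : 'I_N]>>%VS by rewrite Hs_span subvsP.
have sz : size [seq vsval (Hs i) | i : 'I_N] == N by rewrite size_map size_enum_ord.
rewrite -[X in <<X>>%VS]/(tval (Tuple sz)) => /coord_span e.
exists (fun i => coord (Tuple sz) i (vsval y)); apply: val_inj.
rewrite /= raddf_sum {1}e; apply: eq_bigr => i _ /=.
by rewrite (nth_map i) ?size_enum_ord // nth_ord_enum.
Qed.

Lemma A_neq0 a : a \in Phi -> A a != 0.
Proof.
move=> aP; have := free_not0 (v := A a) (basis_free (chev_basis chev)); apply.
by rewrite mem_cat map_f ?orbT.
Qed.

Lemma br_Hsum (c : 'I_N -> F) (x : L) : br (vsval (\sum_i c i *: Hs i)) x =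
  \sum_i c i *: br (vsval (Hs i)) x.
Proof. by rewrite -(br_suml Lie) raddf_sum. Qed.

(** The H-eigenvalue of a root vector is the value of the root at the element of
the Cartan subalgebra representing H, so it is additive. *)
Lemma weightE a : a \in Phi -> (k a)%:~R = a h0 :> F.
Proof.
move=> aP; have [c hc] := cartan_expand h0.
have e : (k a)%:~R *: A a = (a h0 : F) *: A a.
  have -> : (a h0 : F) = \sum_i c i * (a (Hs i) : F).
    by rewrite hc linear_sum; apply: eq_bigr => i _; exact: (linearZ_LR a).
  rewrite -kH // Had hc br_Hsum scaler_suml; apply: eq_bigr => i _.
  by rewrite (chev_HA chev) // scalerA.
have /eqP := e; rewrite -subr_eq0 -scalerBl scaler_eq0 (negbTE (A_neq0 aP)) orbF.
by rewrite subr_eq0 => /eqP.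
Qed.

(** The coroot of a is a bracket of root vectors for a and -a, so a vector for
-a cannot vanish. *)
Lemma opp_root a : a \in Phi -> - a \in Phi.
Proof.
move=> aP; have [ay [x [z [hx hz e]]]] := chev_coroot chev aP.
have [a0 _] := proj1 (proj2 Phiroots a) aP.
apply/(proj2 Phiroots); split; first by rewrite oppr_eq0.
exists z => //; apply/negP => /eqP z0.
have y0 : Hc a = 0 by apply: val_inj; rewrite /= e z0 (br0r Lie).
by move: ay; rewrite y0 linear0 => /eqP; rewrite eq_sym pnatr_eq0.
Qed.

Lemma weight_add a b : a \in Phi -> b \in Phi -> a + b \in Phi -> k (a + b) = k a + k b.
Proof.
move=> aP bP abP; apply: (@intr_inj F); rewrite rmorphD /= !weightE //.
by rewrite add_lfunE.
Qed.

Lemma weight_opp a : a \in Phi -> k (- a) = - k a.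
Proof.
move=> aP; apply: (@intr_inj F); rewrite rmorphN /= !weightE ?opp_root //.
by rewrite opp_lfunE.
Qed.

Lemma Hs_weight i : D (vsval (Hs i)) = 0.
Proof.
have [c hc] := cartan_expand h0.
by rewrite Had hc br_Hsum big1 // => j _; rewrite (chev_HH chev) scaler0.
Qed.
End CartanWeights.

Section Final.
Variable R : realType.
Local Notation C := (R[i]).
Local Notation K := {fraction {mpoly C[2]}}.
Variables (L : vectType C) (rhoP : 'M[{mpoly C[(2 * 2)]}]_(\dim {:L})).
Variable P : {mpoly C[2]}.
Local Notation e := (vbasis {:L}).

Lemma extendZ (c : C) (x : L) : extend (c *: x) = constK c *: extend x.
Proof. by apply/matrixP => i j; rewrite !mxE linearZ constKM. Qed.

Lemma Phi_rhoZ (c : C) (x : L) : Phi_rho P rhoP (c *: x) = constK c *: Phi_rho P rhoP x.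
Proof. by rewrite /Phi_rho extendZ -scalemxAr. Qed.

Lemma Phi_rho0 : Phi_rho P rhoP (0 : L) = 0.
Proof. by rewrite -[0 in LHS](scale0r (0 : L)) Phi_rhoZ constK0 scale0r. Qed.
End Final.

Theorem theorem3p5 (R : realType)
    (L : vectType R[i]) (br : L -> L -> L) (Lsimple : is_simple_lie br)
    (rho : 'M[R[i]]_2 -> 'End(L))
    (rhoP : 'M[{mpoly R[i][(2 * 2)]}]_(\dim {:L}))
    (rho_action : is_sl2_action br rhoP rho)
    (G : seq 'M[R]_3) (Gpoly : is_polyhedral G)
    (Omega : finType) (S : Omega -> seq {vspace 'cV[R[i]]_2})
    (nu : Omega -> nat) (Sexc : is_exceptional_orbits G S nu)
    (Pi : Omega -> {mpoly R[i][2]})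
    (Piform : forall i, is_ground_form (S i) (Pi i))
    (T : seq {vspace 'cV[R[i]]_2}) (Torbit : is_orbit G T)
    (P : {mpoly R[i][2]}) (Pform : is_orbit_form G T P)
    (h : {vspace L}) (hcartan : is_cartan br h)
    (Had : exists h0 : subvs_of h,
       forall x, drho rhoP (sl2H R[i]) x = br (vsval h0) x)
    (N : nat) (hrank : \dim h = N)
    (Phi : seq 'Hom(subvs_of h, R[i]^o)) (Phiroots : is_root_system br Phi)
    (Delta : 'I_N -> 'Hom(subvs_of h, R[i]^o))
    (Hs : 'I_N -> subvs_of h)
    (Hc : 'Hom(subvs_of h, R[i]^o) -> subvs_of h)
    (A : 'Hom(subvs_of h, R[i]^o) -> L)
    (eps : 'Hom(subvs_of h, R[i]^o) -> 'Hom(subvs_of h, R[i]^o) -> R[i])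
    (chevalley : is_chevalley_basis br Phi Delta Hs Hc A eps)
    (k : 'Hom(subvs_of h, R[i]^o) -> int) (k0 : k 0 = 0)
    (kH : forall a, a \in Phi ->
       drho rhoP (sl2H R[i]) (A a) = (k a)%:~R *: A a) :
  let hh (i : 'I_N) := Phi_rho P rhoP (vsval (Hs i)) in
  let hc (a : 'Hom(subvs_of h, R[i]^o)) := Phi_rho P rhoP (vsval (Hc a)) in
  let aa (a : 'Hom(subvs_of h, R[i]^o)) :=
    Pk G P S nu Pi (k a) *: Phi_rho P rhoP (A a) in
  let gens := [seq hh i | i : 'I_N] ++ [seq aa a | a <- Phi] in
  [/\ exists I, is_inv_generator G P I,
      forall I, is_inv_generator G P I ->
        is_free_basis I [seq b <- gens | b != 0] (in_aLie G P rhoP),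
      [/\ forall i j, brK br (hh i) (hh j) = 0,
          forall i a, a \in Phi ->
            brK br (hh i) (aa a) = constK (a (Hs i)) *: aa a,
          forall a, a \in Phi -> (2 %| k a)%Z ->
            brK br (aa a) (aa (- a)) = I_omega P nu Pi k a (- a) *: hc a,
          forall a b, a \in Phi -> b \in Phi -> a + b \in Phi ->
            (2 %| k a)%Z -> (2 %| k b)%Z ->
            brK br (aa a) (aa b) =
              (constK (eps a b) * I_omega P nu Pi k a b) *: aa (a + b)
        & forall a b, a \in Phi -> b \in Phi -> a + b \notin 0 :: Phi ->
            brK br (aa a) (aa b) = 0]
    & forall i, is_symmetric_2cocycle
        (fun a b : 'Hom(subvs_of h, R[i]^o) => omega2 nu k a b i)].
Proof.
move=> hh hc aa gens.
have Lie := simple_lie Lsimple.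
have [h0 Hh0] := Had.
have kE a (aP : a \in Phi) := weightE Lie hrank chevalley Hh0 kH aP.
have kD a b (aP : a \in Phi) (bP : b \in Phi) (abP : a + b \in Phi) :=
  weight_add Lie hrank chevalley Hh0 kH aP bP abP.
have kN a (aP : a \in Phi) := weight_opp Lie hrank Phiroots chevalley Hh0 kH aP.
have dPhi1 := det_Phi1 Gpoly Pform.
have brP x y : brK br (Phi_rho P rhoP x) (Phi_rho P rhoP y) = Phi_rho P rhoP (br x y).
  by rewrite /Phi_rho (brK_rho Lie rho_action _ _ dPhi1) (brK_extend Lie).
have Pk0 : Pk G P S nu Pi 0 = 1.
  have n0 i : nres nu 0 i = 0 by rewrite /nres div0z mod0z.
  have l0 : ell G S nu 0 = 0 by rewrite /ell big1 ?subrr ?div0z // => i _; rewrite n0 mul0r.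
  by rewrite /Pk dvdz0 l0 expr0z mul1r big1 // => i _; rewrite n0 expr0z.
have br_scaled a b x y :
    brK br (a *: Phi_rho P rhoP x) (b *: Phi_rho P rhoP y) =
    (a * b) *: Phi_rho P rhoP (br x y).
  by rewrite brKZ brP.
split.
- exact: (inv_generator_exists Gpoly Torbit Pform Sexc Piform).
- move=> I hI.
  pose bk := [seq (vsval (Hs i), 0 : int) | i : 'I_N] ++ [seq (A a, k a) | a <- Phi].
  have bk1 : [seq b.1 | b <- bk] = [seq vsval (Hs i) | i : 'I_N] ++ [seq A a | a <- Phi].
    by rewrite map_cat; congr (_ ++ _); rewrite -map_comp; apply: eq_map.
  have bkw b : b \in bk -> drho rhoP (sl2H R[i]) b.1 = b.2%:~R *: b.1.
    rewrite mem_cat => /orP[/mapP[i _ ->]|/mapP[a aP ->]] /=; last exact: kH.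
    by rewrite (Hs_weight Lie hrank chevalley Hh0) scale0r.
  have bkb : basis_of fullv [seq b.1 | b <- bk] by rewrite bk1; apply: chev_basis chevalley.
  have -> : gens = [seq Pk G P S nu Pi b.2 *: Phi_rho P rhoP b.1 | b <- bk].
    rewrite map_cat; congr (_ ++ _); rewrite -map_comp; apply: eq_map => i //=.
    by rewrite Pk0 scale1r.
  exact: (aLie_free_basis Gpoly Torbit Pform Sexc Piform rho_action bkb bkw hI).
- split.
  + by move=> i j; rewrite brP (chev_HH chevalley) Phi_rho0.
  + move=> i a aP; rewrite /hh /aa -[Phi_rho P rhoP (vsval (Hs i))]scale1r br_scaled.
    by rewrite mul1r (chev_HA chevalley) // Phi_rhoZ !scalerA mulrC.
  + move=> a aP k2; rewrite br_scaled (chev_AAN chevalley) //; congr (_ *: _).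
    have k2' : (2 %| k (- a))%Z by rewrite kN // rpredN.
    have kS : k (a + - a) = k a + k (- a) by rewrite kN // !subrr k0.
    by rewrite (PkM Gpoly Pform Sexc Piform k2 k2' kS) subrr k0 Pk0 mulr1.
  + move=> a b aP bP abP ka kb; rewrite br_scaled (chev_AA chevalley) // Phi_rhoZ !scalerA.
    congr (_ *: _); rewrite (PkM Gpoly Pform Sexc Piform ka kb (kD a b aP bP abP)).
    by rewrite mulrAC [constK _ * _]mulrC.
  + by move=> a b aP bP ab; rewrite br_scaled (chev_AA0 chevalley) // Phi_rho0 scaler0.
- move=> i; split=> [a b|a b c]; rewrite /omega2 /coboundary.
    by rewrite [b + a]addrC; ring.
  by rewrite !addrA; ring.
Qed.
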